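(* Let $a=a(x,\xi)\in C^\infty(\mathbb{R}^n\times\mathbb{R}^n)$ be $2\pi$-periodic with respect to $x$ (in each coordinate) for every $\xi\in\mathbb{R}^n$. Assume that for every $\alpha,\beta\in\mathbb{N}_0^n$ there are constants $C_{\alpha\beta}$ and $M(\alpha,\beta)$ such that $$|\partial_x^\alpha\partial_\xi^\beta a(x,\xi)|\le C_{\alpha\beta}\langle\xi\rangle^{M(\alpha,\beta)}$$ holds for all $x,\xi\in\mathbb{R}^n$. Let $\widetilde a=a|_{\mathbb{T}^n\times\mathbb{Z}^n}$. Then $$\mathcal{P}\bigl(a(X,D)f\bigr)=\widetilde a(X,D)\bigl(\mathcal{P}f\bigr)$$ for all $f\in\mathcal{S}(\mathbb{R}^n)$.
   Context: $\mathbb{T}^n=(\mathbb{R}/2\pi\mathbb{Z})^n$; functions on $\mathbb{T}^n$ are identified with $2\pi$-periodic functions on $\mathbb{R}^n$. $\langle\xi\rangle=(1+|\xi|^2)^{1/2}$. The measure is normalised by writing $(2\pi)^{-n}\,\mathrm{d}y$. $\mathcal{S}(\mathbb{R}^n)$ is the Schwartz space. Euclidean Fourier transform: $(\mathcal{F}_{\mathbb{R}^n}f)(\xi)=\int_{\mathbb{R}^n}e^{-ix\cdot\xi}f(x)\,(2\pi)^{-n}\mathrm{d}x$. Toroidal Fourier transform: $(\mathcal{F}_{\mathbb{T}^n}g)(\xi)=\int_{\mathbb{T}^n}e^{-ix\cdot\xi}g(x)\,(2\pi)^{-n}\mathrm{d}x$ for $\xi\in\mathbb{Z}^n$ (integral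 over the cube $[0,2\pi)^n$). For $f\in\mathcal{S}(\mathbb{R}^n)$: $a(X,D)f(x)=\int_{\mathbb{R}^n}e^{ix\cdot\xi}a(x,\xi)(\mathcal{F}_{\mathbb{R}^n}f)(\xi)\,\mathrm{d}\xi$. For $g\in C^\infty(\mathbb{T}^n)$: $\widetilde a(X,D)g(x)=\sum_{\xi\in\mathbb{Z}^n}e^{ix\cdot\xi}\,\widetilde a(x,\xi)(\mathcal{F}_{\mathbb{T}^n}g)(\xi)$. Periodization: $\mathcal{P}f(x)=\sum_{k\in\mathbb{Z}^n}f(x+2\pi k)$, a map $\mathcal{S}(\mathbb{R}^n)\to C^\infty(\mathbb{T}^n)$. (Under the hypotheses $a(X,D)$ maps $\mathcal{S}(\mathbb{R}^n)$ to itself.) *)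

(* Defs.v *)
From HB Require Import structures.
From mathcomp Require Import all_boot all_order all_algebra.
From mathcomp Require Import complex.
From mathcomp Require Import all_classical all_reals all_analysis.

Set Implicit Arguments.
Unset Strict Implicit.
Unset Printing Implicit Defensive.

Import Order.TTheory GRing.Theory Num.Theory.
Import numFieldNormedType.Exports.

Local Open Scope classical_set_scope.
Local Open Scope ring_scope.
Local Open Scope complex_scope.

Section lebesgue_cons.
Context (R : realType) (n : nat).

Definition consp (p : R * n.-tuple R) : n.+1.-tuple R :=
  [the n.+1.-tuple R of p.1 :: p.2].

Lemma measurable_consp : measurable_fun [set: R * n.-tuple R] consp.
Proof. by apply: measurable_cons. Qed.

Definition lebesgue_cons (mu : {sigma_finite_measure set (n.-tuple R) -> \bar R})
  : set (n.+1.-tuple R) -> \bar R :=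
  pushforward (@lebesgue_measure R \x mu)%E consp.

Variable mu : {sigma_finite_measure set (n.-tuple R) -> \bar R}.

Let lebesgue_cons0 : lebesgue_cons mu set0 = 0%E.
Proof. by rewrite /lebesgue_cons /pushforward preimage_set0 measure0. Qed.

Let lebesgue_cons_ge0 A : (0 <= lebesgue_cons mu A)%E.
Proof. by rewrite /lebesgue_cons /pushforward measure_ge0. Qed.

Let lebesgue_cons_sigma_additive : semi_sigma_additive (lebesgue_cons mu).
Proof.
move=> F mF tF mUF; rewrite /lebesgue_cons /pushforward preimage_bigcup.
apply: measure_semi_sigma_additive.
- move=> k; rewrite -[X in measurable X]setTI; exact: measurable_consp.
- apply/trivIsetP => /= i j _ _ ij; rewrite -preimage_setI.
  by move/trivIsetP : tF => /(_ _ _ _ _ ij) ->//; rewrite preimage_set0.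
- rewrite -preimage_bigcup -[X in measurable X]setTI; exact: measurable_consp.
Qed.

HB.instance Definition _ := isMeasure.Build _ _ _ (lebesgue_cons mu)
  lebesgue_cons0 lebesgue_cons_ge0 lebesgue_cons_sigma_additive.

Let lebesgue_cons_sigma_finite : sigma_finite setT (lebesgue_cons mu).
Proof.
have /sigma_finiteP[F [FT ndF Foo]] := sigma_finiteT (@lebesgue_measure R).
have /sigma_finiteP[G [GT ndG Goo]] := sigma_finiteT mu.
pose g (t : n.+1.-tuple R) : R * n.-tuple R := (tnth t ord0, [tuple of behead t]).
have mg : measurable_fun setT g.
  by apply: measurable_fun_pair;
    [exact: measurable_tnth|exact: measurable_behead].
have gK : g \o consp = id.
  by apply/funext => -[x t]; congr pair => //; exact: val_inj.
exists (fun k => g @^-1` (F k `*` G k)).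
  apply/esym; rewrite -subTset => t _.
  have [i _ Fi] : (\bigcup_i F i) (g t).1 by rewrite -FT.
  have [j _ Gj] : (\bigcup_i G i) (g t).2 by rewrite -GT.
  exists (maxn i j) => //; split.
    by move: Fi; exact/subsetPset/ndF/leq_maxl.
  by move: Gj; exact/subsetPset/ndG/leq_maxr.
move=> k; have [mF Fk] := Foo k; have [mG Gk] := Goo k; split.
  by rewrite -[X in measurable X]setTI; apply: mg => //; exact: measurableX.
rewrite /lebesgue_cons /pushforward -comp_preimage gK preimage_id.
by rewrite product_measure1E// lte_mul_pinfty// ge0_fin_numE.
Qed.

HB.instance Definition _ := @Measure_isSigmaFinite.Build _ _ _
  (lebesgue_cons mu) lebesgue_cons_sigma_finite.

End lebesgue_cons.

(* Lebesgue measure on R^n (on tuples, where the library puts the product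
   sigma-algebra), as an iterated product of one-dimensional ones. *)
Fixpoint lebesgue (R : realType) (n : nat) :
    {sigma_finite_measure set (n.-tuple R) -> \bar R} :=
  match n with
  | 0 => dirac [tuple]
  | m.+1 => lebesgue_cons (lebesgue R m)
  end.

Section toroidal.
Context {R : realType}.
Implicit Types n : nat.

Definition twopi : R := 2 * pi.

Definition expi (t : R) : R[i] := cos t +i* sin t.

Definition dot n (x y : 'rV[R]_n) : R := \sum_(i < n) x 0 i * y 0 i.

Definition japanese n (xi : 'rV[R]_n) : R := Num.sqrt (1 + dot xi xi).

Definition latv n (k : 'rV[int]_n) : 'rV[R]_n := map_mx intr k.

Definition rV_of_tuple n (t : n.-tuple R) : 'rV[R]_n := \row_i tnth t i.

(* The value is meaningful when the real and imaginary parts of [f] are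
   integrable on [D]. *)
Definition cintegral n (D : set 'rV[R]_n) (f : 'rV[R]_n -> R[i]) : R[i] :=
  let D' := @rV_of_tuple n @^-1` D in
  (\int[lebesgue R n]_(t in D') complex.Re (f (rV_of_tuple t))) +i*
  (\int[lebesgue R n]_(t in D') complex.Im (f (rV_of_tuple t))).

(* Sum of an absolutely summable family; the library's [esum] only covers
   nonnegative families. *)
Definition rsum (T : choiceType) (F : T -> R) : R :=
  fine (\esum_(k in [set: T]) (EFin \o F)^\+ k)%E -
  fine (\esum_(k in [set: T]) (EFin \o F)^\- k)%E.

Definition csum (T : choiceType) (F : T -> R[i]) : R[i] :=
  rsum (fun k => complex.Re (F k)) +i* rsum (fun k => complex.Im (F k)).

Definition basis_vec n (i : 'I_n) : 'rV[R]_n := delta_mx 0 i.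

(* [R[i]] carries no normed structure over [R] in the library, so
   differentiation acts on real and imaginary parts. *)
Definition partial n (i : 'I_n) (f : 'rV[R]_n -> R[i]) : 'rV[R]_n -> R[i] :=
  fun x => ('D_(basis_vec i) (@complex.Re R \o f) x) +i*
           ('D_(basis_vec i) (@complex.Im R \o f) x).

Definition partials n (s : seq 'I_n) (f : 'rV[R]_n -> R[i]) :
    'rV[R]_n -> R[i] :=
  foldr (@partial n) f s.

Definition mpartial n (alpha : 'I_n -> nat) (f : 'rV[R]_n -> R[i]) :
    'rV[R]_n -> R[i] :=
  foldr (fun i => iter (alpha i) (partial i)) f (enum 'I_n).

(* C^oo: the iterated partial derivatives, in any order, exist and are
   continuous. *)
Definition smooth n (f : 'rV[R]_n -> R[i]) : Prop :=
  forall s : seq 'I_n,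
    [/\ continuous (@complex.Re R \o partials s f : 'rV[R]_n -> R),
        continuous (@complex.Im R \o partials s f : 'rV[R]_n -> R) &
        forall (i : 'I_n) (x : 'rV[R]_n),
          derivable (@complex.Re R \o partials s f) x (basis_vec i) /\
          derivable (@complex.Im R \o partials s f) x (basis_vec i)].

Definition smooth2 n (a : 'rV[R]_n -> 'rV[R]_n -> R[i]) : Prop :=
  smooth (fun z : 'rV[R]_(n + n) => a (lsubmx z) (rsubmx z)).

Definition monomial n (alpha : 'I_n -> nat) (x : 'rV[R]_n) : R :=
  \prod_(i < n) x 0 i ^+ alpha i.

Definition schwartz n (f : 'rV[R]_n -> R[i]) : Prop :=
  smooth f /\
  forall alpha beta : 'I_n -> nat, exists C : R, forall x : 'rV[R]_n,
    `| (monomial alpha x)%:C * mpartial beta f x | <= C%:C.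

Definition fourierR n (f : 'rV[R]_n -> R[i]) (xi : 'rV[R]_n) : R[i] :=
  cintegral setT (fun x => expi (- dot x xi) * f x * (twopi ^- n)%:C).

Definition torus_cube n : set 'rV[R]_n :=
  [set x | forall i, 0 <= x 0 i < twopi].

(* Functions on the torus are represented by 2pi-periodic functions. *)
Definition fourierT n (g : 'rV[R]_n -> R[i]) (xi : 'rV[int]_n) : R[i] :=
  cintegral (@torus_cube n)
    (fun x => expi (- dot x (latv xi)) * g x * (twopi ^- n)%:C).

Definition psdoR n (a : 'rV[R]_n -> 'rV[R]_n -> R[i]) (f : 'rV[R]_n -> R[i]) :
    'rV[R]_n -> R[i] :=
  fun x => cintegral setT (fun xi => expi (dot x xi) * a x xi * fourierR f xi).

Definition psdoT n (a : 'rV[R]_n -> 'rV[int]_n -> R[i])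
    (g : 'rV[R]_n -> R[i]) : 'rV[R]_n -> R[i] :=
  fun x => csum (fun xi : 'rV[int]_n =>
    expi (dot x (latv xi)) * a x xi * fourierT g xi).

Definition periodization n (f : 'rV[R]_n -> R[i]) : 'rV[R]_n -> R[i] :=
  fun x => csum (fun k : 'rV[int]_n => f (x + twopi *: latv k)).

Definition symbol_restriction n (a : 'rV[R]_n -> 'rV[R]_n -> R[i]) :
    'rV[R]_n -> 'rV[int]_n -> R[i] :=
  fun x xi => a x (latv xi).

End toroidal.

(* Main.v *)
Require Import Defs.
From mathcomp Require Import all_boot all_order all_algebra.
From mathcomp Require Import complex.
From mathcomp Require Import all_classical all_reals all_analysis.
From mathcomp Require Import measurable_realfun.
From mathcomp Require Import ring lra zify.

Set Implicit Arguments.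
Unset Strict Implicit.
Unset Printing Implicit Defensive.

Import Order.TTheory GRing.Theory Num.Theory.
Import numFieldNormedType.Exports.

Local Open Scope classical_set_scope.
Local Open Scope ring_scope.
Local Open Scope complex_scope.

(* For fixed [x], set [h xi = a x xi * fhat xi] and write [u z] for the integral of
   [e^(i z.xi) h xi].  Since [a] is periodic in [x], the left-hand side at [x] is the sum
   over [k] of [u (x + 2 pi k)], while unfolding the integral over the torus gives
   [fourierT (P f) m = fhat m], so that the right-hand side is the sum over [m] of
   [e^(i x.m) h m].  The theorem is therefore the Poisson summation formula for
   [H xi = e^(i x.xi) h xi].

   The Fourier coefficients of the 1-periodization of [H] are absolutely summable because
   [h] decays rapidly together with its pure derivatives.  Testing [H] against the Fejer
   kernel [F_N = (N+1)^-n |\sum_(p in box) e^(2 pi i p.t)|^2] gives on one side the sum of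
   the Fourier coefficients weighted by [c_N(k) = \prod_i max(0, 1 - |k_i| / (N+1))], and on
   the other side, unfolding into unit cubes centered at lattice points, averages of [H]
   near each lattice point; both converge dominatedly as [N] tends to infinity. *)

(** * Complex modulus and exponentials *)

(** Absolute summability of the Fourier coefficients does not identify the lattice sum of H; that
    takes an inversion argument, and the Fejer kernel keeps it elementary. The kernel is a finite
    trigonometric polynomial, so testing H against it exchanges sum and integral by finite linearity
    alone. It is nonnegative with mass 1 on a period, unlike the Dirichlet kernel, so Fejer means
    obey the bounds of the function averaged, uniformly in N. Hence the bound of H by a multiple of
    [sumdecay], which is summable over the lattice, gives one majorant for all N, and both limits
    are cases of dominated convergence for the counting measure.

    Of H itself only continuity and this bound are used. Decay of its transform rests on two
    exchanges, of d/dz_j with multiplication by i y_j and of multiplication by z_j with d/dy_j. Both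
    are proved with explicit quadratic remainders integrated against [sumdecay].

    The factor (2 pi)^-n sits in both forward transforms, so fhat at an integer point is exactly the
    toroidal coefficient. Poisson summation is done on the unit lattice, with 2 pi in the phase, and
    carries no constant. *)

Section l1_modulus.
Variable R : realType.
Implicit Types z u : R[i].

(* With the l1 modulus (still submultiplicative), [l1C (\int F) <= \int l1C F] follows from
   the real case applied to the real and imaginary parts. *)
Definition l1C z : R := `|complex.Re z| + `|complex.Im z|.

Lemma cReD z u : complex.Re (z + u) = complex.Re z + complex.Re u.
Proof. by case: z u => ? ? []. Qed.

Lemma cImD z u : complex.Im (z + u) = complex.Im z + complex.Im u.
Proof. by case: z u => ? ? []. Qed.

Lemma cReN z : complex.Re (- z) = - complex.Re z.
Proof. by case: z. Qed.

Lemma cImN z : complex.Im (- z) = - complex.Im z.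
Proof. by case: z. Qed.

Lemma cReM z u : complex.Re (z * u) =
  complex.Re z * complex.Re u - complex.Im z * complex.Im u.
Proof. by case: z u => ? ? []. Qed.

Lemma cImM z u : complex.Im (z * u) =
  complex.Re z * complex.Im u + complex.Im z * complex.Re u.
Proof. by case: z u => ? ? []. Qed.

Definition cReImE := (cReD, cImD, cReN, cImN, cReM, cImM).

Lemma cRe_sum (I : Type) (r : seq I) (P : pred I) (F : I -> R[i]) :
  complex.Re (\sum_(i <- r | P i) F i) = \sum_(i <- r | P i) complex.Re (F i).
Proof. by rewrite (big_morph _ cReD (erefl : complex.Re (0 : R[i]) = 0)). Qed.

Lemma cIm_sum (I : Type) (r : seq I) (P : pred I) (F : I -> R[i]) :
  complex.Im (\sum_(i <- r | P i) F i) = \sum_(i <- r | P i) complex.Im (F i).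
Proof. by rewrite (big_morph _ cImD (erefl : complex.Im (0 : R[i]) = 0)). Qed.

Lemma complex_eqP z u :
  complex.Re z = complex.Re u -> complex.Im z = complex.Im u -> z = u.
Proof. by case: z u => ? ? [? ?] /= -> ->. Qed.

Lemma l1C_ge0 z : 0 <= l1C z. Proof. by rewrite addr_ge0. Qed.

Lemma l1C0 : l1C 0 = 0. Proof. by rewrite /l1C /= normr0 addr0. Qed.

Lemma l1C_real (x : R) : l1C x%:C = `|x|.
Proof. by rewrite /l1C /= normr0 addr0. Qed.

Lemma l1CN z : l1C (- z) = l1C z.
Proof. by rewrite /l1C !cReImE !normrN. Qed.

Lemma l1CD z u : l1C (z + u) <= l1C z + l1C u.
Proof.
by rewrite /l1C !cReImE addrACA lerD// ler_normD.
Qed.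

Lemma l1CB z u : l1C (z - u) <= l1C z + l1C u.
Proof. by rewrite -(l1CN u) l1CD. Qed.

Lemma l1CM z u : l1C (z * u) <= l1C z * l1C u.
Proof.
rewrite /l1C !cReImE mulrDl !mulrDr -!normrM.
apply: (le_trans (lerD (ler_normB _ _) (ler_normD _ _))); lra.
Qed.

Lemma l1CM_real (x : R) z : l1C (x%:C * z) = `|x| * l1C z.
Proof. by rewrite /l1C !cReImE /= !mul0r subr0 addr0 !normrM mulrDr. Qed.

Lemma l1CMi z : l1C ('i * z) = l1C z.
Proof. by rewrite /l1C !cReImE /= !mul0r !mul1r sub0r add0r normrN addrC. Qed.

Lemma normRe_l1C z : `|complex.Re z| <= l1C z. Proof. by rewrite lerDl. Qed.
Lemma normIm_l1C z : `|complex.Im z| <= l1C z. Proof. by rewrite lerDr. Qed.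

Lemma l1C_eq0 z : l1C z <= 0 -> z = 0.
Proof.
move=> h; apply: complex_eqP => /=; apply/eqP; rewrite -normr_le0.
  exact: le_trans (normRe_l1C _) h.
exact: le_trans (normIm_l1C _) h.
Qed.

(** Passage from the complex modulus, in which the Schwartz and symbol bounds are stated, to [l1C];
    the modulus dominates the real and imaginary parts separately. *)
Lemma l1C_le_norm z (c : R) : `|z| <= c%:C -> l1C z <= 2 * c.
Proof.
rewrite normc_def lecR => h; rewrite /l1C mulr_natl mulr2n.
by apply: lerD; apply: le_trans h; rewrite -sqrtr_sqr ler_wsqrtr// ?lerDl ?lerDr sqr_ge0.
Qed.

End l1_modulus.

Section expi.
Variable R : realType.
Implicit Types s t : R.

Lemma expiD s t : expi (s + t) = expi s * expi t.
Proof.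
by apply: complex_eqP; rewrite !cReImE /= (sinD, cosD)//; rewrite addrC.
Qed.

Lemma expi0 : expi (0 : R) = 1.
Proof. by rewrite /expi cos0 sin0. Qed.

Lemma l1C_expi t : l1C (expi t) <= 2.
Proof.
by apply: lerD => /=; rewrite ler_norml (cos_geN1, sin_geN1) (cos_le1, sin_le1).
Qed.

Lemma l1C_expiM t z : l1C (expi t * z) <= 2 * l1C z.
Proof.
by apply: (le_trans (l1CM _ _)); rewrite ler_wpM2r ?l1C_ge0// l1C_expi.
Qed.

(** The derivative is bounded only where |s| <= |t|, so K may itself depend on t. Iterating this
    yields Taylor estimates, with constants that are not sharp. *)
Lemma MVT_lipschitz (f df : R -> R) (K t : R) :
  (forall x : R, is_derive x 1 f (df x)) ->
  (forall s, `|s| <= `|t| -> `|df s| <= K) -> `|f t - f 0| <= K * `|t|.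
Proof.
move=> fdf Kdf.
have cf : continuous f.
  by move=> x; apply/differentiable_continuous/derivable1_diffP; have [] := fdf x.
have [t0|t0] := leP 0 t.
  have [//|c] := @MVT_segment _ f df 0 t t0 (fun x _ => fdf x).
    exact: continuous_subspaceT.
  rewrite in_itv/= => /andP[c0 ct] ->; rewrite subr0 normrM ler_wpM2r//.
  by apply: Kdf; rewrite !ger0_norm.
have [//|c] := @MVT_segment _ f df t 0 (ltW t0) (fun x _ => fdf x).
  exact: continuous_subspaceT.
rewrite in_itv/= => /andP[tc c0] fE; rewrite distrC fE sub0r normrM normrN.
by rewrite ler_wpM2r//; apply: Kdf; rewrite !ler0_norm ?(ltW t0)// lerN2.
Qed.

Lemma sin_le_norm t : `|sin t| <= `|t|.
Proof.
have := @MVT_lipschitz sin cos 1 t (fun x => is_derive_sin x).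
rewrite sin0 subr0 mul1r; apply => s _.
by rewrite ler_norml cos_geN1 cos_le1.
Qed.

Lemma cosB1_le t : `|cos t - 1| <= t ^+ 2.
Proof.
have := @MVT_lipschitz cos (fun x => - sin x) `|t| t (fun x => is_derive_cos x).
rewrite cos0 -normrM -expr2 ger0_norm ?sqr_ge0//.
by apply => s st; rewrite normrN (le_trans (sin_le_norm _)).
Qed.

Lemma sinB_le t : `|sin t - t| <= `|t| ^+ 3.
Proof.
have := @MVT_lipschitz (fun x => sin x - x) (fun x => cos x - 1) (`|t| ^+ 2) t.
rewrite sin0 subrr subr0 -exprSr; apply.
move=> s st; apply: (le_trans (cosB1_le _)).
by rewrite -real_normK ?num_real// lerXn2r ?nnegrE.
Qed.

(** The cubic bound serves for |t| <= 1; beyond that, |t| <= t^2 and the trivial estimate is enough.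
    The result is quadratic for every t, as needed under an integral over the whole space. *)
Lemma sinB_le2 t : `|sin t - t| <= 2 * t ^+ 2.
Proof.
have [t1|t1] := leP `|t| 1.
  apply: (le_trans (sinB_le _)); rewrite exprS real_normK ?num_real//.
  by rewrite ler_wpM2r ?sqr_ge0// (le_trans t1)// ler1n.
apply: (le_trans (ler_normB _ _)); apply: (le_trans (lerD (sin_le_norm t) (lexx _))).
have : `|t| <= t ^+ 2 by rewrite -real_normK ?num_real// expr2 ler_peMl// ltW.
by have := normr_ge0 (sin t); lra.
Qed.

Lemma l1C_expiB1 t : l1C (expi t - 1) <= 3 * `|t|.
Proof.
rewrite /l1C !cReImE /= oppr0 addr0.
have h : `|cos t - 1| <= 2 * `|t|.
  have [t1|t1] := leP `|t| 1.
    apply: (le_trans (cosB1_le _)); rewrite -real_normK ?num_real// expr2.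
    by rewrite ler_wpM2r// (le_trans t1)// ler1n.
  apply: (@le_trans _ _ 2); last by rewrite ler_peMr// ltW.
  by apply: (le_trans (ler_normB _ _)); rewrite normr1 lerD// ler_norml cos_geN1 cos_le1.
by have := sin_le_norm t; lra.
Qed.

(** This remainder is what differentiation under the integral and integration by parts both rest on;
    the constant is 1 from the cosine plus 2 from the sine. *)
Lemma l1C_expiB2 t : l1C (expi t - 1 - 'i * t%:C) <= 3 * t ^+ 2.
Proof.
rewrite /l1C !cReImE /= !mul0r !mulr0 mul1r !oppr0 !addr0 add0r.
by rewrite subr0; have := cosB1_le t; have := sinB_le2 t; lra.
Qed.

Lemma l1C_expiB s t : l1C (expi s - expi t) <= 6 * `|s - t|.
Proof.
have -> : expi s - expi t = expi t * (expi (s - t) - 1).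
  by rewrite mulrBr mulr1 -expiD [t + _]addrC subrK.
by apply: (le_trans (l1C_expiM _ _)); have := l1C_expiB1 (s - t); lra.
Qed.

Lemma expi_twopi_nat (k : nat) : expi (twopi * k%:R : R) = 1.
Proof.
elim: k => [|k IH]; first by rewrite mulr0 expi0.
rewrite -natr1 mulrDr expiD IH mul1r mulr1 /twopi mulr_natl.
by rewrite /expi cos2pi sin2pi.
Qed.

Lemma expiN_mul t : expi t * expi (- t) = 1.
Proof. by rewrite -expiD subrr expi0. Qed.

Lemma expi_twopi_int (k : int) : expi (twopi * k%:~R : R) = 1.
Proof.
case: k => k; first exact: expi_twopi_nat.
rewrite NegzE mulrNz mulrN; have := expiN_mul (twopi * k.+1%:R).
by rewrite expi_twopi_nat mul1r.
Qed.

End expi.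

(** * Scalar products, the weight [sqjap] and Peetre's inequality *)

Section dot.
Variables (R : realType) (n : nat).
Implicit Types x y z : 'rV[R]_n.

Lemma dotC x y : dot x y = dot y x.
Proof. by apply: eq_bigr => i _; rewrite mulrC. Qed.

Lemma dotDl x y z : dot (x + y) z = dot x z + dot y z.
Proof. by rewrite -big_split; apply: eq_bigr => i _; rewrite mxE mulrDl. Qed.

Lemma dotNl x z : dot (- x) z = - dot x z.
Proof. by rewrite /dot -sumrN; apply: eq_bigr => i _; rewrite mxE mulNr. Qed.

Lemma dotBl x y z : dot (x - y) z = dot x z - dot y z.
Proof. by rewrite dotDl dotNl. Qed.

Lemma dotZl (c : R) x z : dot (c *: x) z = c * dot x z.
Proof. by rewrite /dot mulr_sumr; apply: eq_bigr => i _; rewrite mxE mulrA. Qed.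

Lemma dotDr x y z : dot x (y + z) = dot x y + dot x z.
Proof. by rewrite dotC dotDl !(dotC x). Qed.

Lemma dotZr (c : R) x z : dot x (c *: z) = c * dot x z.
Proof. by rewrite dotC dotZl dotC. Qed.

Lemma dotNr x z : dot x (- z) = - dot x z.
Proof. by rewrite dotC dotNl dotC. Qed.

Lemma dot_basis (j : 'I_n) x : dot (basis_vec j) x = x 0 j.
Proof.
rewrite /dot (bigD1 j)//= big1 ?addr0 => [|i ij].
  by rewrite /basis_vec mxE !eqxx mul1r.
by rewrite /basis_vec mxE (negPf ij) andbF mul0r.
Qed.

Lemma dot_latv (k m : 'rV[int]_n) :
  dot (latv k) (latv m) = (\sum_i k 0 i * m 0 i)%:~R :> R.
Proof. by rewrite /dot rmorph_sum; apply: eq_bigr => i _; rewrite !mxE rmorphM. Qed.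

Lemma latvD (k m : 'rV[int]_n) : latv (k + m) = latv k + latv m :> 'rV[R]_n.
Proof. by apply/rowP => i; rewrite !mxE rmorphD. Qed.

Lemma latvN (k : 'rV[int]_n) : latv (- k) = - latv k :> 'rV[R]_n.
Proof. by apply/rowP => i; rewrite !mxE rmorphN. Qed.

(** The square of [japanese]: being polynomial in the coordinates, it keeps square roots out of the
    decay estimates. *)
Definition sqjap x : R := 1 + dot x x.

Lemma dot_ge0 x : 0 <= dot x x.
Proof. by apply: sumr_ge0 => i _; rewrite -expr2 sqr_ge0. Qed.

Lemma sqjap_ge1 x : 1 <= sqjap x.
Proof. by rewrite lerDl dot_ge0. Qed.

Lemma sqjap_gt0 x : 0 < sqjap x.
Proof. exact: lt_le_trans (sqjap_ge1 x). Qed.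

Lemma sqjapN x : sqjap (- x) = sqjap x.
Proof. by rewrite /sqjap dotNl dotNr opprK. Qed.

Lemma sqr_le_sqjap x i : 1 + x 0 i ^+ 2 <= sqjap x.
Proof.
rewrite lerD2l /dot (bigD1 i)//= -expr2 lerDl.
by apply: sumr_ge0 => j _; rewrite -expr2 sqr_ge0.
Qed.

Lemma coord_le_sqjap x i : `|x 0 i| <= sqjap x.
Proof.
apply: le_trans (sqr_le_sqjap x i); rewrite -real_normK ?num_real//.
have := normr_ge0 (x 0 i); set a := `|_|; nra.
Qed.

(** Peetre's inequality, from |x + y|^2 <= 2 |x|^2 + 2 |y|^2. *)
Lemma sqjapD x y : sqjap (x + y) <= 2 * sqjap x * sqjap y.
Proof.
have : dot (x + y) (x + y) <= 2 * dot x x + 2 * dot y y.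
  rewrite /dot !mulr_sumr -big_split; apply: ler_sum => i _ /=; rewrite !mxE.
  by have := sqr_ge0 (x 0 i - y 0 i); rewrite expr2; lra.
rewrite /sqjap; have := dot_ge0 x; have := dot_ge0 y.
by set a := dot x x; set b := dot y y; nra.
Qed.

Lemma sqjapX_gt0 x N : 0 < sqjap x ^+ N.
Proof. by rewrite exprn_gt0// sqjap_gt0. Qed.

Lemma norm_dot_le x y : `|dot x y| <= `|x| * (n%:R * sqjap y).
Proof.
apply: (le_trans (ler_norm_sum _ _ _)).
have -> : `|x| * (n%:R * sqjap y) = \sum_(i < n) `|x| * sqjap y.
  by rewrite sumr_const card_ord mulrCA mulr_natl.
apply: ler_sum => i _; rewrite normrM ler_pM ?coord_le_sqjap//.
by rewrite /Num.norm/= mx_normrE; apply: (le_bigmax _ (fun ij => `|x ij.1 ij.2|) (0, i)).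
Qed.

(* Integrable on [R^n] because [sqjap x ^+ n >= \prod_i (1 + x_i ^+ 2)]. *)
Definition sumdecay x : R := (sqjap x ^+ n)^-1.

Lemma sumdecay_gt0 x : 0 < sumdecay x.
Proof. by rewrite invr_gt0 sqjapX_gt0. Qed.

Lemma sumdecay_ge0 x : 0 <= sumdecay x.
Proof. exact: ltW (sumdecay_gt0 x). Qed.

(** Peetre's inequality applied to x = (x + y) - y. A translation by y costs a factor depending on y
    alone, so [sumdecay] has comparable values throughout a cube. *)
Lemma sumdecayD x y : sumdecay (x + y) <= 2 ^+ n * sqjap y ^+ n * sumdecay x.
Proof.
have h : sqjap x ^+ n <= 2 ^+ n * sqjap (x + y) ^+ n * sqjap y ^+ n.
  have j0 z := ltW (sqjap_gt0 z).
  rewrite -!exprMn; apply: lerXn2r; rewrite ?nnegrE ?mulr_ge0//.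
  by have := sqjapD (x + y) (- y); rewrite addrK sqjapN.
rewrite /sumdecay ler_pdivlMr ?sqjapX_gt0// mulrC ler_pdivrMr ?sqjapX_gt0//.
by apply: le_trans h _; rewrite mulrAC.
Qed.

End dot.

(** * Lebesgue measure on tuples: translation invariance and integrability *)

Section measurability.
Variables (R : realType) (n : nat).

(** Tuples carry the product sigma-algebra, and open sets of row vectors have to be placed in it: an
    open set is the countable union of the boxes with rational center and side that it contains. *)
Lemma measurable_open_rV (U : set 'rV[R]_n) :
  open U -> measurable (@rV_of_tuple R n @^-1` U).
Proof.
move=> oU.
pose box (p : 'rV[rat]_n * nat) : set (n.-tuple R) :=
  \bigcap_(i in [set: 'I_n]) ((@tnth n R ^~ i) @^-1` ball (ratr (p.1 0 i) : R) p.2.+1%:R^-1).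
pose inU (p : 'rV[rat]_n * nat) := box p `<=` @rV_of_tuple R n @^-1` U.
have -> : @rV_of_tuple R n @^-1` U =
    \bigcup_p (if `[< inU p >] then box p else set0).
  apply/seteqP; split => [t Ut|t [p _]]; last first.
    by case: ifPn => // /asboolP; exact.
  have /nbhs_ballP[e /= e0 eU] : nbhs (rV_of_tuple t) U by exact: open_nbhs_nbhs.
  (* Half of e goes to the distance from t to the rational center, half to the distance from the
     center to another point of the box. *)
  have e2 : 0 < e / 2 by rewrite divr_gt0.
  have [k ke] : exists k : nat, k.+1%:R^-1 < e / 2.
    have [k _ /(_ _ (leqnn k))] := near_infty_natSinv_lt (PosNum e2).
    by exists k.
  have k0 : 0 < k.+1%:R^-1 :> R by rewrite invr_gt0.
  have /choice[q tq] : forall i, exists q : rat, `|ratr q - tnth t i| < k.+1%:R^-1.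
    move=> i; have [|q] := @rat_in_itvoo R (tnth t i) (tnth t i + k.+1%:R^-1).
      by rewrite ltrDl.
    rewrite in_itv/= => /andP[q1 q2]; exists q.
    by rewrite ger0_norm ?subr_ge0 ?(ltW q1)// ltrBlDl.
  exists (\row_i q i, k) => //; case: ifPn => [_ i _|/asboolP nU]/=.
    by rewrite mxE; exact: tq.
  exfalso; apply: nU => s sbox; apply: eU; split => // i j; rewrite !ord1 !mxE.
  have := sbox j I; rewrite /= mxE /ball/= => sj.
  rewrite -(subrKA (ratr (q j))) (le_lt_trans (ler_normD _ _))//.
  by rewrite [e]splitr distrC ltrD// (lt_trans _ ke)// tq.
apply: countable_bigcupT_measurable => // p; case: ifPn => // _.
apply: fin_bigcap_measurable => // i _.
rewrite -[X in measurable X]setTI; apply: measurable_tnth => //.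
by apply: open_measurable; apply: ball_open; rewrite invr_gt0.
Qed.

Lemma measurable_comp_rV (F : 'rV[R]_n -> R) : continuous F ->
  measurable_fun setT (F \o @rV_of_tuple R n).
Proof.
move=> cF mT; apply: (measurability _ (RGenOInfty.measurableE R)) => //.
move=> _ [_ [a ->] <-]; rewrite setTI comp_preimage.
apply: measurable_open_rV; apply: open_comp => // x _; exact: cF.
Qed.

End measurability.

Section lebesgue_translation.
Variable R : realType.
Local Notation leb := (@lebesgue_measure R).

Lemma ge0_integral_lebesgueS n (g : n.+1.-tuple R -> \bar R) :
  measurable_fun setT g -> (forall t, (0 <= g t)%E) ->
  (\int[lebesgue R n.+1]_t g t =
   \int[leb]_x \int[lebesgue R n]_t g (consp (x, t)))%E.
Proof.
move=> mg g0.
pose mu := [the {measure set (measurableTypeR R * n.-tuple R) -> \bar R} of (leb \x lebesgue R n)%E].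
have mc : measurable_fun [set: measurableTypeR R * n.-tuple R] (@consp R n).
  exact: measurable_consp.
have h := ge0_integral_pushforward mc mu measurableT mg (fun t _ => g0 t).
rewrite [LHS]h.
rewrite preimage_setT.
have mgc := measurableT_comp mg mc.
exact: (@fubini_tonelli1 _ _ _ _ R leb (lebesgue R n) _ mgc (fun x => g0 _)).
Qed.

Definition shiftR (c x : R) : measurableTypeR R := x + c.

Lemma measurable_shiftR c : measurable_fun [set: measurableTypeR R] (shiftR c).
Proof. by apply: measurable_funD. Qed.

(** Uniqueness of the Lebesgue measure: the pushforward gives half-open intervals their length. *)
Lemma lebesgue_measure_shift (c : R) (A : set R) : measurable A ->
  pushforward leb (shiftR c) A = leb A.
Proof.
move=> mA; apply/esym/lebesgue_measure_unique => //=; first exact: measurable_shiftR.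
move=> mc _ [[a b]] _ <-.
rewrite /pushforward.
have -> : shiftR c @^-1` `]a, b]%classic = `]a - c, b - c]%classic.
  by apply/seteqP; split => x; rewrite /shiftR /= !in_itv/= ltrBlDr lerBrDr.
rewrite !lebesgue_measure_itv/= !lte_fin ltrD2r; case: ifP => // _.
by rewrite -!EFinB; congr EFin; ring.
Qed.

Lemma ge0_integral_shift1 (c : R) (g : R -> \bar R) :
  measurable_fun setT g -> (forall t, (0 <= g t)%E) ->
  (\int[leb]_x g (x + c)%R = \int[leb]_x g x)%E.
Proof.
move=> mg g0.
have h := @ge0_integral_pushforward _ _ _ _ R _ (@measurable_shiftR c) leb _ g measurableT mg (fun t _ => g0 t).
rewrite preimage_setT in h; rewrite -[LHS]h.
apply: eq_measure_integral => [|mc A mA _]; first exact: measurable_shiftR.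
exact: lebesgue_measure_shift.
Qed.

Definition shift_tuple n (c : 'rV[R]_n) (t : n.-tuple R) : n.-tuple R :=
  [tuple tnth t i + c 0 i | i < n].

Lemma rV_of_shift_tuple n (c : 'rV[R]_n) t :
  rV_of_tuple (shift_tuple c t) = rV_of_tuple t + c.
Proof. by apply/rowP => i; rewrite !mxE tnth_mktuple. Qed.

Lemma measurable_shift_tuple n (c : 'rV[R]_n) :
  measurable_fun setT (shift_tuple c).
Proof.
apply/measurable_fun_tnthP => i; rewrite (_ : _ \o _ = fun t => tnth t i + c 0 i).
  by apply: measurable_funD => //; exact: measurable_tnth.
by apply/funext => t /=; rewrite tnth_mktuple.
Qed.

Lemma shift_tuple_consp n (c : 'rV[R]_n.+1) x (t : n.-tuple R) :
  shift_tuple c (consp (x, t)) =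
  consp (x + c 0 ord0, shift_tuple (\row_i c 0 (lift ord0 i)) t).
Proof.
apply: eq_from_tnth => i; rewrite tnth_mktuple.
have [->|[j ->]] : i = ord0 \/ exists j, i = lift ord0 j.
  by case: (unliftP ord0 i) => [j ->|->]; [right; exists j|left].
  by [].
by rewrite !tnthS tnth_mktuple mxE.
Qed.

(** Tonelli separates the first coordinate, so translation invariance on the line and induction on
    the dimension suffice. *)
Lemma ge0_integral_shift n (c : 'rV[R]_n) (g : n.-tuple R -> \bar R) :
  measurable_fun setT g -> (forall t, (0 <= g t)%E) ->
  (\int[lebesgue R n]_t g (shift_tuple c t) = \int[lebesgue R n]_t g t)%E.
Proof.
elim: n c g => [|n IH] c g mg g0.
  by apply: eq_integral => t _; rewrite (tuple0 t) (tuple0 (shift_tuple _ _)).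
rewrite ge0_integral_lebesgueS//; last first.
  by apply: measurableT_comp => //; exact: measurable_shift_tuple.
under eq_integral do under eq_integral do rewrite shift_tuple_consp.
have mgc x : measurable_fun setT (fun t : n.-tuple R => g (consp (x, t))).
  apply: measurableT_comp => //.
  by apply: (measurableT_comp (@measurable_consp R n)); exact: measurable_pair1.
under eq_integral => x _ do rewrite (IH _ (fun t => g (consp (_, t))))//.
pose G x := (\int[lebesgue R n]_t g (consp (x, t)))%E.
rewrite -/(G _) (ge0_integral_shift1 (c 0 ord0) (g := G)).
- by rewrite ge0_integral_lebesgueS.
- apply: (@measurable_fun_fubini_tonelli_F _ _ _ _ _ _ (g \o @consp R n)).
    by apply: measurableT_comp => //; exact: measurable_consp.
  by move=> x; exact: g0.
- by move=> x; exact: integral_ge0.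
Qed.

End lebesgue_translation.

(** * Finiteness of the integral of [sumdecay], and cubes *)

Section finite_integrals.
Variable R : realType.
Local Notation leb := (@lebesgue_measure R).

Lemma integral_inv_oneDsqr_lty :
  (\int[leb]_x ((oneDsqr x)^-1)%:E < +oo)%E.
Proof.
rewrite (@ge0_symfun_integralT _ (fun x : R => (oneDsqr x)^-1)).
- rewrite (_ : [set x : R | (0 <= x)%R] = `[0, +oo[%classic).
    by rewrite integral0y_oneDsqr -EFinM ltry.
  by apply/seteqP; split => x; rewrite /= in_itv/= andbT.
- by move=> x; rewrite invr_ge0 addr_ge0// sqr_ge0.
- exact: continuous_oneDsqrV.
- by move=> x /=; rewrite /oneDsqr sqrrN.
Qed.

Definition prod_oneDsqrV n (t : n.-tuple R) : R :=
  \prod_(i < n) (oneDsqr (tnth t i))^-1.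

Lemma oneDsqrV_ge0 (x : R) : 0 <= (oneDsqr x)^-1.
Proof. by rewrite invr_ge0 addr_ge0// sqr_ge0. Qed.

Lemma prod_oneDsqrV_ge0 n (t : n.-tuple R) : 0 <= prod_oneDsqrV t.
Proof. by apply: prodr_ge0 => i _; exact: oneDsqrV_ge0. Qed.

Lemma measurable_oneDsqrV : measurable_fun setT (fun x : R => (oneDsqr x)^-1).
Proof. exact: continuous_measurable_fun (@continuous_oneDsqrV R). Qed.

Lemma measurable_prod_oneDsqrV n : measurable_fun setT (@prod_oneDsqrV n).
Proof.
apply: measurable_prod => i _.
by apply: (measurableT_comp measurable_oneDsqrV); exact: measurable_tnth.
Qed.

Lemma integral_prod_oneDsqrV_lty n :
  (\int[lebesgue R n]_t (prod_oneDsqrV t)%:E < +oo)%E.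
Proof.
elim: n => [|n IH].
  rewrite integral_dirac //; first by rewrite diracT mul1e ltry.
  by apply/measurable_EFinP; exact: measurable_prod_oneDsqrV.
rewrite ge0_integral_lebesgueS//; first last.
- by move=> t; rewrite lee_fin prod_oneDsqrV_ge0.
- by apply/measurable_EFinP; exact: measurable_prod_oneDsqrV.
have E x (t : n.-tuple R) : (prod_oneDsqrV (consp (x, t)))%:E =
    ((oneDsqr x)^-1%:E * (prod_oneDsqrV t)%:E)%E.
  rewrite -EFinM /prod_oneDsqrV big_ord_recl; congr (_ * _)%:E.
  by apply: eq_bigr => i _; rewrite tnthS.
have [r r0 rE] : exists2 r : R, 0 <= r & (\int[lebesgue R n]_t (prod_oneDsqrV t)%:E)%E = r%:E.
  have I0 : (0 <= \int[lebesgue R n]_t (prod_oneDsqrV t)%:E)%E.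
    by apply: integral_ge0 => t _; rewrite lee_fin prod_oneDsqrV_ge0.
  exists (fine (\int[lebesgue R n]_t (prod_oneDsqrV t)%:E)%E); first exact: fine_ge0.
  by rewrite fineK// ge0_fin_numE.
have Ix x : (\int[lebesgue R n]_t (prod_oneDsqrV (consp (x, t)))%:E =
    r%:E * (oneDsqr x)^-1%:E)%E.
  under eq_integral do rewrite E.
  rewrite ge0_integralZl_EFin//; first by rewrite rE muleC.
  - by move=> t _; rewrite lee_fin prod_oneDsqrV_ge0.
  - by apply/measurable_EFinP; exact: measurable_prod_oneDsqrV.
under eq_integral do rewrite Ix.
rewrite ge0_integralZl_EFin//.
- by apply: lte_mul_pinfty => //; exact: integral_inv_oneDsqr_lty.
- by apply/measurable_EFinP; exact: measurable_oneDsqrV.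
Qed.

Lemma sumr_continuous (T : topologicalType) (I : Type) (r : seq I) (F : I -> T -> R) :
  (forall i, continuous (F i)) -> continuous (fun x => \sum_(i <- r) F i x).
Proof.
move=> cF; apply: continuous_big => //; exact: add_continuous.
Qed.

Lemma continuous_coord n (i : 'I_n) : continuous (fun x : 'rV[R]_n => x 0 i).
Proof. exact: coord_continuous. Qed.

Lemma continuous_dot n (z : 'rV[R]_n) : continuous (fun x : 'rV[R]_n => dot z x).
Proof.
apply: sumr_continuous => i x; apply: continuousM; first exact: cst_continuous.
exact: continuous_coord.
Qed.

Lemma continuous_sqjap n : continuous (@sqjap R n).
Proof.
have cdd : continuous (fun x : 'rV[R]_n => dot x x).
  apply: sumr_continuous => i y; apply: continuousM; exact: continuous_coord.
rewrite (_ : @sqjap R n = cst 1 \+ (fun x => dot x x))//.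
move=> x; apply: (@continuousD R R _ (cst 1) (fun x : 'rV[R]_n => dot x x)); [exact: cst_continuous|exact: cdd].
Qed.

Lemma continuous_sumdecay n : continuous (@sumdecay R n).
Proof.
have cX : continuous (fun x : 'rV[R]_n => sqjap x ^+ n).
  move=> x; apply: (@continuous_comp _ _ _ (@sqjap R n) (fun y : R => y ^+ n)).
    exact: continuous_sqjap.
  exact: exprn_continuous.
move=> x; apply: (@continuousV R _ (fun x => sqjap x ^+ n)); last exact: cX.
by rewrite gt_eqF// sqjapX_gt0.
Qed.

Lemma measurable_sumdecay n : measurable_fun setT (@sumdecay R n \o @rV_of_tuple R n).
Proof. by apply: measurable_comp_rV; exact: continuous_sumdecay. Qed.

Lemma integrable_sumdecay n :
  (lebesgue R n).-integrable setT (EFin \o @sumdecay R n \o @rV_of_tuple R n).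
Proof.
apply/integrableP; split.
  by apply/measurable_EFinP; exact: measurable_sumdecay.
apply: le_lt_trans (integral_prod_oneDsqrV_lty n).
apply: ge0_le_integral => //.
- apply: measurableT_comp => //; apply/measurable_EFinP; exact: measurable_sumdecay.
- by apply/measurable_EFinP; exact: measurable_prod_oneDsqrV.
move=> t _ /=; rewrite lee_fin ger0_norm ?sumdecay_ge0// /sumdecay -exprVn.
rewrite -[X in _ ^+ X]card_ord -prodr_const; apply: ler_prod => i _.
have o0 : 0 < oneDsqr (tnth t i) by rewrite /oneDsqr ltr_wpDr ?sqr_ge0.
have j0 := sqjap_gt0 (rV_of_tuple t).
rewrite invr_ge0 ltW//= lef_pV2 ?posrE//.
by have := sqr_le_sqjap (rV_of_tuple t) i; rewrite mxE.
Qed.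

(** Half-open, so that the translates by the lattice of step L tile exactly; [torus_cube] is
    convertible to the case L = [twopi]. *)
Definition cube n (L : R) : set 'rV[R]_n := [set x | forall i, 0 <= x 0 i < L].

Lemma measurable_cube n L : measurable (@rV_of_tuple R n @^-1` @cube n L).
Proof.
rewrite (_ : _ @^-1` _ = \bigcap_(i in [set: 'I_n]) ((@tnth n R ^~ i) @^-1` `[0, L[)).
  apply: fin_bigcap_measurable => // i _.
  by rewrite -[X in measurable X]setTI; apply: measurable_tnth.
apply/seteqP; split => t tL i.
  by move=> _; rewrite /= in_itv/=; have := tL i; rewrite mxE.
by rewrite mxE; have := tL i I; rewrite /= in_itv.
Qed.

Lemma lebesgue_cube n (L : R) : 0 < L ->
  lebesgue R n (@rV_of_tuple R n @^-1` @cube n L) = (L ^+ n)%:E.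
Proof.
move=> L0; elim: n => [|n IH].
  by rewrite /= diracE mem_set// => -[].
transitivity ((leb \x lebesgue R n)%E (`[0, L[ `*` (@rV_of_tuple R n @^-1` @cube n L))).
  congr ((leb \x lebesgue R n)%E _); apply/seteqP; split => -[x t] /=.
    move=> h; split; first by rewrite in_itv/=; have := h ord0; rewrite mxE.
    by move=> i; have := h (lift ord0 i); rewrite !mxE tnthS.
  rewrite in_itv/= => -[x0 h] i; rewrite mxE.
  case: (unliftP ord0 i) => [j ->|->]; last by [].
  by have := h j; rewrite mxE tnthS.
rewrite product_measure1E//; last exact: measurable_cube.
have lebL : leb `[0, L[%classic = L%:E.
  by rewrite lebesgue_measure_itv/= lte_fin L0 sube0.
by rewrite IH exprS EFinM; congr (_ * _)%E.
Qed.

End finite_integrals.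

(** * Absolutely summable families *)

Section countable_sums.
Variables (R : realType) (T : countType).
Implicit Types (r s : T -> R) (F G : T -> R[i]).
Local Notation cnt := (@counting nat R).

(** Transports a family over T to the indices of nat, with the default u (0 or the empty set) off
    the range of [pickle]. Sums over T become integrals for the counting measure on nat. *)
Definition along_pickle (U : Type) (u : U) (f : T -> U) (i : nat) : U :=
  oapp f u (pickle_inv i).

Lemma esum_along_pickle (g : T -> \bar R) : (forall k, (0 <= g k)%E) ->
  (\esum_(k in [set: T]) g k = \sum_(i <oo) along_pickle 0 g i)%E.
Proof.
move=> g0.
have g0' i : (0 <= along_pickle 0 g i)%E by rewrite /along_pickle; case: pickle_inv.
rewrite nneseries_esumT//.
transitivity (\esum_(i in range (@pickle T)) along_pickle 0%E g i)%E.
  have bij : set_bij [set: T] (range (@pickle T)) (@pickle T).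
    split; [by move=> k _; exists k|by move=> k l _ _; exact: pcan_inj (@pickleK_inv T) _ _|].
    by move=> i [k _ <-]; exists k.
  by rewrite (reindex_esum _ _ _ _ bij); apply: eq_esum => k _; rewrite /along_pickle pickleK_inv.
rewrite [LHS]esum_mkcond; apply: eq_esum => i _; case: ifPn => //.
move=> /negP iT; rewrite /along_pickle; case E : (pickle_inv i) => [k|//].
exfalso; apply: iT; rewrite inE; exists k => //.
by have := @pickle_invK T i; rewrite E.
Qed.

Definition rsummable r := (\esum_(k in [set: T]) (`|r k|)%:E < +oo)%E.

Lemma esum_counting (g : T -> \bar R) : (forall k, (0 <= g k)%E) ->
  (\esum_(k in [set: T]) g k = \int[cnt]_i along_pickle 0 g i)%E.
Proof.
move=> g0; rewrite esum_along_pickle// ge0_integral_count// => i.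
by rewrite /along_pickle; case: pickle_inv.
Qed.

Lemma rsummable_integrable r : rsummable r ->
  cnt.-integrable setT (EFin \o along_pickle 0 r).
Proof.
move=> sr; apply/integrableP; split => //.
move: sr; rewrite /rsummable esum_counting//; apply: le_lt_trans.
rewrite le_eqVlt; apply/orP; left; apply/eqP; apply: eq_integral => i _ /=.
by rewrite /along_pickle; case: pickle_inv => [k|] //=; rewrite normr0.
Qed.

(** Linearity, monotonicity and dominated convergence of [rsum] are all read off from the integral
    through this identity. *)
Lemma rsumE r : rsummable r -> rsum r = \int[cnt]_i along_pickle 0 r i.
Proof.
move=> sr; have ir := rsummable_integrable sr.
have fp := integrable_pos_fin_num measurableT ir.
have fn := integrable_neg_fin_num measurableT ir.
rewrite /rsum /Rintegral integralE fineB//; congr (fine _ - fine _).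
  rewrite esum_counting//; apply: eq_integral => i _.
  by rewrite /along_pickle funeposE /=; case: pickle_inv => [k|] /=; rewrite ?funeposE ?maxxx.
rewrite esum_counting//; apply: eq_integral => i _.
by rewrite /along_pickle funenegE /=; case: pickle_inv => [k|] /=; rewrite ?funenegE ?oppr0 ?maxxx.
Qed.

Lemma rsummable_le r s : (forall k, `|r k| <= s k) -> rsummable s -> rsummable r.
Proof.
move=> rs; apply: le_lt_trans; apply: le_esum => k _.
by rewrite lee_fin; apply: le_trans (rs k) _; exact: ler_norm.
Qed.

Lemma rsummableD r s : rsummable r -> rsummable s -> rsummable (fun k => r k + s k).
Proof.
move=> sr ss; rewrite /rsummable.
apply: (@le_lt_trans _ _ (\esum_(k in [set: T]) ((`|r k|)%:E + (`|s k|)%:E))%E).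
  by apply: le_esum => k _; rewrite -EFinD lee_fin ler_normD.
by rewrite esumD//; exact: lte_add_pinfty.
Qed.

Lemma rsummableZ c r : rsummable r -> rsummable (fun k => c * r k).
Proof.
move=> sr; have := integrableZl measurableT c (rsummable_integrable sr).
move=> /integrableP[_]; rewrite /rsummable esum_counting//; apply: le_lt_trans.
rewrite le_eqVlt; apply/orP; left; apply/eqP; apply: eq_integral => i _ /=.
rewrite /along_pickle; case: pickle_inv => [k|] //=.
by rewrite mulr0 normr0.
Qed.

Lemma rsummable_norm r : rsummable r -> rsummable (fun k => `|r k|).
Proof. by apply: le_lt_trans; apply: le_esum => k _; rewrite normr_id. Qed.

Lemma rsummableN r : rsummable r -> rsummable (fun k => - r k).
Proof. by move=> /rsummable_norm; apply: rsummable_le => k; rewrite normrN. Qed.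

Lemma rsumD r s : rsummable r -> rsummable s ->
  rsum (fun k => r k + s k) = rsum r + rsum s.
Proof.
move=> sr ss; rewrite !rsumE//; last exact: rsummableD.
rewrite -RintegralD//; [|exact: rsummable_integrable..].
apply: eq_Rintegral => i _; rewrite /along_pickle.
by case: pickle_inv => //=; rewrite addr0.
Qed.

Lemma rsumZ c r : rsummable r -> rsum (fun k => c * r k) = c * rsum r.
Proof.
move=> sr; rewrite !rsumE//; last exact: rsummableZ.
rewrite -RintegralZl//; last exact: rsummable_integrable.
apply: eq_Rintegral => i _; rewrite /along_pickle.
by case: pickle_inv => //=; rewrite mulr0.
Qed.

Lemma rsumN r : rsummable r -> rsum (fun k => - r k) = - rsum r.
Proof.
move=> sr; rewrite -mulN1r -rsumZ//; congr rsum; apply/funext => k.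
by rewrite mulN1r.
Qed.

Lemma rsumB r s : rsummable r -> rsummable s ->
  rsum (fun k => r k - s k) = rsum r - rsum s.
Proof. by move=> sr ss; rewrite rsumD ?rsumN//; exact: rsummableN. Qed.

Lemma le_rsum r s : rsummable r -> rsummable s -> (forall k, r k <= s k) ->
  rsum r <= rsum s.
Proof.
move=> sr ss rs; rewrite !rsumE//; apply: le_Rintegral => //.
- exact: rsummable_integrable.
- exact: rsummable_integrable.
- by move=> i _; rewrite /along_pickle; case: pickle_inv => //=.
Qed.

Lemma norm_rsum_le r : rsummable r -> `|rsum r| <= rsum (fun k => `|r k|).
Proof.
move=> sr; rewrite !rsumE//; last exact: rsummable_norm.
apply: (le_trans (le_normr_Rintegral measurableT (rsummable_integrable sr))).
rewrite le_eqVlt; apply/orP; left; apply/eqP; apply: eq_Rintegral => i _ /=.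
by rewrite /along_pickle; case: pickle_inv => //=; rewrite normr0.
Qed.

Lemma rsum_ge0E r : (forall k, 0 <= r k) ->
  rsum r = fine (\esum_(k in [set: T]) (r k)%:E)%E.
Proof.
move=> r0; rewrite /rsum [X in _ - fine X](_ : _ = 0%E) ?subr0.
  congr fine; apply: eq_esum => k _; rewrite funeposE /=.
  by apply/max_idPl; rewrite lee_fin.
apply: esum1 => k _; rewrite funenegE /=; apply/max_idPr.
by rewrite -?EFinN lee_fin oppr_le0.
Qed.

Lemma rsum_delta (k0 : T) (c : R) :
  rsum (fun k => (k == k0)%:R * c) = c /\ rsummable (fun k => (k == k0)%:R * c).
Proof.
have E (x : R) : 0 <= x -> (\esum_(k in [set: T]) ((k == k0)%:R * x)%:E = x%:E)%E.
  move=> x0; transitivity (\esum_(k in [set k0]) x%:E)%E.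
    rewrite [RHS]esum_mkcond; apply: eq_esum => k _.
    have [->|kk0] := eqVneq k k0; first by rewrite mem_set// mul1r.
    by rewrite memNset ?mul0r// => /eqP; rewrite (negPf kk0).
  by rewrite esum_set1.
have S (x : R) : rsummable (fun k => (k == k0)%:R * x).
  rewrite /rsummable; under eq_esum => k _ do rewrite normrM normr_nat.
  by rewrite E// ltry.
split => //; have [c0|c0] := leP 0 c.
  by rewrite rsum_ge0E ?E// => k; rewrite mulr_ge0.
have -> : (fun k => (k == k0)%:R * c) = (fun k => - ((k == k0)%:R * - c)).
  by apply/funext => k; rewrite mulrN opprK.
rewrite rsumN// rsum_ge0E ?E ?oppr_ge0 ?ltW// ?opprK// => k.
by rewrite mulr_ge0// oppr_ge0 ltW.
Qed.

(** Dominated convergence for the counting measure; both limits in the Poisson argument are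
    instances. *)
Lemma rsum_dominated_cvg0 (A : nat -> T -> R) (B : T -> R) : rsummable B ->
  (forall N k, `|A N k| <= B k) -> (forall k, A N k @[N --> \oo] --> (0 : R)) ->
  rsum (A N) @[N --> \oo] --> (0 : R).
Proof.
move=> sB AB A0.
have sA N : rsummable (A N) by apply: rsummable_le sB.
have [] := @dominated_convergence _ _ R cnt setT measurableT
  (fun N => EFin \o along_pickle 0 (A N)) (EFin \o cst 0) (EFin \o along_pickle 0 B).
- by [].
- by [].
- apply: aeW => i _; apply/cvg_EFin; first by apply: nearW.
  rewrite /along_pickle /=; case: pickle_inv => [k|] /=; first exact: A0.
  exact: cvg_cst.
- exact: rsummable_integrable.
- apply: aeW => i N _; rewrite /= lee_fin /along_pickle.
  by case: pickle_inv => [k|] //=; rewrite normr0.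
have I0 : (\int[cnt]_x (EFin \o cst (0 : R)%R) x = 0)%E by exact: integral0_eq.
rewrite I0 => _ _.
move=> /fine_cvg; rewrite /=; apply: cvg_trans.
by apply: near_eq_cvg; apply: nearW => N; rewrite rsumE.
Qed.

Definition csummable F := rsummable (fun k => l1C (F k)).

Lemma csummable_Re F : csummable F -> rsummable (fun k => complex.Re (F k)).
Proof. by apply: rsummable_le => k; exact: normRe_l1C. Qed.

Lemma csummable_Im F : csummable F -> rsummable (fun k => complex.Im (F k)).
Proof. by apply: rsummable_le => k; exact: normIm_l1C. Qed.

Lemma csummable_le F s : (forall k, l1C (F k) <= s k) -> rsummable s -> csummable F.
Proof. by move=> Fs; apply: rsummable_le => k; rewrite ger0_norm// l1C_ge0. Qed.

Lemma csummableD F G : csummable F -> csummable G -> csummable (fun k => F k + G k).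
Proof.
by move=> sF sG; apply: csummable_le (rsummableD sF sG) => k; exact: l1CD.
Qed.

Lemma csummableB F G : csummable F -> csummable G -> csummable (fun k => F k - G k).
Proof.
by move=> sF sG; apply: csummable_le (rsummableD sF sG) => k; exact: l1CB.
Qed.

Lemma csummableZ z F : csummable F -> csummable (fun k => z * F k).
Proof.
by move=> sF; apply: csummable_le (rsummableZ (l1C z) sF) => k; exact: l1CM.
Qed.

Lemma csumD F G : csummable F -> csummable G ->
  csum (fun k => F k + G k) = csum F + csum G.
Proof.
move=> sF sG; apply: complex_eqP; rewrite ?cReD ?cImD /=.
  rewrite -rsumD; [|exact: csummable_Re..].
  by congr rsum; apply/funext => k; rewrite cReD.
rewrite -rsumD; [|exact: csummable_Im..].
by congr rsum; apply/funext => k; rewrite cImD.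
Qed.

Lemma csumB F G : csummable F -> csummable G ->
  csum (fun k => F k - G k) = csum F - csum G.
Proof.
move=> sF sG; apply: complex_eqP; rewrite !cReImE /=.
  rewrite -rsumB; [|exact: csummable_Re..].
  by congr rsum; apply/funext => k; rewrite !cReImE.
rewrite -rsumB; [|exact: csummable_Im..].
by congr rsum; apply/funext => k; rewrite !cReImE.
Qed.

Lemma csumZ z F : csummable F -> csum (fun k => z * F k) = z * csum F.
Proof.
move=> sF; have sr := csummable_Re sF; have si := csummable_Im sF.
apply: complex_eqP; rewrite !cReImE /= -!rsumZ//.
  rewrite -rsumB; [|exact: rsummableZ..].
  by congr rsum; apply/funext => k; rewrite !cReImE.
rewrite -rsumD; [|exact: rsummableZ..].
by congr rsum; apply/funext => k; rewrite !cReImE.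
Qed.

Lemma l1C_csum_le F : csummable F -> l1C (csum F) <= rsum (fun k => l1C (F k)).
Proof.
move=> sF; have sr := csummable_Re sF; have si := csummable_Im sF.
rewrite /l1C /= rsumD; [|exact: rsummable_norm..].
by apply: lerD; exact: norm_rsum_le.
Qed.

Lemma csum_delta (k0 : T) (z : R[i]) :
  csum (fun k => (k == k0)%:R * z) = z /\ csummable (fun k => (k == k0)%:R * z).
Proof.
have E k : (k == k0)%:R * z =
    ((k == k0)%:R * complex.Re z) +i* ((k == k0)%:R * complex.Im z).
  by case: (k == k0); [rewrite !mul1r; case: (z)|rewrite !mul0r].
split.
  apply: complex_eqP => /=.
    rewrite -[RHS](rsum_delta k0 _).1; congr rsum; apply/funext => k.
    by rewrite E.
  rewrite -[RHS](rsum_delta k0 _).1; congr rsum; apply/funext => k.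
  by rewrite E.
apply: csummable_le (rsum_delta k0 (l1C z)).2 => k.
by case: (k == k0); rewrite ?mul1r// !mul0r l1C0.
Qed.

(** Regroups a finite sum along the fibers of [kap]. It turns the double sum over box points in the
    Fejer kernel into a sum over all lattice frequencies. *)
Lemma csum_sum_delta (I : finType) (kap : I -> T) (z : I -> R[i]) :
  csum (fun k => \sum_i (k == kap i)%:R * z i) = \sum_i z i /\
  csummable (fun k => \sum_i (k == kap i)%:R * z i).
Proof.
rewrite unlock; elim: (index_enum I) => [|i s [IHs IHc]] /=.
  have [c0 c1] : csum (fun k : T => (0 : R[i])) = 0 /\ csummable (fun k : T => (0 : R[i])).
    have s0 : rsummable (fun _ : T => (0 : R)).
      by rewrite /rsummable esum1 ?ltry// => k _; rewrite normr0.
    split; last by apply: csummable_le s0 => k; rewrite l1C0.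
    have rs0 : rsum (fun _ : T => (0 : R)) = 0.
      by rewrite rsum_ge0E// esum1.
    by apply: complex_eqP.
  split; [exact: c0|exact: c1].
have [d1 d2] := csum_delta (kap i) (z i).
by split; [rewrite csumD// IHs d1|exact: csummableD].
Qed.

End countable_sums.

(** * Unfolding integrals over translated cubes *)

Section tiling.
Variables (R : realType) (n : nat).
Local Notation V := 'rV[R]_n.
Local Notation mu := (lebesgue R n).
Local Notation rV := (@rV_of_tuple R n).

Lemma ge0_integral_shift_rV (g : V -> \bar R) (c : V) :
  measurable_fun setT (g \o rV) -> (forall x, (0 <= g x)%E) ->
  (\int[mu]_t g (rV t + c)%R = \int[mu]_t g (rV t))%E.
Proof.
move=> mg g0; rewrite -[RHS](ge0_integral_shift c mg).
  by apply: eq_integral => t _; rewrite /= rV_of_shift_tuple.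
by move=> t; exact: g0.
Qed.

Lemma integral_shift_rV (g : V -> \bar R) (c : V) : measurable_fun setT (g \o rV) ->
  (\int[mu]_t g (rV t + c)%R = \int[mu]_t g (rV t))%E.
Proof.
move=> mg; rewrite [LHS]integralE [RHS]integralE.
have Ep (f : n.-tuple R -> V) : (fun t => g (f t))^\+%E = (fun t => g^\+%E (f t)).
  exact: (funepos_comp g f).
have En (f : n.-tuple R -> V) : (fun t => g (f t))^\-%E = (fun t => g^\-%E (f t)).
  exact: (funeneg_comp g f).
rewrite (Ep (fun t => rV t + c)) (En (fun t => rV t + c)) (Ep rV) (En rV).
have mp : measurable_fun setT (g^\+%E \o rV).
  by rewrite -funepos_comp; exact: measurable_funepos.
have mn : measurable_fun setT (g^\-%E \o rV).
  by rewrite -funeneg_comp; exact: measurable_funeneg.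
congr (_ - _)%E.
  exact: (ge0_integral_shift_rV c mp (funepos_ge0 g)).
exact: (ge0_integral_shift_rV c mn (funeneg_ge0 g)).
Qed.

(** The coordinates of k are the floors of x_i / L. With [lattice_cube_inj], the lattice translates
    of the cube form a partition. *)
Lemma exists_lattice_cube (L : R) (x : V) : 0 < L ->
  exists k : 'rV[int]_n, cube L (x - L *: latv k).
Proof.
move=> L0; exists (\row_i Num.floor (x 0 i / L)) => i; rewrite !mxE.
have /andP[h1 h2] := floor_itv (x 0 i / L).
move: h1 h2; rewrite ler_pdivlMr// ltr_pdivrMr// rmorphD/= mulrDl mul1r => h1 h2.
by apply/andP; split; lra.
Qed.

Lemma lattice_cube_inj (L : R) (x : V) (k l : 'rV[int]_n) : 0 < L ->
  cube L (x - L *: latv k) -> cube L (x - L *: latv l) -> k = l.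
Proof.
move=> L0 hk hl; apply/rowP => i.
have E (m : 'rV[int]_n) : cube L (x - L *: latv m) -> Num.floor (x 0 i / L) = m 0 i.
  move=> /(_ i); rewrite !mxE => /andP[h1 h2]; apply: floor_def.
  rewrite ler_pdivlMr// ltr_pdivrMr// rmorphD/= mulrDl mul1r.
  by apply/andP; split; lra.
by rewrite -(E _ hk) -(E _ hl).
Qed.

Definition lattice_cube (L : R) (k : 'rV[int]_n) : set (n.-tuple R) :=
  rV @^-1` [set x | cube L (x - L *: latv k)].

Lemma measurable_lattice_cube L k : measurable (lattice_cube L k).
Proof.
rewrite (_ : lattice_cube L k = shift_tuple (- (L *: latv k)) @^-1` (rV @^-1` @cube R n L)).
  rewrite -[X in measurable X]setTI; apply: measurable_shift_tuple => //.
  exact: measurable_cube.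
by apply/seteqP; split => t; rewrite /lattice_cube /= rV_of_shift_tuple.
Qed.

Lemma ge0_integral_lattice_cube L k (g : V -> \bar R) :
  measurable_fun setT (g \o rV) -> (forall x, (0 <= g x)%E) ->
  (\int[mu]_(t in lattice_cube L k) g (rV t) =
   \int[mu]_(t in rV @^-1` cube L) g (rV t + L *: latv k)%R)%E.
Proof.
move=> mg g0; rewrite integral_mkcond [RHS]integral_mkcond.
pose h := g \_ [set x | cube L (x - L *: latv k)].
transitivity (\int[mu]_t h (rV t))%E; first by [].
rewrite -(ge0_integral_shift_rV (L *: latv k)).
- apply: eq_integral => t _; rewrite /h /patch.
  suff -> : (rV t + L *: latv k \in [set x | cube L (x - L *: latv k)]) =
      (t \in rV @^-1` cube L) by [].
  by apply/idP/idP; rewrite !inE /= addrK.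
- rewrite (_ : h \o rV = (g \o rV) \_ (lattice_cube L k))//.
  apply: (measurable_restrictT _ _).1; last exact: measurable_funS mg.
  exact: measurable_lattice_cube.
- by move=> x; rewrite /h /patch; case: ifP.
Qed.

(** Countable additivity over the partition, each piece being translated back to the base cube. In
    this form, with the sum outside, it localises the Fejer integral around the lattice points. *)
Lemma tiling_ge0 L (g : V -> \bar R) : 0 < L ->
  measurable_fun setT (g \o rV) -> (forall x, (0 <= g x)%E) ->
  (\int[mu]_t g (rV t) = \esum_(k in [set: 'rV[int]_n])
     \int[mu]_(t in rV @^-1` cube L) g (rV t + L *: latv k)%R)%E.
Proof.
move=> L0 mg g0.
pose F := along_pickle set0 (lattice_cube L).
have FT : [set: n.-tuple R] = \bigcup_i F i.
  apply/esym; rewrite -subTset => t _.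
  have [k kt] := exists_lattice_cube (rV t) L0.
  by exists (pickle k) => //; rewrite /F /along_pickle pickleK_inv.
rewrite FT ge0_integral_bigcup//.
- rewrite esum_along_pickle; last by move=> k; apply: integral_ge0.
  apply: eq_eseriesr => i _; rewrite /F /along_pickle.
  case: pickle_inv => [k|] /=; first exact: ge0_integral_lattice_cube.
  by rewrite integral_set0.
- move=> i; rewrite /F /along_pickle; case: pickle_inv => [k|] //=.
  exact: measurable_lattice_cube.
- by rewrite -FT.
- move=> i j _ _ [t []]; rewrite /F /along_pickle.
  case Ei : (pickle_inv i) => [k|//]; case Ej : (pickle_inv j) => [l|//] /= hk hl.
  have kl := lattice_cube_inj L0 hk hl.
  have := @pickle_invK ('rV[int]_n) i; rewrite Ei => <-.
  by have := @pickle_invK ('rV[int]_n) j; rewrite Ej => <- /=; rewrite kl.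
Qed.

(** Tonelli moves the sum inside, the form needed for the Fourier coefficients of a
    periodization. *)
Lemma tiling_ge0_sum L (g : V -> \bar R) : 0 < L ->
  measurable_fun setT (g \o rV) -> (forall x, (0 <= g x)%E) ->
  (\int[mu]_t g (rV t) = \int[mu]_(t in rV @^-1` cube L)
     \esum_(k in [set: 'rV[int]_n]) g (rV t + L *: latv k)%R)%E.
Proof.
move=> L0 mg g0; rewrite (tiling_ge0 L0)//.
have mgk k : measurable_fun setT (fun t => g (rV t + L *: latv k)).
  rewrite (_ : (fun t => _) = (g \o rV) \o shift_tuple (L *: latv k)).
    by apply: measurableT_comp => //; exact: measurable_shift_tuple.
  by apply/funext => t /=; rewrite rV_of_shift_tuple.
rewrite esum_along_pickle; last by move=> k; apply: integral_ge0.
under [RHS]eq_integral do rewrite esum_along_pickle//.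
rewrite integral_nneseries//.
- apply: eq_eseriesr => i _; rewrite /along_pickle.
  by case: pickle_inv => [k|] //=; rewrite integral0.
- exact: measurable_cube.
- move=> i; rewrite /along_pickle; case: pickle_inv => [k|] //=.
  by apply: measurable_funTS; exact: mgk.
- by move=> i t _; rewrite /along_pickle; case: pickle_inv => [k|] /=.
Qed.

End tiling.

(** * Integrals of complex functions and signed unfolding *)

Section complex_integral.
Variables (R : realType) (n : nat).
Local Notation V := 'rV[R]_n.
Local Notation mu := (lebesgue R n).
Local Notation rV := (@rV_of_tuple R n).
Implicit Types (D : set V) (F G : V -> R[i]) (g s : V -> R).

Definition ccont F := continuous (@complex.Re R \o F) /\ continuous (@complex.Im R \o F).

Definition cmeas F := measurable_fun setT (@complex.Re R \o F \o rV) /\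
  measurable_fun setT (@complex.Im R \o F \o rV).

Definition rintble D g := mu.-integrable (rV @^-1` D) (EFin \o (g \o rV)).

Definition cintble D F := rintble D (@complex.Re R \o F) /\ rintble D (@complex.Im R \o F).

Lemma ccont_cmeas F : ccont F -> cmeas F.
Proof. by case=> cR cI; split; apply: measurable_comp_rV. Qed.

Lemma ccontD F G : ccont F -> ccont G -> ccont (fun x => F x + G x).
Proof.
move=> [cR cI] [dR dI]; split.
  rewrite (_ : _ \o _ = fun x => complex.Re (F x) + complex.Re (G x)).
    by move=> x; apply: continuousD; [exact: cR|exact: dR].
  by apply/funext => x /=; rewrite cReD.
rewrite (_ : _ \o _ = fun x => complex.Im (F x) + complex.Im (G x)).
  by move=> x; apply: continuousD; [exact: cI|exact: dI].
by apply/funext => x /=; rewrite cImD.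
Qed.

Lemma ccontM F G : ccont F -> ccont G -> ccont (fun x => F x * G x).
Proof.
move=> [cR cI] [dR dI]; split.
  rewrite (_ : _ \o _ = fun x => complex.Re (F x) * complex.Re (G x) -
      complex.Im (F x) * complex.Im (G x)).
    move=> x; have h1 := continuousM (cR x) (dR x).
    have h2 := continuousM (cI x) (dI x).
    exact: (continuousB h1 h2).
  by apply/funext => x /=; rewrite cReM.
rewrite (_ : _ \o _ = fun x => complex.Re (F x) * complex.Im (G x) +
    complex.Im (F x) * complex.Re (G x)).
  move=> x; have h1 := continuousM (cR x) (dI x).
  have h2 := continuousM (cI x) (dR x).
  exact: (continuousD h1 h2).
by apply/funext => x /=; rewrite cImM.
Qed.

Lemma ccont_cst z : ccont (cst z).
Proof. by split => x; exact: cst_continuous. Qed.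

Lemma ccont_real g : continuous g -> ccont (fun x => (g x)%:C).
Proof. by move=> cg; split => //; exact: cst_continuous. Qed.

Lemma ccont_expi g : continuous g -> ccont (fun x => expi (g x)).
Proof.
move=> cg; split => x.
  by apply: (@continuous_comp _ _ _ g (@cos R)); [exact: cg|exact: continuous_cos].
by apply: (@continuous_comp _ _ _ g (@sin R)); [exact: cg|exact: continuous_sin].
Qed.

Lemma ccont_sum (I : Type) (r : seq I) (F_ : I -> V -> R[i]) :
  (forall i, ccont (F_ i)) -> ccont (fun x => \sum_(i <- r) F_ i x).
Proof.
move=> cF; elim: r => [|i r IH].
  by under eq_fun do rewrite big_nil; exact: ccont_cst.
by under eq_fun do rewrite big_cons; exact: ccontD.
Qed.

Lemma ccont_shift F (c : V) : ccont F -> ccont (fun x => F (x + c)).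
Proof.
have cc : continuous (fun x : V => x + c).
  by move=> x; apply: continuousD; [exact: cvg_id|exact: cst_continuous].
move=> [cR cI]; split => x.
  exact: (continuous_comp (cc x) (cR (x + c))).
exact: (continuous_comp (cc x) (cI (x + c))).
Qed.

Lemma continuous_l1C F : ccont F -> continuous (fun x => l1C (F x)).
Proof.
move=> [cR cI] x.
have h1 := continuous_comp (cR x) (@norm_continuous _ _ (complex.Re (F x))).
have h2 := continuous_comp (cI x) (@norm_continuous _ _ (complex.Im (F x))).
exact: (continuousD h1 h2).
Qed.

Lemma measurable_l1C F : cmeas F -> measurable_fun setT (fun t => l1C (F (rV t))).
Proof.
by move=> [mR mI]; apply: measurable_funD; apply: measurableT_comp.
Qed.

Lemma measurable_shift_rV g c : measurable_fun setT (g \o rV) ->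
  measurable_fun setT ((fun x => g (x + c)) \o rV).
Proof.
move=> mg; rewrite (_ : _ \o _ = (g \o rV) \o shift_tuple c).
  by apply: measurableT_comp => //; exact: measurable_shift_tuple.
by apply/funext => t /=; rewrite rV_of_shift_tuple.
Qed.

Lemma cmeas_shift F c : cmeas F -> cmeas (fun x => F (x + c)).
Proof.
by move=> [mR mI]; split; [exact: (measurable_shift_rV c mR)|exact: (measurable_shift_rV c mI)].
Qed.

Lemma rintble_le D g s : measurable (rV @^-1` D) -> measurable_fun setT (g \o rV) ->
  (forall x, D x -> `|g x| <= s x) -> rintble D s -> rintble D g.
Proof.
move=> mD mg gs; apply: le_integrable => //.
  by apply/measurable_EFinP; exact: measurable_funS mg.
move=> t Dt; rewrite lee_fin; apply: le_trans (gs _ Dt) _; exact: ler_norm.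
Qed.

Lemma cintble_le D F s : measurable (rV @^-1` D) -> cmeas F ->
  (forall x, D x -> l1C (F x) <= s x) -> rintble D s -> cintble D F.
Proof.
move=> mD [mR mI] Fs is_; split; apply: rintble_le is_ => //= x Dx.
  exact: le_trans (normRe_l1C _) (Fs _ Dx).
exact: le_trans (normIm_l1C _) (Fs _ Dx).
Qed.

Lemma rintbleD D g s : measurable (rV @^-1` D) ->
  rintble D g -> rintble D s -> rintble D (fun x => g x + s x).
Proof. by move=> mD ig is_; exact: (integrableD mD ig is_). Qed.

Lemma rintbleZ D (c : R) g : measurable (rV @^-1` D) ->
  rintble D g -> rintble D (fun x => c * g x).
Proof. by move=> mD ig; exact: (integrableZl mD c ig). Qed.

Lemma rintble_l1C D F : measurable (rV @^-1` D) -> cintble D F ->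
  rintble D (fun x => l1C (F x)).
Proof.
move=> mD [iR iI]; apply: (rintbleD (g := fun x => `|complex.Re (F x)|)) => //.
  exact: integrable_norm.
exact: integrable_norm.
Qed.

Lemma cintbleD D F G : measurable (rV @^-1` D) -> cintble D F -> cintble D G ->
  cintble D (fun x => F x + G x).
Proof.
move=> mD [iR iI] [jR jI]; split.
  rewrite (_ : _ \o _ = fun x => complex.Re (F x) + complex.Re (G x)).
    exact: rintbleD.
  by apply/funext => x /=; rewrite cReD.
rewrite (_ : _ \o _ = fun x => complex.Im (F x) + complex.Im (G x)).
  exact: rintbleD.
by apply/funext => x /=; rewrite cImD.
Qed.

Lemma cintbleZ D z F : measurable (rV @^-1` D) -> cintble D F ->
  cintble D (fun x => z * F x).
Proof.
move=> mD [iR iI]; split.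
  rewrite (_ : _ \o _ = fun x => complex.Re z * complex.Re (F x) +
      (- complex.Im z) * complex.Im (F x)).
    by apply: rintbleD => //; exact: rintbleZ.
  by apply/funext => x /=; rewrite cReM mulNr.
rewrite (_ : _ \o _ = fun x => complex.Re z * complex.Im (F x) +
    complex.Im z * complex.Re (F x)).
  by apply: rintbleD => //; exact: rintbleZ.
by apply/funext => x /=; rewrite cImM.
Qed.

Definition rint D g : R := \int[mu]_(t in rV @^-1` D) g (rV t).

Lemma rintD D g s : measurable (rV @^-1` D) -> rintble D g -> rintble D s ->
  rint D (fun x => g x + s x) = rint D g + rint D s.
Proof. by move=> mD ig is_; exact: (RintegralD mD ig is_). Qed.

Lemma rintZ D c g : measurable (rV @^-1` D) -> rintble D g ->
  rint D (fun x => c * g x) = c * rint D g.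
Proof. by move=> mD ig; exact: (RintegralZl c mD ig). Qed.

Lemma rint_eq D g s : (forall x, D x -> g x = s x) -> rint D g = rint D s.
Proof. by move=> gs; apply: eq_Rintegral => t; rewrite inE; exact: gs. Qed.

Lemma rint_le D g s : measurable (rV @^-1` D) -> rintble D g -> rintble D s ->
  (forall x, D x -> g x <= s x) -> rint D g <= rint D s.
Proof. by move=> mD ig is_ gs; apply: le_Rintegral => // t Dt; exact: gs. Qed.

Lemma rint_ge0 D g : (forall x, D x -> 0 <= g x) -> 0 <= rint D g.
Proof. by move=> g0; apply: Rintegral_ge0 => t Dt; exact: g0. Qed.

Lemma cintE D F : cintegral D F =
  rint D (fun x => complex.Re (F x)) +i* rint D (fun x => complex.Im (F x)).
Proof. by []. Qed.

Lemma cint_eq D F G : (forall x, D x -> F x = G x) -> cintegral D F = cintegral D G.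
Proof. by move=> FG; rewrite !cintE; congr (_ +i* _); apply: rint_eq => x /FG ->. Qed.

Lemma cintD D F G : measurable (rV @^-1` D) -> cintble D F -> cintble D G ->
  cintegral D (fun x => F x + G x) = cintegral D F + cintegral D G.
Proof.
move=> mD [iR iI] [jR jI]; apply: complex_eqP; rewrite !cReImE !cintE /= -rintD//.
  by apply: rint_eq => x _; rewrite cReD.
by apply: rint_eq => x _; rewrite cImD.
Qed.

Lemma cintZ D z F : measurable (rV @^-1` D) -> cintble D F ->
  cintegral D (fun x => z * F x) = z * cintegral D F.
Proof.
move=> mD [iR iI]; apply: complex_eqP; rewrite !cReImE !cintE /=.
  rewrite -mulNr -!rintZ// -rintD//; try exact: rintbleZ.
  by apply: rint_eq => x _; rewrite cReM mulNr.
rewrite -!rintZ// -rintD//; try exact: rintbleZ.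
by apply: rint_eq => x _; rewrite cImM.
Qed.

Lemma cintB D F G : measurable (rV @^-1` D) -> cintble D F -> cintble D G ->
  cintegral D (fun x => F x - G x) = cintegral D F - cintegral D G.
Proof.
move=> mD iF iG; rewrite -mulN1r -cintZ// -cintD//; last exact: cintbleZ.
by apply: cint_eq => x _; rewrite mulN1r.
Qed.

Lemma cintble_sum D (I : Type) (r : seq I) (F_ : I -> V -> R[i]) :
  measurable (rV @^-1` D) -> (forall i, cintble D (F_ i)) ->
  cintble D (fun x => \sum_(i <- r) F_ i x) /\
  cintegral D (fun x => \sum_(i <- r) F_ i x) = \sum_(i <- r) cintegral D (F_ i).
Proof.
move=> mD iF; elim: r => [|i r [IH1 IH2]].
  under eq_fun do rewrite big_nil; rewrite big_nil.
  have i0 : rintble D (cst 0) by exact: integrable0.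
  split; first by split; exact: i0.
  have r0 : rint D (cst 0) = 0.
    by rewrite -[RHS](mul0r (rint D (cst 0))) -rintZ//; apply: rint_eq => x _; rewrite mul0r.
  by rewrite cintE /= r0.
under eq_fun do rewrite big_cons; rewrite big_cons; split; first exact: cintbleD.
by rewrite cintD// IH2.
Qed.

Lemma l1C_cint_le D F : measurable (rV @^-1` D) -> cintble D F ->
  l1C (cintegral D F) <= rint D (fun x => l1C (F x)).
Proof.
move=> mD [iR iI]; rewrite cintE /l1C /= rintD//; try exact: integrable_norm.
by apply: lerD; exact: le_normr_Rintegral.
Qed.

Lemma l1C_cint_le2 D F s : measurable (rV @^-1` D) -> cmeas F -> rintble D s ->
  (forall x, D x -> l1C (F x) <= s x) -> l1C (cintegral D F) <= rint D s.
Proof.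
move=> mD mF is_ Fs; have iF := cintble_le mD mF Fs is_.
apply: (le_trans (l1C_cint_le mD iF)); apply: rint_le => //.
exact: rintble_l1C.
Qed.

Lemma rint_shift g c : measurable_fun setT (g \o rV) ->
  rint setT (fun x => g (x + c)) = rint setT g.
Proof.
move=> mg; congr fine; apply: (integral_shift_rV (g := EFin \o g)).
by apply/measurable_EFinP.
Qed.

Lemma cint_shift F c : cmeas F ->
  cintegral setT (fun x => F (x + c)) = cintegral setT F.
Proof.
move=> [mR mI]; rewrite !cintE; congr (_ +i* _).
  exact: (rint_shift c mR).
exact: (rint_shift c mI).
Qed.

Lemma rintble_sumdecay (C : R) : rintble setT (fun x => C * sumdecay x).
Proof. exact: (rintbleZ C measurableT (@integrable_sumdecay R n)). Qed.

Lemma rintble_cube_cst (L c : R) : 0 < L -> rintble (cube L) (cst c).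
Proof.
move=> L0; rewrite /rintble (_ : _ \o _ = cst c%:E)//.
apply/integrableP; split; first exact: measurable_cst.
rewrite (eq_integral (cst `|c|%:E))// integral_cst; last exact: measurable_cube.
have e : mu (rV @^-1` cube L) = (L ^+ n)%:E := lebesgue_cube n L0.
by rewrite [X in (_ * X < _)%E]e -EFinM ltry.
Qed.

Lemma rint_cube_cst (L c : R) : 0 < L -> rint (cube L) (cst c) = L ^+ n * c.
Proof.
move=> L0; rewrite /rint Rintegral_cst; last exact: measurable_cube.
have e : mu (rV @^-1` cube L) = (L ^+ n)%:E := lebesgue_cube n L0.
by rewrite [X in fine X]e mulrC.
Qed.

Lemma rintble_shift g c : rintble setT g -> rintble setT (fun x => g (x + c)).
Proof.
move=> /integrableP[/measurable_EFinP mg ig]; apply/integrableP; split.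
  by apply/measurable_EFinP; exact: measurable_shift_rV.
rewrite (ge0_integral_shift_rV c (g := fun x => `|g x|%:E))//.
by apply/measurable_EFinP; apply: measurableT_comp.
Qed.

Lemma rintbleS D g : measurable (rV @^-1` D) -> rintble setT g -> rintble D g.
Proof. by move=> mD ig; exact: (integrableS measurableT mD (@subsetT _ _) ig). Qed.

Lemma EFin_rint D g : measurable (rV @^-1` D) -> rintble D g ->
  ((rint D g)%:E = \int[mu]_(t in rV @^-1` D) (g (rV t))%:E)%E.
Proof. by move=> mD ig; rewrite fineK//; exact: (integrable_fin_num mD ig). Qed.

Lemma rintble_measurable g : rintble setT g -> measurable_fun setT (g \o rV).
Proof. by move=> /integrableP[/measurable_EFinP]. Qed.

Lemma tiling_rsum_ge0 (L : R) g : 0 < L -> rintble setT g -> (forall x, 0 <= g x) ->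
  let p := fun k : 'rV[int]_n => rint (cube L) (fun x => g (x + L *: latv k)) in
  rsummable p /\ rint setT g = rsum p.
Proof.
move=> L0 ig g0 p; have mg := rintble_measurable ig.
have p0 k : 0 <= p k by apply: rint_ge0.
have mc := @measurable_cube R n L.
have E : ((rint setT g)%:E = \esum_(k in [set: 'rV[int]_n]) (p k)%:E)%E.
  have mEg : measurable_fun setT ((EFin \o g) \o rV) by apply/measurable_EFinP.
  transitivity (\int[mu]_t (g (rV t))%:E)%E; first exact: (EFin_rint measurableT ig).
  have h := tiling_ge0 (g := EFin \o g) L0 mEg; rewrite [LHS]h; last first.
    by move=> x; rewrite lee_fin.
  by apply: eq_esum => k _; rewrite EFin_rint//; exact: (rintbleS mc (rintble_shift _ ig)).
split; last by rewrite rsum_ge0E// -E.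
rewrite /rsummable; under eq_esum => k _ do rewrite ger0_norm//.
by rewrite -E ltry.
Qed.

Lemma rintble_max0 D g : measurable (rV @^-1` D) -> rintble D g ->
  rintble D (fun x => Num.max (g x) 0).
Proof.
move=> mD ig; apply: (le_integrable mD _ _ ig).
  apply/measurable_EFinP; apply: measurable_maxr => //.
  by move: ig => /integrableP[/measurable_EFinP].
move=> t _; rewrite /= lee_fin; have [g0|g0] := leP (g (rV t)) 0.
  by rewrite normr0.
by [].
Qed.

Lemma rintbleN D g : measurable (rV @^-1` D) -> rintble D g -> rintble D (fun x => - g x).
Proof.
move=> mD ig; rewrite (_ : (fun x => _) = fun x => -1 * g x); first exact: rintbleZ.
by apply/funext => x; rewrite mulN1r.
Qed.

Lemma rintB D g s : measurable (rV @^-1` D) -> rintble D g -> rintble D s ->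
  rint D (fun x => g x - s x) = rint D g - rint D s.
Proof. by move=> mD ig is_; exact: (RintegralB mD ig is_). Qed.

Lemma max0B (x : R) : Num.max x 0 - Num.max (- x) 0 = x.
Proof.
have [x0|/ltW x0] := leP x 0.
  by rewrite max_l ?oppr_ge0// sub0r opprK.
by rewrite max_r ?oppr_le0// subr0.
Qed.

(** The nonnegative case for max(g, 0) and max(-g, 0). The summability clause bears on the integrals
    of |g|, since these are what bounds the [l1C] of complex cube integrals in [tiling_csum]. *)
Lemma tiling_rsum (L : R) g : 0 < L -> rintble setT g ->
  rsummable (fun k : 'rV[int]_n => rint (cube L) (fun x => `|g (x + L *: latv k)|)) /\
  rint setT g = rsum (fun k => rint (cube L) (fun x => g (x + L *: latv k))).
Proof.
move=> L0 ig; have mc := @measurable_cube R n L.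
have ign := rintbleN measurableT ig.
have [ip iq] := (rintble_max0 measurableT ig, rintble_max0 measurableT ign).
have max_ge0 (x : R) : 0 <= Num.max x 0 by rewrite le_max lexx orbT.
have [sp Ep] := tiling_rsum_ge0 L0 ip (fun x => max_ge0 (g x)).
have [sq Eq] := tiling_rsum_ge0 L0 iq (fun x => max_ge0 (- g x)).
split.
  have ia : rintble setT (fun x => `|g x|) by exact: integrable_norm.
  exact: (tiling_rsum_ge0 L0 ia (fun x => normr_ge0 _)).1.
transitivity (rint setT (fun x => Num.max (g x) 0 - Num.max (- g x) 0)).
  by apply: rint_eq => x _; rewrite max0B.
rewrite (rintB measurableT ip iq) Ep Eq -rsumB//; congr rsum; apply/funext => k.
rewrite -rintB//; last 2 first.
  exact: (rintbleS mc (rintble_shift _ ip)).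
  exact: (rintbleS mc (rintble_shift _ iq)).
by apply: rint_eq => x _; rewrite max0B.
Qed.

Lemma tiling_rsum_in_ge0 (L : R) g : 0 < L -> rintble setT g -> (forall x, 0 <= g x) ->
  (forall x, rsummable (fun k : 'rV[int]_n => g (x + L *: latv k))) ->
  let G := fun x => rsum (fun k => g (x + L *: latv k)) in
  rintble (cube L) G /\ rint setT g = rint (cube L) G.
Proof.
move=> L0 ig g0 sg G; have mg := rintble_measurable ig.
have mc := @measurable_cube R n L.
(* Summability at every point makes the real-valued sum faithful to the extended one; [fine] would
   turn an infinite sum into 0. *)
have GE x : ((G x)%:E = \esum_(k in [set: 'rV[int]_n]) (g (x + L *: latv k)%R)%:E)%E.
  rewrite /G rsum_ge0E// fineK// ge0_fin_numE; last by apply: esum_ge0 => k _; rewrite lee_fin.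
  by apply: le_lt_trans (sg x); apply: le_esum => k _; rewrite lee_fin ler_norm.
have mG : measurable_fun setT (EFin \o (G \o rV)).
  rewrite (_ : _ \o _ = fun t => \sum_(i <oo) along_pickle 0%E
      (fun k : 'rV[int]_n => (g (rV t + L *: latv k)%R)%:E) i)%E.
    apply: ge0_emeasurable_sum => [i t _ _|i _]; rewrite /along_pickle; case: pickle_inv => //= k.
      by rewrite lee_fin.
    by apply/measurable_EFinP; exact: (measurable_shift_rV _ mg).
  by apply/funext => t /=; rewrite GE esum_along_pickle// => k; rewrite lee_fin.
have E : (\int[mu]_t (g (rV t))%:E = \int[mu]_(t in rV @^-1` cube L) (G (rV t))%:E)%E.
  have mEg : measurable_fun setT ((EFin \o g) \o rV) by apply/measurable_EFinP.
  have h := tiling_ge0_sum (g := EFin \o g) L0 mEg; rewrite [LHS]h; last first.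
    by move=> x; rewrite lee_fin.
  by apply: eq_integral => t _; rewrite GE.
split; last by rewrite /rint /Rintegral preimage_setT E.
apply/integrableP; split; first exact: measurable_funS mG.
rewrite (eq_integral (fun t => (G (rV t))%:E)).
  by rewrite -E; have := EFin_rint measurableT ig; rewrite preimage_setT => <-; rewrite ltry.
move=> t _; rewrite /= ger0_norm// -lee_fin GE; apply: esum_ge0 => k _.
by rewrite lee_fin.
Qed.

Lemma tiling_rsum_in (L : R) g : 0 < L -> rintble setT g ->
  (forall x, rsummable (fun k : 'rV[int]_n => g (x + L *: latv k))) ->
  rint setT g = rint (cube L) (fun x => rsum (fun k => g (x + L *: latv k))).
Proof.
move=> L0 ig sg; have mc := @measurable_cube R n L.
have ign := rintbleN measurableT ig.
have [ip iq] := (rintble_max0 measurableT ig, rintble_max0 measurableT ign).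
have max_ge0 (x : R) : 0 <= Num.max x 0 by rewrite le_max lexx orbT.
have max_le (x : R) : `|Num.max x 0| <= `|x|.
  by have [x0|x0] := leP x 0; rewrite ?normr0.
have sp x : rsummable (fun k : 'rV[int]_n => Num.max (g (x + L *: latv k)) 0).
  by apply: rsummable_le (rsummable_norm (sg x)) => k.
have sq x : rsummable (fun k : 'rV[int]_n => Num.max (- g (x + L *: latv k)) 0).
  by apply: rsummable_le (rsummable_norm (sg x)) => k; rewrite -(normrN (g _)).
have [jp Ep] := tiling_rsum_in_ge0 L0 ip (fun x => max_ge0 (g x)) sp.
have [jq Eq] := tiling_rsum_in_ge0 L0 iq (fun x => max_ge0 (- g x)) sq.
transitivity (rint setT (fun x => Num.max (g x) 0 - Num.max (- g x) 0)).
  by apply: rint_eq => x _; rewrite max0B.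
rewrite (rintB measurableT ip iq) Ep Eq -(rintB mc jp jq); apply: rint_eq => x _.
by rewrite -rsumB//; congr rsum; apply/funext => k; rewrite max0B.
Qed.

Lemma tiling_csum (L : R) F : 0 < L -> cintble setT F ->
  csummable (fun k : 'rV[int]_n => cintegral (cube L) (fun x => F (x + L *: latv k))) /\
  cintegral setT F = csum (fun k => cintegral (cube L) (fun x => F (x + L *: latv k))).
Proof.
move=> L0 [iR iI]; have mc := @measurable_cube R n L.
have [sR ER] := tiling_rsum L0 iR; have [sI EI] := tiling_rsum L0 iI.
split; last by rewrite [LHS]cintE; congr (_ +i* _).
apply: csummable_le (rsummableD sR sI) => k; rewrite cintE /l1C /=.
apply: lerD; apply: le_normr_Rintegral => //.
  exact: (rintbleS mc (rintble_shift _ iR)).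
exact: (rintbleS mc (rintble_shift _ iI)).
Qed.

Lemma tiling_csum_in (L : R) F : 0 < L -> cintble setT F ->
  (forall x, csummable (fun k : 'rV[int]_n => F (x + L *: latv k))) ->
  cintegral setT F = cintegral (cube L) (fun x => csum (fun k => F (x + L *: latv k))).
Proof.
move=> L0 [iR iI] sF; rewrite !cintE; congr (_ +i* _).
  by apply: (tiling_rsum_in L0 iR) => x; exact: csummable_Re.
by apply: (tiling_rsum_in L0 iI) => x; exact: csummable_Im.
Qed.

End complex_integral.

(** * Rapidly decaying functions and their Fourier integrals *)

Section line_derivatives.
Variables (R : realType) (n : nat).
Local Notation V := 'rV[R]_n.
Implicit Types (F G : V -> R[i]) (g s : V -> R) (j : 'I_n).

(** A directional derivative phrased on each line parallel to the j-th axis, so that the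
    one-variable product rule and mean value theorem apply directly. The derivative is an explicit
    candidate [dg], which can then be a closed formula. *)
Definition rpd j g dg := forall (x : V) (t : R),
  is_derive t 1 (fun u : R => g (x + u *: basis_vec j)) (dg (x + t *: basis_vec j)).

Definition cpd j F dF := rpd j (@complex.Re R \o F) (@complex.Re R \o dF) /\
  rpd j (@complex.Im R \o F) (@complex.Im R \o dF).

Lemma rpdD j g dg s ds : rpd j g dg -> rpd j s ds ->
  rpd j (fun x => g x + s x) (fun x => dg x + ds x).
Proof. by move=> hg hs x t; exact: (is_deriveD (hg x t) (hs x t)). Qed.

Lemma rpdB j g dg s ds : rpd j g dg -> rpd j s ds ->
  rpd j (fun x => g x - s x) (fun x => dg x - ds x).
Proof. by move=> hg hs x t; exact: (is_deriveB (hg x t) (hs x t)). Qed.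

Lemma rpdM j g dg s ds : rpd j g dg -> rpd j s ds ->
  rpd j (fun x => g x * s x) (fun x => g x * ds x + dg x * s x).
Proof.
move=> hg hs x t; have h := is_deriveM (hg x t) (hs x t).
by apply: is_derive_eq h _; rewrite /= [X in _ + X]mulrC.
Qed.

Lemma rpd_ext j g dg s ds : s =1 g -> ds =1 dg -> rpd j g dg -> rpd j s ds.
Proof. by move=> /funext -> /funext ->. Qed.

Lemma cpdD j F dF G dG : cpd j F dF -> cpd j G dG ->
  cpd j (fun x => F x + G x) (fun x => dF x + dG x).
Proof.
move=> [FR FI] [GR GI]; split.
  by apply: rpd_ext (rpdD FR GR) => x /=; rewrite cReD.
by apply: rpd_ext (rpdD FI GI) => x /=; rewrite cImD.
Qed.

Lemma cpdM j F dF G dG : cpd j F dF -> cpd j G dG ->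
  cpd j (fun x => F x * G x) (fun x => F x * dG x + dF x * G x).
Proof.
move=> [FR FI] [GR GI]; split.
  apply: rpd_ext (rpdB (rpdM FR GR) (rpdM FI GI)) => x /=; rewrite !cReImE//.
  by ring.
apply: rpd_ext (rpdD (rpdM FR GI) (rpdM FI GR)) => x /=; rewrite !cReImE//.
by ring.
Qed.

Lemma cpd_cst j z : cpd j (cst z) (cst 0).
Proof. by split => x t; exact: is_derive_cst. Qed.

Lemma rpd_coord j i : rpd j (fun x => x 0 i) (cst (j == i)%:R).
Proof.
move=> x t; have h := is_deriveD (is_derive_cst (x 0 i) t 1)
  (is_deriveZ (j == i)%:R (is_derive_id t 1)).
have E : cst (x 0 i) + (j == i)%:R \*: id = (fun u => (x + u *: basis_vec j) 0 i).
  apply/funext => u; rewrite /= !mxE eqxx /= eq_sym.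
  by rewrite mulrC.
by rewrite E in h; apply: is_derive_eq h _; rewrite add0r [_ *: _]mulr1.
Qed.

Lemma cpd_coord j i : cpd j (fun x => (x 0 i)%:C) (cst (j == i)%:R%:C).
Proof. by split; [exact: rpd_coord|move=> x t; exact: is_derive_cst]. Qed.

Lemma rpdN j g dg : rpd j g dg -> rpd j (fun x => g (- x)) (fun x => - dg (- x)).
Proof.
move=> hg x t.
have hN : is_derive t 1 (fun u : R => - u) (- 1) := is_deriveN (is_derive_id t 1).
have h := is_derive1_comp (hg (- x) (- t)) hN.
have E : (fun u : R => g (- x + u *: basis_vec j)) \o (fun u : R => - u) =
    (fun u : R => g (- (x + u *: basis_vec j))).
  by apply/funext => u /=; rewrite opprD scaleNr.
rewrite E in h; apply: is_derive_eq h _.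
by rewrite mulrN1 scaleNr -opprD.
Qed.

Lemma cpdN j F dF : cpd j F dF -> cpd j (fun x => F (- x)) (fun x => - dF (- x)).
Proof.
move=> [FR FI]; split.
  by apply: rpd_ext (rpdN FR) => x /=; rewrite ?cReN.
by apply: rpd_ext (rpdN FI) => x /=; rewrite ?cImN.
Qed.

Lemma derivable_rpd j g : (forall x, derivable g x (basis_vec j)) ->
  rpd j g (fun x => 'D_(basis_vec j) g x).
Proof.
move=> dg x t; set y := x + t *: basis_vec j.
have E : (fun h : R => h^-1 *: (((fun u => g (x + u *: basis_vec j)) \o shift t) (h *: 1) -
      g (x + t *: basis_vec j))) =
    (fun h : R => h^-1 *: ((g \o shift y) (h *: basis_vec j) - g y)).
  apply/funext => h /=; congr (_ *: (g _ - _)).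
  by rewrite /y [h *: 1]mulr1 scalerDl addrCA.
split; first by rewrite /derivable E; exact: dg.
by rewrite /derive E.
Qed.

(** The error of the difference quotient is at most K |h|; K may vary with the base point. This is
    how transforms are differentiated. *)
Lemma quadratic_rpd j g dg : (forall x : V, exists K : R, forall u, `|u| <= 1 ->
    `|g (x + u *: basis_vec j) - g x - u * dg x| <= K * u ^+ 2) ->
  rpd j g dg.
Proof.
move=> hg x t; set y := x + t *: basis_vec j; have [K hK] := hg y.
(* The sign of K is read off from the hypothesis at u = 1. *)
have K0 : 0 <= K.
  by have := hK 1; rewrite normr1 expr1n mulr1 => /(_ (lexx 1)); exact: le_trans.
have E (h : R) : ((fun u => g (x + u *: basis_vec j)) \o shift t) (h *: 1) =
    g (y + h *: basis_vec j).
  by rewrite /= /y [h *: 1]mulr1 scalerDl addrA addrAC.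
have lim : h^-1 *: (((fun u => g (x + u *: basis_vec j)) \o shift t) (h *: (1 : R)) -
      g (x + t *: basis_vec j)) @[h --> (0 : R)^'] --> dg y.
  apply/cvgrPdist_le => e e0.
  near=> h.
  have h0 : h != 0 by near: h; exact: nbhs_dnbhs_neq.
  have h1 : `|h| <= 1 by near: h; apply: dnbhs0_le.
  have h2 : `|h| <= e / (K + 1) by near: h; apply: dnbhs0_le; rewrite divr_gt0// ltr_wpDl.
  rewrite E -/y distrC -[_ *: _]/(h^-1 * _).
  have -> : h^-1 * (g (y + h *: basis_vec j) - g y) - dg y =
     h^-1 * (g (y + h *: basis_vec j) - g y - h * dg y).
    by rewrite [in RHS]mulrBr mulKf.
  rewrite normrM normfV ler_pdivrMl ?normr_gt0//.
  apply: (le_trans (hK _ h1)); rewrite -real_normK ?num_real// expr2 mulrCA.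
  rewrite ler_wpM2l//; apply: (@le_trans _ _ ((K + 1) * `|h|)).
    by rewrite ler_wpM2r// lerDl.
  by rewrite mulrC -ler_pdivlMr// ltr_wpDl.
have d : derivable (fun u : R => g (x + u *: basis_vec j)) t (1 : R).
  by apply/cvg_ex; exists (dg y).
by split => //; exact: cvg_lim lim.
Unshelve. all: by end_near. Qed.

(** Two uses of the mean value inequality, on dg and then on g minus its tangent; they give B
    instead of the sharp B / 2. *)
Lemma taylor1 j g dg ddg (x : V) (t B : R) : rpd j g dg -> rpd j dg ddg ->
  (forall u : R, `|u| <= `|t| -> `|ddg (x + u *: basis_vec j)| <= B) ->
  `|g (x + t *: basis_vec j) - g x - t * dg x| <= B * t ^+ 2.
Proof.
move=> hg hdg hB.
have h1 (v : R) : `|v| <= `|t| -> `|dg (x + v *: basis_vec j) - dg x| <= B * `|t|.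
  move=> st; have := @MVT_lipschitz _ (fun u => dg (x + u *: basis_vec j))
    (fun u => ddg (x + u *: basis_vec j)) B v (hdg x).
  rewrite scale0r addr0 => h; apply: le_trans (h _) _.
    by move=> u us; apply: hB; exact: le_trans us st.
  rewrite ler_wpM2l//; apply: le_trans (hB 0 _); rewrite ?normr0//.
have := @MVT_lipschitz _ (fun u => g (x + u *: basis_vec j) - u * dg x)
  (fun u => dg (x + u *: basis_vec j) - dg x) (B * `|t|) t.
rewrite scale0r addr0 mul0r subr0 addrAC => h.
apply: le_trans (h _ h1) _; last by rewrite -mulrA -expr2 real_normK ?num_real.
move=> u; have hu := is_deriveB (hg x u) (is_deriveM (is_derive_id u 1) (is_derive_cst (dg x) u 1)).
apply: is_derive_eq hu _.
by rewrite scaler0 add0r [_ *: 1]mulr1.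
Qed.

End line_derivatives.

(** * Rapid decay and slow growth with derivatives in one direction *)

Section rapid_decay.
Variables (R : realType) (n : nat).
Local Notation V := 'rV[R]_n.
Implicit Types (F G : V -> R[i]) (j : 'I_n).

Definition decaying F := forall N, exists C : R, forall x, sqjap x ^+ N * l1C (F x) <= C.

Definition slowly_growing F := exists C N, forall x, l1C (F x) <= C * sqjap x ^+ N.

(* [rapid j q F]: [F] and its first [q] derivatives in the single direction [j] exist
   and decay faster than any power; mixed derivatives are never needed, since the
   weights [xi_j ^+ q] for each [j] separately control any power of [sqjap]. *)
Fixpoint rapid j q F : Prop := [/\ ccont F, decaying F &
  if q is q'.+1 then exists2 dF, cpd j F dF & rapid j q' dF else True].

Fixpoint slow j q F : Prop := [/\ ccont F, slowly_growing F &
  if q is q'.+1 then exists2 dF, cpd j F dF & slow j q' dF else True].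

Lemma rapid_ccont j q F : rapid j q F -> ccont F. Proof. by case: q => [|q] []. Qed.
Lemma rapid_decaying j q F : rapid j q F -> decaying F. Proof. by case: q => [|q] []. Qed.
Lemma slow_growing j q F : slow j q F -> slowly_growing F.
Proof. by case: q => [|q] []. Qed.

Lemma rapid_pred j q F : rapid j q.+1 F -> rapid j q F.
Proof.
elim: q F => [|q IH] F; first by case.
by move=> [cF dF [dF' FdF rdF]]; split => //; exists dF' => //; exact: IH.
Qed.

Lemma slow_pred j q F : slow j q.+1 F -> slow j q F.
Proof.
elim: q F => [|q IH] F; first by case.
by move=> [cF dF [dF' FdF rdF]]; split => //; exists dF' => //; exact: IH.
Qed.

Lemma decayingD F G : decaying F -> decaying G -> decaying (fun x => F x + G x).
Proof.
move=> dF dG N; have [C hC] := dF N; have [D hD] := dG N; exists (C + D) => x.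
apply: le_trans (lerD (hC x) (hD x)); rewrite -mulrDr ler_wpM2l ?l1CD//.
exact: ltW (sqjapX_gt0 _ _).
Qed.

Lemma decayingM F G : slowly_growing F -> decaying G -> decaying (fun x => F x * G x).
Proof.
move=> [C [M hF]] dG N; have [D hD] := dG (N + M)%N; exists (C * D) => x.
have w0 k := ltW (sqjapX_gt0 x k).
apply: (@le_trans _ _ (sqjap x ^+ N * (C * sqjap x ^+ M * l1C (G x)))).
  rewrite ler_wpM2l//; apply: (le_trans (l1CM _ _)).
  by rewrite ler_wpM2r ?l1C_ge0.
have C0 : 0 <= C.
  have := le_trans (l1C_ge0 _) (hF x); by rewrite pmulr_lge0// sqjapX_gt0.
apply: le_trans (ler_wpM2l C0 (hD x)).
by rewrite exprD le_eqVlt; apply/orP; left; apply/eqP; ring.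
Qed.

Lemma rapidD j q F G : rapid j q F -> rapid j q G -> rapid j q (fun x => F x + G x).
Proof.
elim: q F G => [|q IH] F G [cF dF hF] [cG dG hG].
  by split => //; [exact: ccontD|exact: decayingD].
split; [exact: ccontD|exact: decayingD|].
case: hF hG => [F' cF' rF'] [G' cG' rG'].
by exists (fun x => F' x + G' x); [exact: cpdD|exact: IH].
Qed.

Lemma rapidM j q F G : slow j q F -> rapid j q G -> rapid j q (fun x => F x * G x).
Proof.
elim: q F G => [|q IH] F G sF rG.
  case: sF rG => [cF dF _] [cG dG _].
  by split => //; [exact: ccontM|exact: decayingM].
(* In each Leibniz term the factor left undifferentiated has one order to spare, which is dropped so
   that the induction hypothesis applies. *)
have sFq := slow_pred sF; have rGq := rapid_pred rG.
case: sF rG => [cF dF [F' cF' rF']] [cG dG [G' cG' rG']].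
split; [exact: ccontM|exact: decayingM|].
exists (fun x => F x * G' x + F' x * G x); first exact: cpdM.
by apply: rapidD; exact: IH.
Qed.

Lemma slowly_growing_cst z : slowly_growing (cst z).
Proof. by exists (l1C z), 0%N => x; rewrite expr0 mulr1. Qed.

Lemma slow_cst j q z : slow j q (cst z).
Proof.
elim: q z => [|q IH] z; split => //; try exact: ccont_cst; try exact: slowly_growing_cst.
by exists (cst 0); [exact: cpd_cst|exact: IH].
Qed.

Lemma slow_coord j q i : slow j q (fun x : V => (x 0 i)%:C).
Proof.
have sg : slowly_growing (fun x : V => (x 0 i)%:C).
  by exists 1, 1%N => x; rewrite l1C_real expr1 mul1r coord_le_sqjap.
have cc : ccont (fun x : V => (x 0 i)%:C) by apply: ccont_real; exact: continuous_coord.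
case: q => [|q]; split => //; exists (cst (j == i)%:R%:C); first exact: cpd_coord.
exact: slow_cst.
Qed.

Lemma rapidZ j q z F : rapid j q F -> rapid j q (fun x => z * F x).
Proof. by move=> rF; apply: (rapidM (slow_cst j q z)). Qed.

Lemma continuous_oppV : continuous (fun x : V => - x).
Proof. by move=> x; exact: opp_continuous. Qed.

Lemma ccont_opp F : ccont F -> ccont (fun x => F (- x)).
Proof.
move=> [cR cI]; split => x.
  exact: (continuous_comp (@continuous_oppV x) (cR (- x))).
exact: (continuous_comp (@continuous_oppV x) (cI (- x))).
Qed.

Lemma decaying_opp F : decaying F -> decaying (fun x => F (- x)).
Proof. by move=> dF N; have [C hC] := dF N; exists C => x; rewrite -sqjapN. Qed.

Lemma rapid_opp j q F : rapid j q F -> rapid j q (fun x => F (- x)).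
Proof.
elim: q F => [|q IH] F [cF dF hF].
  by split => //; [exact: ccont_opp|exact: decaying_opp].
split; [exact: ccont_opp|exact: decaying_opp|].
case: hF => [F' cF' rF']; exists (fun x => - F' (- x)); first exact: cpdN.
rewrite (_ : (fun x => - F' (- x)) = fun x => -1 * F' (- x)).
  by apply: rapidZ; exact: IH.
by apply/funext => x; rewrite mulN1r.
Qed.

Definition Rapid F := forall j q, rapid j q F.

Lemma Rapid_coordM i F : Rapid F -> Rapid (fun x => (x 0 i)%:C * F x).
Proof. by move=> rF j q; apply: rapidM; [exact: slow_coord|exact: rF]. Qed.

Lemma RapidZ z F : Rapid F -> Rapid (fun x => z * F x).
Proof. by move=> rF j q; exact: rapidZ. Qed.

Lemma exprD_le (a b : R) N : 0 <= a -> 0 <= b -> (a + b) ^+ N <= 2 ^+ N * (a ^+ N + b ^+ N).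
Proof.
move=> a0 b0; have aN : 0 <= a ^+ N by rewrite exprn_ge0.
have bN : 0 <= b ^+ N by rewrite exprn_ge0.
have [ab|/ltW ba] := leP a b.
  apply: (@le_trans _ _ ((2 * b) ^+ N)); last by rewrite exprMn ler_wpM2l ?exprn_ge0// lerDr.
  by apply: lerXn2r; rewrite ?nnegrE ?addr_ge0 ?mulr_ge0//; lra.
apply: (@le_trans _ _ ((2 * a) ^+ N)); last by rewrite exprMn ler_wpM2l ?exprn_ge0// lerDl.
by apply: lerXn2r; rewrite ?nnegrE ?addr_ge0 ?mulr_ge0//; lra.
Qed.

(** This is what lets powers of single coordinates control a power of [sqjap], and hence makes pure
    derivatives sufficient. The induction peels off one coordinate at a time with [exprD_le]. *)
Lemma expr_sum_le (N : nat) (s : seq 'I_n) : exists C : R, 0 <= C /\ forall x : V,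
  (1 + \sum_(i <- s) x 0 i ^+ 2) ^+ N <= C * (1 + \sum_(i <- s) x 0 i ^+ (2 * N)).
Proof.
elim: s => [|i s [C [C0 hC]]].
  by exists 1; split => // x; rewrite !big_nil addr0 expr1n mulr1.
exists (2 ^+ N * (C + 1)); split; first by rewrite mulr_ge0 ?exprn_ge0 ?addr_ge0.
move=> x; rewrite !big_cons.
have := hC x; set A := 1 + \sum_(_ <- _) _ ^+ 2; set B := 1 + \sum_(_ <- _) _.
move=> AB; set a := x 0 i ^+ 2; set b := x 0 i ^+ (2 * N).
have a0 : 0 <= a by rewrite sqr_ge0.
have A0 : 0 <= A.
  by rewrite addr_ge0// sumr_ge0// => k _; rewrite sqr_ge0.
have B0 : 0 <= B.
  by rewrite addr_ge0// sumr_ge0// => k _; rewrite exprM exprn_ge0// sqr_ge0.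
have bE : b = a ^+ N by rewrite /b exprM.
rewrite (addrCA 1 a) -/A (addrCA 1 b) -/B bE.
apply: (@le_trans _ _ (2 ^+ N * (a ^+ N + A ^+ N))).
  exact: exprD_le.
rewrite -mulrA ler_wpM2l ?exprn_ge0// mulrDl mul1r mulrDr.
have aN : 0 <= a ^+ N by rewrite exprn_ge0.
have : 0 <= C * a ^+ N by rewrite mulr_ge0.
by lra.
Qed.

Lemma decaying_coord F : (exists C : R, forall x, l1C (F x) <= C) ->
  (forall (i : 'I_n) N, exists C : R, forall x : V, `|x 0 i| ^+ (2 * N) * l1C (F x) <= C) ->
  decaying F.
Proof.
move=> [C0 h0] h N; have [C [C_ge0 hC]] := expr_sum_le N (index_enum 'I_n).
have /choice[D hD] i := h i N.
exists (C * (C0 + \sum_i D i)) => x.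
have wE : sqjap x = 1 + \sum_i x 0 i ^+ 2.
  by rewrite /sqjap /dot; congr (_ + _); apply: eq_bigr => i _; rewrite expr2.
apply: (@le_trans _ _ (C * (1 + \sum_i x 0 i ^+ (2 * N)) * l1C (F x))).
  by rewrite wE ler_wpM2r ?l1C_ge0// hC.
rewrite -mulrA ler_wpM2l// mulrDl mul1r lerD ?h0// mulr_suml.
apply: ler_sum => i _; apply: le_trans (hD i x).
by rewrite exprM -real_normK ?num_real// -exprM.
Qed.

End rapid_decay.

(** * Fourier integrals: decay and differentiation *)

Section fourier_integral.
Variables (R : realType) (n : nat).
Local Notation V := 'rV[R]_n.
Implicit Types (F G h : V -> R[i]) (j : 'I_n) (z : V).

(** Sign plus and no constant: this is the outer integral of [psdoR] as it stands, and [fourierR] is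
    recovered at -z with the factor (2 pi)^-n. *)
Definition fint z h : R[i] := cintegral setT (fun y => expi (dot z y) * h y).

(** Of the n + N powers available, n pay for integrability and N remain as a weight. *)
Lemma decaying_sumdecay F N : decaying F ->
  exists C : R, 0 <= C /\ forall x, sqjap x ^+ N * l1C (F x) <= C * sumdecay x.
Proof.
move=> dF; have [C hC] := dF (n + N)%N; exists C; split.
  by apply: le_trans (hC 0); rewrite mulr_ge0 ?l1C_ge0// ltW// sqjapX_gt0.
move=> x; rewrite /sumdecay ler_pdivlMr ?sqjapX_gt0//.
by apply: le_trans (hC x); rewrite exprD mulrC mulrA.
Qed.

Lemma decaying_sumdecay0 F : decaying F ->
  exists C : R, 0 <= C /\ forall x, l1C (F x) <= C * sumdecay x.
Proof.
move=> /(decaying_sumdecay 0)[C [C0 hC]]; exists C; split => // x.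
by apply: le_trans (hC x); rewrite expr0 mul1r.
Qed.

Lemma ccont_expi_dot z : ccont (fun y : V => expi (dot z y)).
Proof. by apply: ccont_expi; exact: continuous_dot. Qed.

Lemma ccont_fint_integrand z F : ccont F -> ccont (fun y => expi (dot z y) * F y).
Proof. by apply: ccontM; exact: ccont_expi_dot. Qed.

Lemma cintble_sumdecay (C : R) F : ccont F -> (forall x, l1C (F x) <= C * sumdecay x) ->
  cintble setT F.
Proof.
move=> cF hF; have is_ := @rintble_sumdecay R n C.
exact: (cintble_le measurableT (ccont_cmeas cF) (fun x _ => hF x) is_).
Qed.

Lemma cintble_expi_mul (g : V -> R) F : continuous g -> ccont F -> decaying F ->
  cintble setT (fun y => expi (g y) * F y).
Proof.
move=> cg cF /decaying_sumdecay0[C [C0 hC]].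
apply: (@cintble_sumdecay (2 * C)); first exact/ccontM/cF/ccont_expi.
by move=> x; apply: (le_trans (l1C_expiM _ _)); rewrite -mulrA ler_wpM2l.
Qed.

Lemma cintble_fint z F : ccont F -> decaying F ->
  cintble setT (fun y => expi (dot z y) * F y).
Proof. by apply: cintble_expi_mul; exact: continuous_dot. Qed.

Definition Isum : R := rint setT (@sumdecay R n).

Lemma l1C_cint_sumdecay (C : R) F : ccont F -> (forall x, l1C (F x) <= C * sumdecay x) ->
  l1C (cintegral setT F) <= C * Isum.
Proof.
move=> cF hF; rewrite /Isum -(rintZ C measurableT (@integrable_sumdecay R n)).
have is_ := @rintble_sumdecay R n C.
exact: (l1C_cint_le2 measurableT (ccont_cmeas cF) is_ (fun x _ => hF x)).
Qed.

Lemma fint_bounded F : ccont F -> decaying F -> exists C : R, forall z, l1C (fint z F) <= C.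
Proof.
move=> cF /decaying_sumdecay0[C [C0 hC]]; exists (2 * C * Isum) => z.
apply: l1C_cint_sumdecay; first exact: ccont_fint_integrand.
by move=> x; apply: (le_trans (l1C_expiM _ _)); rewrite -mulrA ler_wpM2l.
Qed.

(** The phases differ by at most 6 |z - z'| n [sqjap y]; one power of the weight absorbs the
    dependence on y. *)
Lemma fint_lipschitz F : ccont F -> decaying F ->
  exists C : R, forall z z', l1C (fint z F - fint z' F) <= C * `|z - z'|.
Proof.
move=> cF dF; have [C [C0 hC]] := decaying_sumdecay 1 dF.
exists (6 * (n%:R * C) * Isum) => z z'; rewrite /fint -(cintB measurableT)//; try exact: cintble_fint.
rewrite mulrAC; apply: l1C_cint_sumdecay.
  rewrite (_ : (fun x => _) = fun x => expi (dot z x) * F x + (-1) * (expi (dot z' x) * F x)).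
    apply: ccontD; first exact: ccont_fint_integrand.
    by apply: ccontM; [exact: ccont_cst|exact: ccont_fint_integrand].
  by apply/funext => x; rewrite mulN1r.
move=> x; rewrite -mulrBl; apply: (le_trans (l1CM _ _)).
have h1 := l1C_expiB (dot z x) (dot z' x).
rewrite -dotBl in h1.
have h2 := norm_dot_le (z - z') x.
apply: (@le_trans _ _ (6 * (`|z - z'| * (n%:R * sqjap x)) * l1C (F x))).
  by rewrite ler_wpM2r ?l1C_ge0//; apply: le_trans h1 _; rewrite ler_wpM2l.
have := hC x; rewrite expr1 => h3.
apply: (@le_trans _ _ (6 * `|z - z'| * n%:R * (C * sumdecay x))); last first.
  by rewrite le_eqVlt; apply/orP; left; apply/eqP; ring.
apply: le_trans (ler_wpM2l _ h3); last by rewrite !mulr_ge0.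
by rewrite le_eqVlt; apply/orP; left; apply/eqP; ring.
Qed.

Lemma lipschitz_ccont (F : V -> R[i]) (C : R) :
  (forall z z', l1C (F z - F z') <= C * `|z - z'|) -> ccont F.
Proof.
move=> hF.
have H (g : V -> R) : (forall z z', `|g z - g z'| <= C * `|z - z'|) -> continuous g.
  move=> hg z; apply/(@cvgrPdist_le _ _ _ _ (nbhs_filter z)) => e e0.
  have C1 : 0 < `|C| + 1 by rewrite ltr_wpDl.
  have d0 : 0 < e / (`|C| + 1) by rewrite divr_gt0.
  apply/(@nbhs_normP R 'rV[R]_n z); exists (e / (`|C| + 1)) => // z' /ltW zz'.
  apply: (le_trans (hg _ _)).
  apply: (@le_trans _ _ ((`|C| + 1) * `|z - z'|)).
    by rewrite ler_wpM2r// (le_trans (ler_norm _))// lerDl.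
  by rewrite mulrC -ler_pdivlMr.
split; apply: H => z z'.
  by apply: le_trans (hF z z'); apply: le_trans (normRe_l1C _); rewrite cReD cReN.
by apply: le_trans (hF z z'); apply: le_trans (normIm_l1C _); rewrite cImD cImN.
Qed.

Lemma ccont_fint F : ccont F -> decaying F -> ccont (fun z => fint z F).
Proof. by move=> cF dF; have [C hC] := fint_lipschitz cF dF; exact: lipschitz_ccont hC. Qed.

Lemma ccont_coord j : ccont (fun x : V => (x 0 j)%:C).
Proof. by apply: ccont_real; exact: continuous_coord. Qed.

Lemma decaying_coordM j F : decaying F -> decaying (fun y => (y 0 j)%:C * F y).
Proof. exact: (decayingM (slow_growing (slow_coord R j 0 j))). Qed.

(** The factor i y_j is what differentiating the phase in z_j brings down. *)
Definition coordM j F (y : V) := 'i * ((y 0 j)%:C * F y).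

Lemma ccont_coordM j F : ccont F -> ccont (coordM j F).
Proof.
by move=> cF; apply: ccontM; [exact: ccont_cst|apply: ccontM => //; exact: ccont_coord].
Qed.

Lemma decaying_icoordM j F : decaying F -> decaying (coordM j F).
Proof. by move=> dF; apply: decayingM; [exact: slowly_growing_cst|exact: decaying_coordM]. Qed.

(** Differentiation under the integral with an explicit remainder, from [l1C_expiB2] at u y_j. The
    weight y_j^2 is absorbed by one power of [sqjap], and 6 = 2 * 3 combines the bounds on the phase
    and on the remainder. *)
Lemma fint_taylor j F : ccont F -> decaying F -> exists C : R, forall z (u : R),
  l1C (fint (z + u *: basis_vec j) F - fint z F - u%:C * fint z (coordM j F)) <= C * u ^+ 2.
Proof.
move=> cF dF; have [C [C0 hC]] := decaying_sumdecay 1 dF.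
have [cM dM] := (ccont_coordM j cF, decaying_icoordM j dF).
exists (6 * C * Isum) => z u.
have iF1 := cintble_fint (z + u *: basis_vec j) cF dF.
have iF2 := cintble_fint z cF dF.
have iM := cintble_fint z cM dM.
have iB : cintble setT (fun y => expi (dot (z + u *: basis_vec j) y) * F y - expi (dot z y) * F y).
  rewrite (_ : (fun y => _) = fun y => expi (dot (z + u *: basis_vec j) y) * F y +
      -1 * (expi (dot z y) * F y)).
    by apply: (cintbleD measurableT) => //; exact: (cintbleZ _ measurableT).
  by apply/funext => y; rewrite mulN1r.
rewrite /fint -(cintB measurableT iF1 iF2) -(cintZ u%:C measurableT iM).
rewrite -(cintB measurableT iB (cintbleZ u%:C measurableT iM)).
rewrite mulrAC.
rewrite (_ : 6 * C * u ^+ 2 = 6 * u ^+ 2 * C); last by ring.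
have E y : expi (dot (z + u *: basis_vec j) y) * F y - expi (dot z y) * F y -
    u%:C * (expi (dot z y) * coordM j F y) =
    expi (dot z y) * ((expi (u * y 0 j) - 1 - 'i * (u * y 0 j)%:C) * F y).
  rewrite dotDl dotZl dot_basis expiD /coordM rmorphM /=; ring.
apply: l1C_cint_sumdecay => [|y]; last first.
  rewrite E; apply: (le_trans (l1C_expiM _ _)).
  apply: (@le_trans _ _ (2 * (3 * (u * y 0 j) ^+ 2 * l1C (F y)))).
    by rewrite ler_wpM2l//; apply: (le_trans (l1CM _ _)); rewrite ler_wpM2r ?l1C_ge0// l1C_expiB2.
  apply: (@le_trans _ _ (6 * u ^+ 2 * (sqjap y ^+ 1 * l1C (F y)))).
    have -> : 2 * (3 * (u * y 0 j) ^+ 2 * l1C (F y)) = 6 * u ^+ 2 * (y 0 j ^+ 2 * l1C (F y)).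
      by ring.
    apply: ler_wpM2l; first by rewrite mulr_ge0 ?sqr_ge0.
    apply: ler_wpM2r; first exact: l1C_ge0.
    by rewrite expr1; apply: le_trans (sqr_le_sqjap y j); rewrite lerDr.
  by rewrite -[leRHS]mulrA; apply: ler_wpM2l; [rewrite mulr_ge0 ?sqr_ge0|exact: hC].
rewrite (_ : (fun y => _) = fun y => expi (dot (z + u *: basis_vec j) y) * F y +
    ((-1) * (expi (dot z y) * F y) + (- u%:C) * (expi (dot z y) * coordM j F y))).
  apply: ccontD; first exact: ccont_fint_integrand.
  by apply: ccontD; apply: ccontM; try exact: ccont_cst; exact: ccont_fint_integrand.
by apply/funext => y; rewrite addrA mulN1r mulNr.
Qed.

Lemma cpd_fint j F : ccont F -> decaying F -> cpd j (fun z => fint z F) (fun z => fint z (coordM j F)).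
Proof.
move=> cF dF; have [C hC] := fint_taylor j cF dF.
split; apply: quadratic_rpd => z; exists C => u _; apply: le_trans (hC z u).
  apply: le_trans (normRe_l1C _).
  by rewrite !cReImE /= mul0r subr0.
apply: le_trans (normIm_l1C _).
by rewrite !cReImE /= mul0r addr0.
Qed.

Lemma fint_translate z (c : V) F : ccont F -> decaying F ->
  cintble setT (fun y => expi (dot z y) * F (y + c)) /\
  cintegral setT (fun y => expi (dot z y) * F (y + c)) = expi (- dot z c) * fint z F.
Proof.
move=> cF dF.
have E y : expi (dot z y) * F (y + c) = expi (- dot z c) * (expi (dot z (y + c)) * F (y + c)).
  by rewrite mulrA -expiD dotDr addrCA addNr addr0.
have iF := cintble_fint z cF dF.
have iS : cintble setT (fun y => expi (dot z (y + c)) * F (y + c)).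
  by case: iF => iR iI; split; [exact: (rintble_shift c iR)|exact: (rintble_shift c iI)].
rewrite (_ : (fun y => _) = fun y => expi (- dot z c) * (expi (dot z (y + c)) * F (y + c))).
  split; first exact: (cintbleZ _ measurableT iS).
  rewrite (cintZ _ measurableT iS) /fint.
  congr (_ * _); apply: (cint_shift (F := fun y => expi (dot z y) * F y)).
  exact/ccont_cmeas/ccont_fint_integrand.
by apply/funext.
Qed.

(** The remainder is dominated by [sumdecay] at the base point x, hence integrable in x. For |v| <=
    1 the shift v e_j costs at most 2^n * 2^n = 4^n by [sumdecayD]; the factor 2 counts real and
    imaginary parts. *)
Lemma cpd_taylor j F dF ddF : cpd j F dF -> cpd j dF ddF -> decaying ddF ->
  exists C : R, 0 <= C /\ forall x (u : R), `|u| <= 1 ->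
  l1C (F (x + u *: basis_vec j) - F x - u%:C * dF x) <= C * u ^+ 2 * sumdecay x.
Proof.
move=> [FR FI] [dFR dFI] /decaying_sumdecay0[C [C0 hC]].
exists (2 * (C * 4 ^+ n)); split; first by rewrite !mulr_ge0// exprn_ge0.
move=> x u u1.
have B (v : R) : `|v| <= `|u| -> l1C (ddF (x + v *: basis_vec j)) <= C * 4 ^+ n * sumdecay x.
  move=> vu; apply: (le_trans (hC _)); rewrite -mulrA ler_wpM2l//.
  apply: (le_trans (sumdecayD _ _)); rewrite ler_wpM2r ?sumdecay_ge0//.
  have h : sqjap (v *: basis_vec j) <= 2.
    rewrite /sqjap dotZl dotZr dot_basis /basis_vec mxE !eqxx mulr1 -expr2.
    rewrite -real_normK ?num_real// (_ : 2 = 1 + 1 ^+ 2)// ?lerD2l.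
      by apply: lerXn2r; rewrite ?nnegrE//; exact: le_trans vu u1.
    by rewrite expr1n.
  have j0 := sqjap_gt0 (v *: basis_vec j).
  by rewrite -exprMn; apply: lerXn2r; rewrite ?nnegrE; lra.
have hR := taylor1 FR dFR (fun v vu => le_trans (normRe_l1C _) (B v vu)).
have hI := taylor1 FI dFI (fun v vu => le_trans (normIm_l1C _) (B v vu)).
rewrite /l1C !cReImE /= !mul0r subr0 addr0.
have -> : 2 * (C * 4 ^+ n) * u ^+ 2 * sumdecay x =
  C * 4 ^+ n * sumdecay x * u ^+ 2 + C * 4 ^+ n * sumdecay x * u ^+ 2 by ring.
exact: lerD hR hI.
Qed.

Lemma l1C_le_linear_eq0 (a : R[i]) (K : R) :
  (forall u : R, 0 < u -> u <= 1 -> u * l1C a <= K * u ^+ 2) -> a = 0.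
Proof.
move=> h; apply: l1C_eq0; apply/ler_addgt0Pr => e e0; rewrite add0r.
have K1 : 0 < `|K| + 1 by rewrite ltr_wpDl.
pose u := Num.min 1 (e / (`|K| + 1)).
have u0 : 0 < u by rewrite lt_min ltr01 divr_gt0.
have u1 : u <= 1 by rewrite ge_min lexx.
have ue : u <= e / (`|K| + 1) by rewrite ge_min lexx orbT.
have := h u u0 u1; rewrite expr2 mulrCA ler_pM2l// => hu.
apply: (le_trans hu); apply: (@le_trans _ _ ((`|K| + 1) * u)).
  by apply: ler_wpM2r; [exact: ltW|rewrite (le_trans (ler_norm _))// lerDl].
by rewrite mulrC -ler_pdivlMr.
Qed.

(* Integration by parts, obtained by differentiating the translation invariance of the
   integral. *)
Lemma coord_fint j z F dF ddF : cpd j F dF -> cpd j dF ddF ->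
  ccont F -> decaying F -> ccont dF -> decaying dF -> decaying ddF ->
  (z 0 j)%:C * fint z F = 'i * fint z dF.
Proof.
move=> FdF dFddF cF decF cdF decdF decddF.
have [C [C0 hC]] := cpd_taylor FdF dFddF decddF.
set I0 := fint z F; set I1 := fint z dF.
(* Multiplying this relation by i gives the claim; in this form it is the coefficient of u in the
   comparison of two expansions of one integral. *)
suff h : 'i * ((z 0 j)%:C * I0) + I1 = 0.
  have : 'i * ('i * ((z 0 j)%:C * I0) + I1) = 0 by rewrite h mulr0.
  rewrite mulrDr mulrA -expr2 sqr_i mulN1r addrC => /eqP.
  by rewrite subr_eq0 => /eqP.
apply: (@l1C_le_linear_eq0 _ (2 * C * Isum + 3 * (z 0 j) ^+ 2 * l1C I0)) => u u0 u1.
have un : `|u| <= 1 by rewrite gtr0_norm.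
have [iS ES] := fint_translate z (u *: basis_vec j) cF decF.
have iF := cintble_fint z cF decF; have idF := cintble_fint z cdF decdF.
have iB : cintble setT (fun y => expi (dot z y) * F (y + u *: basis_vec j) - expi (dot z y) * F y).
  rewrite (_ : (fun y => _) = fun y => expi (dot z y) * F (y + u *: basis_vec j) +
      -1 * (expi (dot z y) * F y)).
    by apply: (cintbleD measurableT) => //; exact: (cintbleZ _ measurableT).
  by apply/funext => y; rewrite mulN1r.
have h1 : l1C (expi (- dot z (u *: basis_vec j)) * I0 - I0 - u%:C * I1) <= 2 * (C * u ^+ 2) * Isum.
  rewrite -ES /I0 /I1 /fint -(cintB measurableT iS iF) -(cintZ u%:C measurableT idF).
  rewrite -(cintB measurableT iB (cintbleZ u%:C measurableT idF)).
  have E y : expi (dot z y) * F (y + u *: basis_vec j) - expi (dot z y) * F y -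
      u%:C * (expi (dot z y) * dF y) =
      expi (dot z y) * (F (y + u *: basis_vec j) - F y - u%:C * dF y) by ring.
  apply: l1C_cint_sumdecay => [|y]; last first.
    rewrite E; apply: (le_trans (l1C_expiM _ _)); rewrite -mulrA ler_wpM2l//.
    exact: hC.
  rewrite (_ : (fun y => _) = fun y => expi (dot z y) * F (y + u *: basis_vec j) +
      ((-1) * (expi (dot z y) * F y) + (- u%:C) * (expi (dot z y) * dF y))).
    apply: ccontD; first by apply: ccont_fint_integrand; exact: ccont_shift.
    by apply: ccontD; apply: ccontM; try exact: ccont_cst; exact: ccont_fint_integrand.
  by apply/funext => y; rewrite addrA mulN1r mulNr.
have := l1C_expiB2 (- dot z (u *: basis_vec j)).
rewrite dotZr (dotC z) dot_basis in h1 *.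
set t := - (u * z 0 j) in h1 *; move=> h2.
have -> : u * l1C ('i * ((z 0 j)%:C * I0) + I1) =
    l1C (u%:C * ('i * ((z 0 j)%:C * I0) + I1)) by rewrite l1CM_real gtr0_norm.
(* The integral of the translate by u e_j equals [expi t * I0] with t = -u z_j. Expanding the phase
   and expanding F leave two remainders of order u^2, whose difference is the linear term. *)
have -> : u%:C * ('i * ((z 0 j)%:C * I0) + I1) =
    (expi t - 1 - 'i * t%:C) * I0 - (expi t * I0 - I0 - u%:C * I1).
  by rewrite /t rmorphN rmorphM /=; ring.
apply: (le_trans (l1CB _ _)); rewrite addrC.
have h3 : l1C ((expi t - 1 - 'i * t%:C) * I0) <= 3 * t ^+ 2 * l1C I0.
  by apply: (le_trans (l1CM _ _)); rewrite ler_wpM2r ?l1C_ge0.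
apply: (le_trans (lerD h1 h3)).
by rewrite le_eqVlt; apply/orP; left; apply/eqP; rewrite /t; ring.
Qed.

(** Each power of z_j is traded for one derivative by [coord_fint], whose proof also uses a second
    derivative; the order N + 2 keeps that one available at every step. *)
Lemma coord_fint_bounded j N F : rapid j N.+2 F ->
  exists C : R, forall z, `|z 0 j| ^+ N * l1C (fint z F) <= C.
Proof.
elim: N F => [|N IH] F rF.
  have [C hC] := fint_bounded (rapid_ccont rF) (rapid_decaying rF).
  by exists C => z; rewrite expr0 mul1r.
have cF := rapid_ccont rF; have decF := rapid_decaying rF.
case: rF => _ _ [dF FdF rdF]; have [C hC] := IH dF rdF.
case: rdF => cdF decdF [ddF dFddF [_ decddF _]].
exists C => z; apply: le_trans (hC z); rewrite exprSr -mulrA -l1CM_real.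
by rewrite (coord_fint z FdF dFddF cF decF cdF decdF decddF) l1CMi.
Qed.

Lemma decaying_fint F : ccont F -> decaying F -> Rapid F -> decaying (fun z => fint z F).
Proof.
move=> cF dF rF; apply: decaying_coord => [|i N]; first exact: fint_bounded.
exact: coord_fint_bounded (rF i _).
Qed.

(** The derivative of a transform is the transform of [coordM j F], which lies in the same class, so
    the induction on q closes. *)
Lemma rapid_fint j q F : ccont F -> decaying F -> Rapid F -> rapid j q (fun z => fint z F).
Proof.
elim: q F => [|q IH] F cF dF rF.
  by split => //; [exact: ccont_fint|exact: decaying_fint].
split; [exact: ccont_fint|exact: decaying_fint|].
exists (fun z => fint z (coordM j F)); first exact: cpd_fint.
apply: IH; [exact: ccont_coordM|exact: decaying_icoordM|].
by apply: RapidZ; exact: Rapid_coordM.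
Qed.

End fourier_integral.

(** * Fejer kernel and Poisson summation *)

Section lattice.
Variables (R : realType) (n : nat).
Local Notation V := 'rV[R]_n.
Local Notation mu := (lebesgue R n).
Local Notation rV := (@rV_of_tuple R n).
Local Notation Zn := 'rV[int]_n.

Lemma sqjap_cube (L : R) (t : V) : cube L t -> sqjap t <= 1 + n%:R * L ^+ 2.
Proof.
move=> tL; rewrite /sqjap lerD2l /dot.
have -> : n%:R * L ^+ 2 = \sum_(i < n) L ^+ 2 by rewrite sumr_const card_ord mulr_natl.
apply: ler_sum => i _; have /andP[t0 /ltW tl] := tL i.
by rewrite expr2; exact: ler_pM.
Qed.

(** Comparison with the integral: each lattice value is dominated by the mean of [sumdecay] over the
    corresponding cube, and those integrals sum to a finite one by tiling. *)
Lemma rsummable_sumdecay (L : R) (x : V) : 0 < L ->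
  rsummable (fun k : Zn => sumdecay (x + L *: latv k)).
Proof.
move=> L0; have mc := @measurable_cube R n L.
have is_ := @integrable_sumdecay R n.
have [+ _] := tiling_rsum_ge0 L0 is_ (@sumdecay_ge0 R n).
set p := (fun k : Zn => rint _ _) => sp.
(* The cost in [sumdecayD] of the shift x - t for t in the cube: [sqjap (x - t)] is at most 2
   [sqjap t] [sqjap x], and [sqjap t] at most 1 + n L^2. *)
pose K := 2 ^+ n * (2 * (1 + n%:R * L ^+ 2) * sqjap x) ^+ n.
have Ln : 0 < L ^+ n by rewrite exprn_gt0.
have K0 : 0 <= K.
  rewrite mulr_ge0 ?exprn_ge0// mulr_ge0 ?(ltW (sqjap_gt0 _))// mulr_ge0//.
  by rewrite addr_ge0// mulr_ge0// sqr_ge0.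
apply: rsummable_le (rsummableZ (L ^- n * K) sp) => k.
rewrite ger0_norm ?sumdecay_ge0// -mulrA ler_pdivlMl//.
rewrite -(rint_cube_cst n (sumdecay (x + L *: latv k)) L0).
have isk := rintble_shift (L *: latv k) is_.
rewrite -(rintZ K mc (rintbleS mc isk)).
apply: (rint_le mc); first exact: rintble_cube_cst.
  exact: (rintbleZ K mc (rintbleS mc isk)).
move=> t tL /=.
have := sumdecayD (t + L *: latv k) (x - t).
rewrite addrC addrA subrK => h; apply: le_trans h _.
rewrite ler_wpM2r ?sumdecay_ge0// ler_wpM2l ?exprn_ge0//.
apply: lerXn2r; rewrite ?nnegrE ?(ltW (sqjap_gt0 _))//.
  rewrite mulr_ge0 ?(ltW (sqjap_gt0 _))// mulr_ge0//.
  by rewrite addr_ge0// mulr_ge0// sqr_ge0.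
rewrite addrC; apply: (le_trans (sqjapD _ _)); rewrite sqjapN.
by rewrite ler_wpM2r ?(ltW (sqjap_gt0 _))// ler_wpM2l// sqjap_cube.
Qed.

Lemma rint_mkcond (D : set V) (g : V -> R) :
  rint D g = rint setT (fun x => \1_D x * g x).
Proof.
rewrite /rint preimage_setT Rintegral_mkcond; apply: eq_Rintegral => t _.
rewrite /patch indicE.
have -> : (t \in rV @^-1` D) = (rV t \in D) by apply/idP/idP; rewrite !inE.
by case: (rV t \in D); rewrite ?mul1r ?mul0r.
Qed.

Lemma rintble_mkcond (D : set V) (g : V -> R) : measurable (rV @^-1` D) ->
  rintble D g -> rintble setT (fun x => \1_D x * g x).
Proof.
move=> mD; rewrite /rintble integrable_mkcond//; congr (_.-integrable _ _).
apply/funext => t; rewrite /patch /= indicE.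
have -> : (t \in rV @^-1` D) = (rV t \in D) by apply/idP/idP; rewrite !inE.
by case: (rV t \in D); rewrite ?mul1r ?mul0r.
Qed.

(* Unfolding the integral of the indicator of the cube translated by [c] shows that the
   integral of a periodic function over any translate of the unit cube is the same. *)
Lemma cint_cube_shift (G : V -> R[i]) (c : V) : cintble (cube 1) (fun t => G (t + c)) ->
  (forall (t : V) (k : Zn), G (t + latv k) = G t) ->
  cintegral (cube 1) (fun t => G (t + c)) = cintegral (cube 1) G.
Proof.
move=> [iR iI] Gper; have mc := @measurable_cube R n 1.
pose F t := ((\1_(cube 1) t : R)%:C) * G (t + c).
have FE : cintegral (cube 1) (fun t => G (t + c)) = cintegral setT F.
  rewrite !cintE; congr (_ +i* _).
    by rewrite rint_mkcond; apply: rint_eq => x _; rewrite /F cReM /= mul0r subr0.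
  by rewrite rint_mkcond; apply: rint_eq => x _; rewrite /F cImM /= mul0r addr0.
have iF : cintble setT F.
  split.
    rewrite (_ : _ \o _ = fun x => \1_(cube 1) x * complex.Re (G (x + c))).
      exact: rintble_mkcond.
    by apply/funext => x; rewrite [LHS]cReM /= mul0r subr0.
  rewrite (_ : _ \o _ = fun x => \1_(cube 1) x * complex.Im (G (x + c))).
    exact: rintble_mkcond.
  by apply/funext => x; rewrite [LHS]cImM /= mul0r addr0.
have iFc : cintble setT (fun x => F (x - c)).
  by case: iF => jR jI; split; [exact: (rintble_shift (- c) jR)|exact: (rintble_shift (- c) jI)].
have mF : cmeas F by case: iF => jR jI; split; exact: rintble_measurable.
(* Exactly one of the points x + k - c lies in the half-open unit cube, so the unfolded sum has a
   single term. *)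
have E x : exists k0 : Zn, forall k, F (x + 1 *: latv k - c) = (k == k0)%:R * G x.
  have [k0 hk0] := @exists_lattice_cube R n 1 (x - c) ltr01.
  exists (- k0) => k; rewrite /F subrK scale1r Gper indicE.
  have -> : (x + latv k - c \in cube 1) = (k == - k0); last by case: (k == - k0).
  have e : x + latv k - c = x - c - 1 *: latv (- k) by rewrite scale1r latvN opprK addrAC.
  apply/idP/eqP; rewrite inE e.
    by move=> hk; rewrite -[k]opprK (lattice_cube_inj ltr01 hk hk0).
  by move=> ->; rewrite opprK.
rewrite FE -(cint_shift (- c) mF) (tiling_csum_in ltr01 iFc).
  apply: cint_eq => x _; have [k0 hk0] := E x.
  rewrite -[RHS](csum_delta k0 (G x)).1; congr csum; apply/funext => k.
  exact: hk0.
move=> x; have [k0 hk0] := E x.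
by under eq_fun do rewrite hk0; exact: (csum_delta k0 (G x)).2.
Qed.

Lemma cintble_cube_bounded (F : V -> R[i]) (C : R) : ccont F ->
  (forall x, cube 1 x -> l1C (F x) <= C) -> cintble (cube 1) F.
Proof.
move=> cF hF; have mc := @measurable_cube R n 1.
exact: (cintble_le mc (ccont_cmeas cF) hF (rintble_cube_cst n C ltr01)).
Qed.

Lemma cint_cube_cst (z : R[i]) : cintegral (cube 1) (cst z : V -> R[i]) = z.
Proof.
rewrite cintE; apply: complex_eqP => /=.
  by have := rint_cube_cst n (complex.Re z) (@ltr01 R); rewrite expr1n mul1r.
by have := rint_cube_cst n (complex.Im z) (@ltr01 R); rewrite expr1n mul1r.
Qed.

(** The characters of the torus of period 1. *)
Definition echar (k : Zn) (t : V) : R[i] := expi (dot (twopi *: latv k) t).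

Lemma echar_periodic k (t : V) (m : Zn) : echar k (t + latv m) = echar k t.
Proof.
by rewrite /echar dotDr expiD dotZl dotZl dot_latv expi_twopi_int mulr1 -dotZl.
Qed.

Lemma ccont_echar k : ccont (echar k).
Proof. exact: ccont_expi_dot. Qed.

Lemma echarD k l t : echar (k + l) t = echar k t * echar l t.
Proof. by rewrite /echar latvD scalerDr dotDl expiD. Qed.

Lemma expi_pi : expi (pi : R) = -1.
Proof. by rewrite /expi cospi sinpi; apply: complex_eqP; rewrite //= oppr0. Qed.

Lemma cintble_echar k c : cintble (cube 1) (fun t => echar k (t + c)).
Proof.
apply: (@cintble_cube_bounded _ 2); last by move=> x _; exact: l1C_expi.
exact: (ccont_shift c (ccont_echar k)).
Qed.

(** If k_j is nonzero, the translation by 1 / (2 k_j) along the j-th axis changes the sign of the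
    character but, by periodicity, not its integral. The shift c is kept because the kernel is
    integrated over centered cubes. *)
Lemma cint_echar k c : cintegral (cube 1) (fun t => echar k (t + c)) = (k == 0)%:R.
Proof.
have [->|k0] := eqVneq k 0.
  rewrite -[RHS]cint_cube_cst; apply: cint_eq => t _ /=.
  rewrite /echar dotZl (_ : latv 0 = 0); last by apply/rowP => i; rewrite !mxE.
  by rewrite /dot big1 ?mulr0 ?expi0// => i _; rewrite mxE mul0r.
rewrite (cint_cube_shift (cintble_echar k c) (echar_periodic k)) /=.
have [j kj] : exists j, k 0 j != 0.
  apply/existsP; apply: contra_neqT k0 => /existsPn h.
  by apply/rowP => i; have := h i; rewrite negbK mxE => /eqP.
pose d : V := (2 * (k 0 j)%:~R)^-1 *: basis_vec j.
have kj' : (k 0 j)%:~R != 0 :> R by rewrite intr_eq0.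
have E t : echar k (t + d) = -1 * echar k t.
  rewrite /echar dotDr expiD mulrC; congr (_ * _).
  rewrite -expi_pi dotZr (dotC _ (basis_vec j)) dot_basis !mxE /twopi.
  by congr expi; field.
have := cint_cube_shift (cintble_echar k d) (echar_periodic k).
rewrite (cint_eq (fun t _ => E t)) cintZ; last 2 first.
- exact: measurable_cube.
- have := cintble_echar k 0; congr (cintble _ _).
  by apply/funext => t; rewrite addr0.
set I0 := cintegral _ _; rewrite mulN1r => h.
have : 2 * I0 = 0 by rewrite mulr_natl mulr2n -{1}h addNr.
by move/eqP; rewrite mulf_eq0 pnatr_eq0 /= => /eqP.
Qed.

End lattice.

(** * Fejer coefficients: product formula and limit *)

Section fejer_coefficients.
Variables (R : realType) (n : nat).
Local Notation Zn := 'rV[int]_n.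

Definition box N := {ffun 'I_n -> 'I_N.+1}.

Definition box_pt N (p : box N) : Zn := \row_i (p i : nat)%:Z.

(** Proportion of representations of k as a difference of two box points: the coefficient read off
    when the squared modulus is expanded. *)
Definition fejer_coef N (k : Zn) : R :=
  ((N.+1%:R ^+ n)^-1) * \sum_(p : box N) \sum_(q : box N) (k == box_pt p - box_pt q)%:R.

(** The subtraction in nat truncates at 0 and so produces the max with 0 in the triangular
    weights. *)
Lemma sum_shifted_mem N (k : int) :
  \sum_(a < N.+1) ((0 <= a%:Z - k < N.+1%:Z)%R : nat)%:R = (N.+1 - `|k|)%N%:R :> R.
Proof.
rewrite -natr_sum; congr (_%:R).
have up M (l : nat) : (\sum_(a < M) (l <= a) = M - l)%N.
  elim: M => [|M IH]; first by rewrite big_ord0.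
  by rewrite big_ord_recr /= IH; case: leqP => h; lia.
case: k => k.
  rewrite -up; apply: eq_bigr => a _; congr nat_of_bool.
  have := ltn_ord a; move: (a : nat) => b hb.
  by apply/idP/idP; lia.
(* The reversal of the index from a to N - a reduces a negative shift to the count [up] for its
   absolute value. *)
rewrite NegzE -up (reindex_inj rev_ord_inj) /=; apply: eq_bigr => a _; congr nat_of_bool.
have := ltn_ord a; move: (a : nat) => b hb.
by apply/idP/idP; lia.
Qed.

(** Given p, the only candidate for q is p - k, and it lies in the box exactly when each coordinate
    does; the sum over p then distributes into a product over coordinates. *)
Lemma fejer_coefE N k :
  fejer_coef N k = \prod_i ((N.+1 - `|k 0%R i|)%N%:R / N.+1%:R).
Proof.
rewrite /fejer_coef prodf_div prodr_const card_ord mulrC; congr (_ / _).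
under [RHS]eq_bigr do rewrite -sum_shifted_mem.
rewrite bigA_distr_bigA /=; apply: eq_bigr => p _.
have [/forallP h|/forallPn[i hi]] := boolP [forall i, (0 <= (p i)%:Z - k 0 i < N.+1%:Z)%R].
  rewrite [RHS]big1 => [|i _]; last by rewrite h.
  pose q0 : box N := [ffun i => inord `|((p i)%:Z - k 0 i)%R|%N].
  have q0E i : (q0 i)%:Z = (p i)%:Z - k 0 i.
    have := h i; rewrite ffunE => /andP[h1 h2].
    by rewrite inordK; lia.
  rewrite (bigD1 q0)//= big1 ?addr0.
    suff -> : k == box_pt p - box_pt q0 by [].
    by apply/eqP/rowP => i; rewrite !mxE q0E opprB addrC subrK.
  move=> q qq0; case: eqP => // kE; exfalso; move/negP: qq0; apply.
  apply/eqP/ffunP => i; apply: val_inj => /=.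
  have := q0E i; rewrite kE !mxE => e; apply/eqP; rewrite -eqz_nat; apply/eqP.
  by rewrite e; lia.
rewrite [LHS]big1 => [|q _]; last first.
  case: eqP => // kE; exfalso; move/negP: hi; apply.
  by rewrite kE !mxE; have := ltn_ord (q i); lia.
by rewrite (bigD1 i)//= (negPf hi) mul0r.
Qed.

Lemma fejer_coef_ge0 N k : 0 <= fejer_coef N k.
Proof. by rewrite fejer_coefE; apply: prodr_ge0 => i _; rewrite divr_ge0. Qed.

Lemma fejer_coef_le1 N k : fejer_coef N k <= 1.
Proof.
rewrite fejer_coefE; apply: prodr_ile1 => i; rewrite divr_ge0//=.
by rewrite ler_pdivrMr// mul1r ler_nat leq_subr.
Qed.

Lemma fejer_coef_cvg k : fejer_coef N k @[N --> \oo] --> (1 : R).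
Proof.
under eq_fun do rewrite fejer_coefE.
suff : \prod_i ((N.+1 - `|k 0%R i|)%N%:R / N.+1%:R) @[N --> \oo] --> \prod_(i < n) (1 : R).
  by rewrite [X in _ --> X -> _]big1.
apply: cvg_big => //; first exact: mul_continuous.
move=> i _; set l := `|k 0%R i|%N.
(* Truncated subtraction can only increase the value, so 1 - l / (N + 1) is a lower bound even for N
   + 1 < l. *)
apply: (@squeeze_cvgr _ _ _ _ (fun N => 1 - l%:R * harmonic N) (cst 1)).
- apply: nearW => N; rewrite /harmonic /=; apply/andP; split; last first.
    by rewrite ler_pdivrMr// mul1r ler_nat leq_subr.
  rewrite ler_pdivlMr// mulrBl mul1r mulfVK// lerBlDr -natrD ler_nat.
  by lia.
- rewrite -[X in _ --> X]subr0 -(mulr0 l%:R); apply: cvgB; first exact: cvg_cst.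
  by apply: cvgM; [exact: cvg_cst|exact: cvg_harmonic].
- exact: cvg_cst.
Qed.

End fejer_coefficients.

Section fejer_kernel.
Variables (R : realType) (n : nat).
Local Notation V := 'rV[R]_n.
Local Notation Zn := 'rV[int]_n.

Definition box_sum N (t : V) : R[i] := \sum_(p : box n N) echar (box_pt p) t.

Definition fejer N (t : V) : R := (N.+1%:R ^+ n)^-1 *
  (complex.Re (box_sum N t) ^+ 2 + complex.Im (box_sum N t) ^+ 2).

Lemma fejer_ge0 N t : 0 <= fejer N t.
Proof. by rewrite mulr_ge0 ?invr_ge0 ?exprn_ge0// addr_ge0// sqr_ge0. Qed.

Lemma fejerE N t : (fejer N t)%:C = \sum_(pq : box n N * box n N)
  ((N.+1%:R ^+ n)^-1)%:C * echar (box_pt pq.1 - box_pt pq.2) t.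
Proof.
rewrite -mulr_sumr /fejer rmorphM; congr (_ * _).
(* The complex conjugate of [box_sum N t]. *)
pose E' := \sum_(q : box n N) echar (- box_pt q) t.
have ER : complex.Re E' = complex.Re (box_sum N t).
  rewrite !cRe_sum; apply: eq_bigr => q _.
  by rewrite /echar latvN scalerN dotNl /= cosN.
have EI : complex.Im E' = - complex.Im (box_sum N t).
  rewrite !cIm_sum -sumrN; apply: eq_bigr => q _.
  by rewrite /echar latvN scalerN dotNl /= sinN.
transitivity (box_sum N t * E').
  by apply: complex_eqP; rewrite !cReImE ER EI /=; ring.
rewrite mulr_suml -(pair_bigA _ (fun p q : box n N => echar (box_pt p - box_pt q) t)) /=.
apply: eq_bigr => p _; rewrite mulr_sumr; apply: eq_bigr => q _.
by rewrite echarD.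
Qed.

Lemma fejer_periodic N t m : fejer N (t + latv m) = fejer N t.
Proof.
rewrite /fejer; have -> // : box_sum N (t + latv m) = box_sum N t.
by apply: eq_bigr => p _; rewrite echar_periodic.
Qed.

Lemma ccont_fejer N : ccont (fun t => (fejer N t)%:C).
Proof.
rewrite (_ : (fun t => _) = fun t => \sum_(pq : box n N * box n N)
  ((N.+1%:R ^+ n)^-1)%:C * echar (box_pt pq.1 - box_pt pq.2) t); last exact/funext/fejerE.
by apply: ccont_sum => pq; apply: ccontM; [exact: ccont_cst|exact: ccont_echar].
Qed.

Lemma cint_fejer N (k : Zn) c : cintble (cube 1) (fun t => (fejer N (t + c))%:C * echar k (t + c)) /\
  cintegral (cube 1) (fun t => (fejer N (t + c))%:C * echar k (t + c)) =
  (fejer_coef R N (- k))%:C.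
Proof.
have mc := @measurable_cube R n 1.
pose a : R[i] := ((N.+1%:R ^+ n)^-1)%:C.
have E t : (fejer N (t + c))%:C * echar k (t + c) =
    \sum_(pq : box n N * box n N) a * echar (box_pt pq.1 - box_pt pq.2 + k) (t + c).
  rewrite fejerE mulr_suml; apply: eq_bigr => pq _.
  by rewrite -mulrA -echarD.
have iE (pq : box n N * box n N) :
    cintble (cube 1) (fun t => a * echar (box_pt pq.1 - box_pt pq.2 + k) (t + c)).
  exact: (cintbleZ _ mc (cintble_echar _ c)).
move: (funext E) => EF; rewrite EF.
have [h1 ->] := cintble_sum (index_enum _) mc iE; split => //.
rewrite /fejer_coef pair_bigA /= rmorphM rmorph_sum /= mulr_sumr; apply: eq_bigr => pq _.
rewrite (cintZ _ mc (cintble_echar _ c)) cint_echar; congr (_ * _).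
have -> : (box_pt pq.1 - box_pt pq.2 + k == 0) = (- k == box_pt pq.1 - box_pt pq.2).
  by rewrite addr_eq0 eq_sym.
by case: (- k == _); rewrite ?rmorph1 ?rmorph0.
Qed.

Lemma fejer_coef0 N : fejer_coef R N (0 : Zn) = 1.
Proof.
rewrite fejer_coefE big1// => i _; rewrite mxE subn0 divff//.
Qed.

Lemma fejer_mass N (c : V) : rintble (cube 1) (fun t => fejer N (t + c)) /\
  rint (cube 1) (fun t => fejer N (t + c)) = 1.
Proof.
have [[iR _] hI] := cint_fejer N 0 c.
have E t : (fejer N (t + c))%:C * echar 0 (t + c) = (fejer N (t + c))%:C.
  rewrite /echar dotZl (_ : latv 0 = 0); last by apply/rowP => i; rewrite !mxE.
  by rewrite /dot big1 ?mulr0 ?expi0 ?mulr1// => i _; rewrite mxE mul0r.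
split.
  rewrite (_ : (fun t => fejer N (t + c)) = @complex.Re R \o
      (fun t => (fejer N (t + c))%:C * echar 0 (t + c))) //.
  by apply/funext => t; rewrite [RHS](congr1 _ (E t)).
move: hI; rewrite oppr0 fejer_coef0 (cint_eq (fun t _ => E t)) cintE => -[h _].
exact: h.
Qed.

(** Fejer means of the Korovkin test functions 1 - cos(2 pi s_j), which vanish at lattice points;
    these means tend to 0. *)
Lemma fejer_cos N (j : 'I_n) (c : V) :
  rintble (cube 1) (fun t => fejer N (t + c) * (1 - cos (twopi * (t + c) 0 j))) /\
  rint (cube 1) (fun t => fejer N (t + c) * (1 - cos (twopi * (t + c) 0 j))) =
  1 - fejer_coef R N (- delta_mx 0 j).
Proof.
have mc := @measurable_cube R n 1.
have [i1 m1] := fejer_mass N c.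
have [[iR _] hI] := cint_fejer N (delta_mx 0 j) c.
have E t : complex.Re ((fejer N (t + c))%:C * echar (delta_mx 0 j) (t + c)) =
    fejer N (t + c) * cos (twopi * (t + c) 0 j).
  rewrite cReM /= mul0r subr0 /echar dotZl (_ : latv (delta_mx 0 j) = basis_vec j) ?dot_basis//.
  by apply/rowP => i; rewrite !mxE; case: (_ && _).
have iC : rintble (cube 1) (fun t => fejer N (t + c) * cos (twopi * (t + c) 0 j)).
  rewrite (_ : (fun t => _) = @complex.Re R \o
      (fun t => (fejer N (t + c))%:C * echar (delta_mx 0 j) (t + c))) //.
  by apply/funext => t; rewrite -[LHS]E.
have F t : fejer N (t + c) * (1 - cos (twopi * (t + c) 0 j)) =
    fejer N (t + c) - fejer N (t + c) * cos (twopi * (t + c) 0 j).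
  by rewrite mulrBr mulr1.
split.
  move: (funext F) => EF; rewrite EF.
  rewrite (_ : (fun t => _) = fun t => fejer N (t + c) +
     -1 * (fejer N (t + c) * cos (twopi * (t + c) 0 j))).
    by apply: (rintbleD mc) => //; exact: rintbleZ.
  by apply/funext => t; rewrite mulN1r.
rewrite (rint_eq (fun t _ => F t)) (rintB mc i1 iC) m1; congr (_ - _).
have h : rint (cube 1) (fun t => complex.Re ((fejer N (t + c))%:C *
    echar (delta_mx 0 j) (t + c))) = fejer_coef R N (- delta_mx 0 j).
  by have h0 := congr1 (@complex.Re R) hI; exact: h0.
by rewrite -[RHS]h; apply: rint_eq => t _; rewrite -[LHS]E.
Qed.

End fejer_kernel.

(** * Poisson summation for a continuous function dominated by [sumdecay] *)

Section poisson.
Variables (R : realType) (n : nat).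
Local Notation V := 'rV[R]_n.
Local Notation Zn := 'rV[int]_n.
Variables (H : V -> R[i]) (C : R).
Hypotheses (cH : ccont H) (C_ge0 : 0 <= C).
Hypothesis hH : forall x, l1C (H x) <= C * sumdecay x.

(** In the usual sign convention this is the coefficient of index -k, which does not affect the sum
    over all of Z^n. *)
Let Hhat (k : Zn) : R[i] := fint (twopi *: latv k) H.

Lemma cintble_echarM k : cintble setT (fun t => echar k t * H t).
Proof.
apply: (@cintble_sumdecay _ _ (2 * C)).
  by apply: ccontM => //; exact: ccont_echar.
by move=> x; apply: (le_trans (l1C_expiM _ _)); rewrite -mulrA ler_wpM2l.
Qed.

Lemma cint_fejerM N : cintble setT (fun t => (fejer N t)%:C * H t) /\
  (csummable (fun k => (fejer_coef R N k)%:C * Hhat k) /\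
  cintegral setT (fun t => (fejer N t)%:C * H t) =
  csum (fun k => (fejer_coef R N k)%:C * Hhat k)).
Proof.
pose a : R[i] := ((N.+1%:R ^+ n)^-1)%:C.
pose kap (pq : box n N * box n N) := box_pt pq.1 - box_pt pq.2.
have E t : (fejer N t)%:C * H t = \sum_(pq : box n N * box n N) a * (echar (kap pq) t * H t).
  by rewrite fejerE mulr_suml; apply: eq_bigr => pq _; rewrite mulrA.
have iE pq : cintble setT (fun t => a * (echar (kap pq) t * H t)).
  exact: (cintbleZ _ measurableT (cintble_echarM _)).
have F k : (fejer_coef R N k)%:C * Hhat k =
    \sum_(pq : box n N * box n N) (k == kap pq)%:R * (a * Hhat (kap pq)).
  rewrite /fejer_coef pair_bigA /= rmorphM rmorph_sum /= -mulrA mulr_suml mulr_sumr.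
  apply: eq_bigr => pq _; rewrite -/(kap pq); have [->|_] := eqVneq k (kap pq).
    by rewrite rmorph1 !mul1r.
  by rewrite rmorph0 !mul0r mulr0.
have [s1 s2] := csum_sum_delta kap (fun pq => a * Hhat (kap pq)).
move: (funext E) (funext F) => EE FF; rewrite EE FF s1.
have [h1 h2] := cintble_sum (index_enum _) measurableT iE.
split; [exact: h1|split; [exact: s2|]].
rewrite h2; apply: eq_bigr => pq _.
by rewrite (cintZ _ measurableT (cintble_echarM _)).
Qed.

Lemma cvg_csum_fejer : csummable Hhat ->
  l1C (csum Hhat - csum (fun k => (fejer_coef R N k)%:C * Hhat k)) @[N --> \oo] --> (0 : R).
Proof.
move=> sH.
have sc N : csummable (fun k => (fejer_coef R N k)%:C * Hhat k) := (cint_fejerM N).2.1.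
have B N k : l1C (Hhat k - (fejer_coef R N k)%:C * Hhat k) =
    (1 - fejer_coef R N k) * l1C (Hhat k).
  rewrite -{1}[Hhat k]mul1r -mulrBl -[1 - _]/((1 : R)%:C - _) -rmorphB l1CM_real.
  by rewrite ger0_norm// subr_ge0 fejer_coef_le1.
apply: (@squeeze_cvgr _ _ _ _ (cst 0)
  (fun N => rsum (fun k => (1 - fejer_coef R N k) * l1C (Hhat k)))).
- apply: nearW => N; rewrite l1C_ge0 /= -csumB//.
  apply: (le_trans (l1C_csum_le (csummableB sH (sc N)))).
  by rewrite le_eqVlt; apply/orP; left; apply/eqP; congr rsum; apply/funext => k.
- exact: cvg_cst.
- apply: (rsum_dominated_cvg0 (B := fun k => l1C (Hhat k))) => //.
    move=> N k; rewrite normrM (ger0_norm (l1C_ge0 _)).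
    rewrite ger0_norm ?subr_ge0 ?fejer_coef_le1// ler_piMl ?l1C_ge0//.
    by rewrite lerBlDr lerDl fejer_coef_ge0.
  move=> k; rewrite -[X in _ --> X](mul0r (l1C (Hhat k))).
  apply: cvgM; last exact: cvg_cst.
  rewrite -[X in _ --> X](subrr (1 : R)).
  by apply: cvgB; [exact: cvg_cst|exact: fejer_coef_cvg].
Qed.

(** Moves the unit cube to the one centered at 0. The kernel concentrates at lattice points, which
    would otherwise be corners and split its mass among cubes. *)
Let c0 : V := const_mx (- 2^-1).

Lemma centered_cube (t : V) j : cube 1 t -> `|(t + c0) 0 j| <= 2^-1.
Proof.
move=> tc; rewrite !mxE; have /andP[h1 h2] := tc j.
by rewrite ler_norml; apply/andP; split; lra.
Qed.

Let D (m : Zn) (s : V) : R := l1C (H (s + latv m) - H (latv m)).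

Let A N (m : Zn) : R := rint (cube 1) (fun t => fejer N (t + c0) * D m (t + c0)).

(** The same B for every m gives a summable majorant of the means [A N m] that does not depend on N.
    The two summands of B bound H near m and H at m. *)
Lemma D_bound : exists2 B : R, 0 <= B & forall m t, cube 1 t ->
  D m (t + c0) <= B * sumdecay (latv m).
Proof.
exists (C * (2 ^+ n * (2 * (1 + n%:R * 1 ^+ 2) * sqjap c0) ^+ n) + C).
  have q0 : 0 <= 2 * (1 + n%:R * 1 ^+ 2) * sqjap c0.
    by rewrite expr1n mulr1 mulr_ge0 ?(ltW (sqjap_gt0 _)).
  by apply: addr_ge0 => //; apply: mulr_ge0 => //; rewrite mulr_ge0 ?exprn_ge0.
move=> m t tc; apply: (le_trans (l1CB _ _)); rewrite mulrDl lerD//.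
apply: (le_trans (hH _)); rewrite -mulrA ler_wpM2l//.
rewrite addrC; apply: (le_trans (sumdecayD _ _)).
rewrite ler_wpM2r ?sumdecay_ge0// ler_wpM2l ?exprn_ge0//.
have j0 (x : V) := ltW (sqjap_gt0 x).
have u : sqjap (t + c0) <= 2 * (1 + n%:R * 1 ^+ 2) * sqjap c0.
  apply: (le_trans (sqjapD _ _)); rewrite ler_wpM2r// ler_wpM2l//.
  exact: sqjap_cube.
by apply: lerXn2r; rewrite ?nnegrE//; exact: le_trans u.
Qed.

Lemma ccont_D m : ccont (fun s => H (s + latv m) - H (latv m)).
Proof.
by apply: ccontD; [exact: ccont_shift|exact: ccont_cst].
Qed.

Lemma rintble_A N m : rintble (cube 1) (fun t => fejer N (t + c0) * D m (t + c0)).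
Proof.
have [B B0 hB] := D_bound; have mc := @measurable_cube R n 1.
have [iF _] := fejer_mass N c0.
apply: (rintble_le mc _ _ (rintbleZ (B * sumdecay (latv m)) mc iF)) => [|t tc].
  apply: (measurable_shift_rV (g := fun t => fejer N t * D m t)).
  apply: measurable_funM.
    by have [] := ccont_cmeas (ccont_fejer R n N).
  exact: (measurable_l1C (ccont_cmeas (ccont_D m))).
have D0 : 0 <= D m (t + c0) by exact: l1C_ge0.
rewrite ger0_norm; last by rewrite mulr_ge0 ?fejer_ge0.
rewrite mulrC.
by rewrite ler_wpM2r ?fejer_ge0// hB.
Qed.

Lemma A_le N m (B : R) : (forall t, cube 1 t -> D m (t + c0) <= B) -> A N m <= B.
Proof.
move=> hB; have mc := @measurable_cube R n 1.
have [iF F1] := fejer_mass N c0.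
rewrite -[leRHS]mulr1 -F1 -(rintZ B mc iF).
apply: (rint_le mc); [exact: rintble_A|exact: (rintbleZ B mc iF)|].
by move=> t tc; rewrite mulrC ler_wpM2r ?fejer_ge0// hB.
Qed.

Lemma A_ge0 N m : 0 <= A N m.
Proof. by apply: rint_ge0 => t _; rewrite mulr_ge0 ?fejer_ge0//; exact: l1C_ge0. Qed.

(* Korovkin's argument: on the centered cube, continuity at a lattice point gives
   D m s <= e + K * \sum_j (1 - cos (2 pi s_j)), and the Fejer means of the right-hand
   side are explicit. *)
Lemma D_korovkin m (e : R) : 0 < e -> exists2 K : R, 0 <= K & forall t, cube 1 t ->
  D m (t + c0) <= e + K * \sum_j (1 - cos (twopi * (t + c0) 0 j)).
Proof.
move=> e0; have [B B0 hB] := D_bound.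
have cD : continuous (D m) by apply: continuous_l1C; exact: ccont_D.
have D0 : D m 0 = 0 by rewrite /D add0r subrr l1C0.
have /nbhs_ballP[d /= d0 hd] : \forall s \near (0 : V), D m s < e.
  have h0 : D m s @[s --> (0 : V)] --> D m 0 by exact: cD.
  by rewrite D0 in h0; exact: (cvgr_lt 0 h0).
(* The cap at 1/2 keeps 2 pi d' inside [0, pi], where the cosine is decreasing. *)
pose d' := Num.min d 2^-1.
have d'0 : 0 < d' by rewrite lt_min d0 /= invr_gt0 ltr0n.
have d'h : d' <= 2^-1 by rewrite ge_min lexx orbT.
have pi0 := pi_gt0 R.
have tw0 : 0 <= twopi :> R by rewrite mulr_ge0// ltW.
have in0 (x : R) : 0 <= x -> x <= 2^-1 -> twopi * x \in `[0, pi].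
  move=> x0 xh; rewrite in_itv/= mulr_ge0//=.
  by have := ler_wpM2l (ltW pi0) xh; rewrite /twopi; lra.
have h0 : (0 : R) \in `[0, pi] by rewrite in_itv/= lexx ltW.
have kap0 : 0 < 1 - cos (twopi * d').
  rewrite subr_gt0 -(@cos0 R) ltr_cos//; last exact: in0 (ltW d'0) d'h.
  by rewrite mulr_gt0// mulr_gt0.
have cos_le1' (x : R) : 0 <= 1 - cos x by rewrite subr_ge0 cos_le1.
(* If some |s_j| >= d', the sum of cosine terms is at least 1 - cos(2 pi d'), so this K makes the
   right-hand side exceed the bound of [D_bound]. *)
exists (B * sumdecay (latv m) / (1 - cos (twopi * d'))).
  by rewrite divr_ge0 ?(ltW kap0)// mulr_ge0 ?sumdecay_ge0.
move=> t tc; set s := t + c0.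
have [/forallP small|/forallPn[j]] := boolP [forall j, `|s 0 j| < d'].
  apply: (@le_trans _ _ e).
    apply/ltW/hd; split => // i j; rewrite !ord1 mxE /ball/= sub0r normrN.
    by apply: lt_le_trans (small j) _; rewrite ge_min lexx.
  rewrite lerDl mulr_ge0 ?sumr_ge0// divr_ge0 ?(ltW kap0)// mulr_ge0 ?sumdecay_ge0//.
rewrite -leNgt => big; apply: (le_trans (hB m t tc)).
apply: ler_wpDl; first exact: ltW.
rewrite -mulrA ler_peMr ?mulr_ge0 ?sumdecay_ge0//.
rewrite mulrC ler_pdivlMr// mul1r (bigD1 j)//=.
apply: ler_wpDr; first exact: sumr_ge0.
have cos_norm (x : R) : cos `|x| = cos x.
  by have [x0|x0] := leP 0 x; [rewrite ger0_norm|rewrite ltr0_norm// cosN].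
rewrite lerD2l lerN2 -(cos_norm (twopi * s 0 j)).
have sh := centered_cube j tc; rewrite -/s in sh.
rewrite normrM (ger0_norm tw0) leNgt ltr_cos; last 2 first.
- exact: in0 (normr_ge0 _) sh.
- exact: in0 (ltW d'0) d'h.
by rewrite -leNgt ler_wpM2l.
Qed.

Lemma A_cvg0 m : A N m @[N --> \oo] --> (0 : R).
Proof.
have mc := @measurable_cube R n 1.
have dcvg : \sum_(j < n) (1 - fejer_coef R N (- delta_mx 0 j)) @[N --> \oo] -->
    \sum_(j < n) (0 : R).
  apply: cvg_big => //; first exact: add_continuous.
  move=> j _; rewrite -[X in _ --> X](subrr (1 : R)).
  by apply: cvgB; [exact: cvg_cst|exact: fejer_coef_cvg].
rewrite big1// in dcvg.
apply/cvgrPdist_le => e e0.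
have e2 : 0 < e / 2 by rewrite divr_gt0.
have [K K0 hK] := D_korovkin m e2.
(* The Fejer mean of Korovkin's bound: the constant keeps its value because the mass is 1. *)
have AK N : A N m <= e / 2 + K * \sum_(j < n) (1 - fejer_coef R N (- delta_mx 0 j)).
  have [iF F1] := fejer_mass N c0.
  have iC j := (fejer_cos N j c0).1.
  have iS : rintble (cube 1) (fun t => \sum_j fejer N (t + c0) * (1 - cos (twopi * (t + c0) 0 j))) /\
      rint (cube 1) (fun t => \sum_j fejer N (t + c0) * (1 - cos (twopi * (t + c0) 0 j))) =
      \sum_(j < n) (1 - fejer_coef R N (- delta_mx 0 j)).
    elim: (index_enum 'I_n) => [|j r [IH1 IH2]].
      under eq_fun do rewrite big_nil; rewrite big_nil; split.
        exact: (rintble_cube_cst n 0 ltr01).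
      by have := rint_cube_cst n 0 (@ltr01 R); rewrite mulr0.
    under eq_fun do rewrite big_cons; rewrite big_cons.
    split; first exact: (rintbleD mc (iC j) IH1).
    by rewrite (rintD mc (iC j) IH1) IH2 (fejer_cos N j c0).2.
  have [iS1 iS2] := iS.
  have -> : e / 2 = e / 2 * rint (cube 1) (fun t => fejer N (t + c0)) by rewrite F1 mulr1.
  rewrite -iS2 -(rintZ (e / 2) mc iF) -(rintZ K mc iS1).
  rewrite -(rintD mc (rintbleZ _ mc iF) (rintbleZ _ mc iS1)).
  apply: (rint_le mc); first exact: rintble_A.
    exact: (rintbleD mc (rintbleZ _ mc iF) (rintbleZ _ mc iS1)).
  move=> t tc /=; rewrite -mulr_sumr.
  rewrite [leRHS](_ : _ = fejer N (t + c0) * (e / 2 + K * \sum_j (1 - cos (twopi * (t + c0) 0 j)))); last by ring.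
  by rewrite ler_wpM2l ?fejer_ge0// hK.
have K1 : 0 < K + 1 by rewrite ltr_wpDl.
near=> N.
rewrite sub0r normrN ger0_norm ?A_ge0//; apply: (le_trans (AK N)).
rewrite [leRHS]splitr lerD2l.
have : \sum_(j < n) (1 - fejer_coef R N (- delta_mx 0 j)) <= e / 2 / (K + 1).
  near: N; apply: cvgr_le; first exact: dcvg.
  by rewrite divr_gt0.
rewrite ler_pdivlMr// mulrC; apply: le_trans.
by rewrite ler_wpM2r ?lerDl// sumr_ge0// => j _; rewrite subr_ge0 fejer_coef_le1.
Unshelve. all: by end_near. Qed.

Lemma csummable_lattice : csummable (fun m : Zn => H (latv m)).
Proof.
have := rsummableZ C (rsummable_sumdecay (0 : V) (@ltr01 R)).
by apply: csummable_le => m; rewrite add0r scale1r; exact: hH.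
Qed.

Lemma fejer_csum_le N : l1C (cintegral setT (fun t => (fejer N t)%:C * H t) -
    csum (fun m : Zn => H (latv m))) <= rsum (A N) /\ rsummable (A N).
Proof.
have mc := @measurable_cube R n 1.
have [iFH _] := cint_fejerM N.
have mFH : cmeas (fun t => (fejer N t)%:C * H t).
  by apply/ccont_cmeas/ccontM => //; exact: ccont_fejer.
have [[iF F1] [B B0 hB]] := (fejer_mass N c0, D_bound).
have sA : rsummable (A N).
  have := rsummableZ B (rsummable_sumdecay (0 : V) (@ltr01 R)).
  apply: rsummable_le => m; rewrite add0r scale1r ger0_norm ?A_ge0//.
  by apply: A_le => t; exact: hB.
split => //.
have iFHc : cintble setT (fun t => (fejer N (t + c0))%:C * H (t + c0)).
  by case: iFH => iR iI; split; [exact: (rintble_shift c0 iR)|exact: (rintble_shift c0 iI)].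
have iFC : cintble (cube 1) (fun t => (fejer N (t + c0))%:C).
  by split; [exact: iF|exact: (rintble_cube_cst n 0 ltr01)].
have FC1 : cintegral (cube 1) (fun t => (fejer N (t + c0))%:C) = 1.
  rewrite cintE; apply: complex_eqP => /=; first exact: F1.
  by have := rint_cube_cst n 0 (@ltr01 R); rewrite mulr0.
rewrite -(cint_shift c0 mFH); have [s1 ->] := tiling_csum ltr01 iFHc.
have P (m : Zn) t : (fejer N (t + 1 *: latv m + c0))%:C * H (t + 1 *: latv m + c0) =
    (fejer N (t + c0))%:C * H (t + c0 + latv m).
  by rewrite scale1r addrAC fejer_periodic.
have iP (m : Zn) : cintble (cube 1) (fun t => (fejer N (t + c0))%:C * H (t + c0 + latv m)).
  move: (funext (P m)) => <-; case: iFHc => iR iI; split.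
    exact: (rintbleS mc (rintble_shift _ iR)).
  exact: (rintbleS mc (rintble_shift _ iI)).
(* Mass 1 writes H at m as the Fejer mean of a constant, so the error in each cube is a mean of
   differences of H. *)
have PE (m : Zn) : cintegral (cube 1) (fun t => (fejer N (t + 1 *: latv m + c0))%:C *
    H (t + 1 *: latv m + c0)) - H (latv m) =
  cintegral (cube 1) (fun t => (fejer N (t + c0))%:C * (H (t + c0 + latv m) - H (latv m))).
  rewrite (cint_eq (fun t _ => P m t)).
  rewrite -{1}[H (latv m)]mulr1 -FC1 -(cintZ _ mc iFC) -(cintB mc (iP m) (cintbleZ _ mc iFC)).
  by apply: cint_eq => t _; ring.
rewrite -(csumB s1 csummable_lattice); move: (funext PE) => ->.
have bnd (m : Zn) : l1C (cintegral (cube 1) (fun t => (fejer N (t + c0))%:C *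
    (H (t + c0 + latv m) - H (latv m)))) <= A N m.
  apply: (l1C_cint_le2 mc) (rintble_A N m) _.
    apply/(cmeas_shift c0 (F := fun t => (fejer N t)%:C * (H (t + latv m) - H (latv m)))).
    by apply/ccont_cmeas/ccontM; [exact: ccont_fejer|exact: ccont_D].
  by move=> t _; rewrite l1CM_real ger0_norm ?fejer_ge0.
have sS : csummable (fun m => cintegral (cube 1) (fun t => (fejer N (t + c0))%:C *
    (H (t + c0 + latv m) - H (latv m)))) := csummable_le bnd sA.
by apply: (le_trans (l1C_csum_le sS)); exact: le_rsum.
Qed.

(** The integral of H against the N-th kernel is the intermediate term of a triangle inequality
    whose two parts tend to 0. *)
Theorem poisson_summation : csummable Hhat ->
  csum Hhat = csum (fun m : Zn => H (latv m)).
Proof.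
move=> sH; apply/eqP; rewrite -subr_eq0; apply/eqP/l1C_eq0.
have h1 := cvg_csum_fejer sH.
have h2 : rsum (A N) @[N --> \oo] --> (0 : R).
  have [B B0 hB] := D_bound.
  have sB := rsummableZ B (rsummable_sumdecay (0 : V) (@ltr01 R)).
  apply: (rsum_dominated_cvg0 sB); last exact: A_cvg0.
  move=> N m; rewrite add0r scale1r ger0_norm ?A_ge0//.
  by apply: A_le => t; exact: hB.
have h3 := cvgD h1 h2; rewrite addr0 in h3.
set X := csum Hhat - _.
have h4 : (fun=> l1C X) N @[N --> \oo] --> l1C X by exact: cvg_cst.
apply: (ler_cvg_to h4 (h3 _)); apply: nearW => N.
have [hN _] := fejer_csum_le N.
rewrite (cint_fejerM N).2.2 in hN.
apply: le_trans (lerD (lexx _) hN).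
by apply: le_trans (l1CD _ _); rewrite addrA subrK.
Qed.

End poisson.

(** * Schwartz functions and symbols *)

Section smooth_classes.
Variables (R : realType) (n : nat).
Local Notation V := 'rV[R]_n.

(** Specialises the multi-index bounds to pure derivatives and to powers of one coordinate. *)
Definition single_index (j : 'I_n) q : 'I_n -> nat := fun i => if i == j then q else 0%N.

Lemma mpartial_single j q (F : V -> R[i]) :
  mpartial (single_index j q) F = iter q (partial j) F.
Proof.
rewrite /mpartial; have := enum_uniq 'I_n; have : j \in enum 'I_n by rewrite mem_enum.
have H0 (s : seq 'I_n) : j \notin s ->
    foldr (fun i => iter (single_index j q i) (partial i)) F s = F.
  elim: s => //= i s IH; rewrite inE negb_or => /andP[ji /IH ->].
  by rewrite /single_index eq_sym (negPf ji).
elim: (enum 'I_n) => //= i s IH; rewrite inE => /orP[/eqP<-|js] /andP[is_ us].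
  by rewrite H0// /single_index eqxx.
rewrite IH// /single_index; case: eqP => // ij; by rewrite ij js in is_.
Qed.

Lemma mpartial0 (F : V -> R[i]) : mpartial (fun=> 0%N) F = F.
Proof. by rewrite /mpartial; elim: (enum 'I_n) => //= i s ->. Qed.

Lemma partials_nseq d (j : 'I_d) q (F : 'rV[R]_d -> R[i]) : partials (nseq q j) F = iter q (partial j) F.
Proof. by rewrite /partials; elim: q => //= q ->. Qed.

Lemma monomial_single j q (x : V) : monomial (single_index j q) x = x 0 j ^+ q.
Proof.
rewrite /monomial (bigD1 j)//= big1 /single_index ?eqxx ?mulr1// => i ij.
by rewrite (negPf ij).
Qed.

Lemma monomial0 (x : V) : monomial (fun=> 0%N) x = 1.
Proof. by rewrite /monomial big1. Qed.

Lemma derivable_cpd j (F : V -> R[i]) :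
  (forall x, derivable (@complex.Re R \o F) x (basis_vec j) /\
     derivable (@complex.Im R \o F) x (basis_vec j)) ->
  cpd j F (partial j F).
Proof.
move=> dF; split.
  exact: (derivable_rpd (fun x => (dF x).1)).
exact: (derivable_rpd (fun x => (dF x).2)).
Qed.

Lemma schwartz_bound j q M (f : V -> R[i]) : schwartz f ->
  (exists C : R, forall x, l1C (iter q (partial j) f x) <= C) /\
  (forall i, exists C : R, forall x : V, `|x 0 i| ^+ M * l1C (iter q (partial j) f x) <= C).
Proof.
move=> [_ hf]; split.
  have [C hC] := hf (fun=> 0%N) (single_index j q); exists (2 * C) => x.
  by have := l1C_le_norm (hC x); rewrite mpartial_single monomial0 mul1r.
move=> i; have [C hC] := hf (single_index i M) (single_index j q); exists (2 * C) => x.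
have := l1C_le_norm (hC x).
by rewrite mpartial_single monomial_single l1CM_real normrX.
Qed.

Lemma schwartz_ccont (f : V -> R[i]) : schwartz f -> ccont f.
Proof. by move=> [sf _]; have [h1 h2 _] := sf [::]; split. Qed.

Lemma schwartz_decaying (f : V -> R[i]) : schwartz f -> decaying f.
Proof.
move=> sf; apply: decaying_coord.
  case: sf => _ hf; have [C hC] := hf (fun=> 0%N) (fun=> 0%N); exists (2 * C) => x.
  by have := l1C_le_norm (hC x); rewrite mpartial0 monomial0 mul1r.
move=> i N; exact: (schwartz_bound i 0 (2 * N) sf).2.
Qed.

Lemma schwartz_Rapid (f : V -> R[i]) : schwartz f -> Rapid f.
Proof.
(* The statement is generalised to all iterates because each step of [rapid] passes to the next
   derivative. *)
move=> sf j q; suff H p : rapid j q (iter p (partial j) f) by exact: (H 0%N).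
have cc r : ccont (iter r (partial j) f).
  by case: sf => sf _; have [h1 h2 _] := sf (nseq r j); rewrite partials_nseq in h1 h2.
have dd r : decaying (iter r (partial j) f).
  apply: decaying_coord; first exact: (schwartz_bound j r 0 sf).1.
  by move=> i N; exact: (schwartz_bound j r (2 * N) sf).2.
elim: q p => [|q IH] p; split => //.
exists (iter p.+1 (partial j) f); last exact: IH.
apply: derivable_cpd => x; case: sf => sf _; have [_ _ h] := sf (nseq p j).
by rewrite partials_nseq in h; exact: h.
Qed.

Lemma row_mx_line (x xi : V) j (h : R) :
  row_mx x (h *: basis_vec j + xi) = h *: basis_vec (rshift n j) + row_mx x xi.
Proof.
apply/rowP => i; rewrite !mxE eqxx /=.
case: split_ordP => k ->; rewrite ?mxE ?eqxx /=.
  by rewrite eq_lrshift mulr0 add0r.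
by rewrite eq_rshift.
Qed.

(** With x frozen, a derivative in xi is one of the joint function along the second block: the
    difference quotients coincide. *)
Lemma derive_row_mx (g : 'rV[R]_(n + n) -> R) (x xi : V) j :
  (derivable g (row_mx x xi) (basis_vec (rshift n j)) ->
   derivable (fun y => g (row_mx x y)) xi (basis_vec j)) /\
  'D_(basis_vec j) (fun y => g (row_mx x y)) xi =
  'D_(basis_vec (rshift n j)) g (row_mx x xi).
Proof.
have E : (fun h : R => h^-1 *: (((fun y => g (row_mx x y)) \o shift xi) (h *: basis_vec j) -
      g (row_mx x xi))) =
    (fun h : R => h^-1 *: ((g \o shift (row_mx x xi)) (h *: basis_vec (rshift n j)) -
      g (row_mx x xi))).
  by apply/funext => h /=; rewrite row_mx_line.
by split; [rewrite /derivable E|rewrite /derive E].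
Qed.

Lemma continuous_row_mx (x : V) : continuous (fun xi : V => row_mx x xi).
Proof.
move=> xi; apply/(cvg_ballP (FF := nbhs_filter xi)) => e e0; apply/nbhs_ballP; exists e => // y [_ xy].
split => // i k; rewrite !mxE; case: split_ordP => l _; last exact: xy.
exact: ballxx.
Qed.

Section symbol.
Variable a : V -> V -> R[i].
Hypothesis a_smooth : smooth2 a.

Let A (z : 'rV[R]_(n + n)) : R[i] := a (lsubmx z) (rsubmx z).

Lemma iter_partial_symbol x j q : iter q (partial j) (a x) =
  fun xi => iter q (partial (rshift n j)) A (row_mx x xi).
Proof.
elim: q => [|q IH].
  by apply/funext => xi; rewrite /= /A row_mxKl row_mxKr.
apply/funext => xi; rewrite iterS IH /= /partial; congr (_ +i* _).
  exact: (derive_row_mx (@complex.Re R \o iter q (partial (rshift n j)) A) x xi j).2.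
exact: (derive_row_mx (@complex.Im R \o iter q (partial (rshift n j)) A) x xi j).2.
Qed.

Lemma ccont_symbol x j q : ccont (iter q (partial j) (a x)).
Proof.
have [h1 h2 _] := a_smooth (nseq q (rshift n j)); rewrite partials_nseq in h1 h2.
rewrite iter_partial_symbol; split => xi.
  exact: (continuous_comp (@continuous_row_mx x xi) (h1 _)).
exact: (continuous_comp (@continuous_row_mx x xi) (h2 _)).
Qed.

Lemma ccont_symbol0 x : ccont (a x).
Proof.
have [h1 h2 _] := a_smooth [::].
have E : a x = fun xi => A (row_mx x xi).
  by apply/funext => xi; rewrite /A row_mxKl row_mxKr.
rewrite E; split => xi.
  exact: (continuous_comp (@continuous_row_mx x xi) (h1 _)).
exact: (continuous_comp (@continuous_row_mx x xi) (h2 _)).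
Qed.

Lemma cpd_symbol x j q : cpd j (iter q (partial j) (a x)) (iter q.+1 (partial j) (a x)).
Proof.
apply: derivable_cpd => xi; rewrite iter_partial_symbol.
have [_ _ h] := a_smooth (nseq q (rshift n j)); rewrite partials_nseq in h.
have [hR hI] := h (rshift n j) (row_mx x xi); split.
  exact: (derive_row_mx (@complex.Re R \o iter q (partial (rshift n j)) A) x xi j).1.
exact: (derive_row_mx (@complex.Im R \o iter q (partial (rshift n j)) A) x xi j).1.
Qed.

(** The bracket is at least 1, so a real exponent of either sign may be raised to a natural N >=
    |M|, and the bracket replaced by its square. *)
Lemma japanese_powR_le (M : R) : exists N : nat, forall xi : V, japanese xi `^ M <= sqjap xi ^+ N.
Proof.
have [N hN] : exists N : nat, `|M| <= N%:R.
  by exists (Num.bound `|M|); apply/ltW/archi_boundP.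
exists N => xi; have s1 := sqjap_ge1 xi.
have j1 : 1 <= japanese xi by rewrite /japanese -/(sqjap xi) -sqrtr1 ler_wsqrtr.
have js : japanese xi <= sqjap xi.
  rewrite -[leRHS]sqr_sqrtr ?(le_trans _ s1)// -/(japanese xi) expr2.
  by rewrite ler_peMl// (le_trans _ j1).
apply: (@le_trans _ _ (japanese xi `^ N%:R)).
  by rewrite ler_powR// (le_trans (ler_norm _)).
rewrite powR_mulrn ?(le_trans _ j1)//.
have s0 := ltW (sqjap_gt0 xi); have j0 : 0 <= japanese xi := sqrtr_ge0 _.
by apply: lerXn2r; rewrite ?nnegrE.
Qed.

Hypothesis a_bound : forall alpha beta : 'I_n -> nat, exists C M : R,
  forall x xi : V,
    `| mpartial alpha (fun y => mpartial beta (a y) xi) x |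
      <= (C * japanese xi `^ M)%:C.

Lemma symbol_growing x beta : slowly_growing (mpartial beta (a x)).
Proof.
have [C [M hCM]] := a_bound (fun=> 0%N) beta.
(* The given C has no prescribed sign, hence the absolute value; the 2 is the cost of passing to
   [l1C]. *)
have [N hN] := japanese_powR_le M; exists (2 * `|C|), N => xi.
have := hCM x xi; rewrite mpartial0 => h; apply: (le_trans (l1C_le_norm h)).
rewrite -mulrA ler_wpM2l//; apply: (@le_trans _ _ (`|C| * japanese xi `^ M)).
  by rewrite ler_wpM2r ?powR_ge0// ler_norm.
by rewrite ler_wpM2l.
Qed.

Lemma slow_symbol x j q : slow j q (a x).
Proof.
suff H p : slow j q (iter p (partial j) (a x)) by exact: (H 0%N).
have gg r : slowly_growing (iter r (partial j) (a x)).
  by rewrite -mpartial_single; exact: symbol_growing.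
elim: q p => [|q IH] p; split => //; try exact: ccont_symbol.
by exists (iter p.+1 (partial j) (a x)); [exact: cpd_symbol|exact: IH].
Qed.

Lemma growing_symbol x : slowly_growing (a x).
Proof. by have := symbol_growing x (fun=> 0%N); rewrite mpartial0. Qed.

End symbol.

Lemma symbol_periodic (a : V -> V -> R[i]) :
  (forall (x xi : V) (i : 'I_n), a (x + twopi *: basis_vec i) xi = a x xi) ->
  forall x xi (k : 'rV[int]_n), a (x + twopi *: latv k) xi = a x xi.
Proof.
move=> aper x xi k.
have nat_per (m : nat) y i : a (y + m%:R *: (twopi *: basis_vec i)) xi = a y xi.
  elim: m => [|m IH]; first by rewrite scale0r addr0.
  by rewrite -natr1 scalerDl scale1r addrA aper.
have int_per (m : int) y i : a (y + m%:~R *: (twopi *: basis_vec i)) xi = a y xi.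
  case: m => m; first exact: nat_per.
  (* A negative shift is undone by the opposite positive one, already covered by [nat_per]. *)
  rewrite NegzE mulrNz scaleNr -[in RHS](subrK (m.+1%:R *: (twopi *: basis_vec i)) y).
  by rewrite nat_per.
have -> : twopi *: latv k = \sum_i (k 0 i)%:~R *: (twopi *: basis_vec i) :> V.
  apply/rowP => j; rewrite summxE !mxE (bigD1 j)//= big1 => [|i ij].
    by rewrite !mxE !eqxx mulr1 addr0 mulrC.
  by rewrite !mxE eq_sym (negPf ij) andbF !mulr0.
elim: (index_enum 'I_n) x => [|i s IH] x; first by rewrite big_nil addr0.
by rewrite big_cons addrA IH int_per.
Qed.

End smooth_classes.

(** * Fourier transforms of f and Poisson summation at a fixed x *)

Section quantization.
Variables (R : realType) (n : nat).
Local Notation V := 'rV[R]_n.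
Local Notation Zn := 'rV[int]_n.
Implicit Types f h : V -> R[i].

Lemma twopi_gt0 : 0 < twopi :> R.
Proof. by rewrite mulr_gt0// pi_gt0. Qed.

Lemma fourierRE f xi : ccont f -> decaying f ->
  fourierR f xi = (twopi ^- n)%:C * fint (- xi) f.
Proof.
move=> cf df; rewrite /fourierR /fint -(cintZ _ measurableT (cintble_fint _ cf df)).
by apply: cint_eq => y _; rewrite mulrC dotNl dotC.
Qed.

Lemma fourierR_props f : ccont f -> decaying f -> Rapid f ->
  [/\ ccont (fourierR f), decaying (fourierR f) & Rapid (fourierR f)].
Proof.
move=> cf df rf.
have E : fourierR f = fun xi => (twopi ^- n)%:C * fint (- xi) f.
  by apply/funext => xi; exact: fourierRE.
have cF := ccont_fint cf df; have dF := decaying_fint cf df rf.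
rewrite E; split.
- exact: (ccontM (ccont_cst n _) (ccont_opp cF)).
- exact: (decayingM (slowly_growing_cst n _) (decaying_opp dF)).
- by move=> j q; exact: (rapidZ _ (rapid_opp (rapid_fint j q cf df rf))).
Qed.

(** For integer m the phase is 2 pi-periodic and factors out of the periodization sum; the integral
    over the torus then unfolds to the whole space. *)
Lemma fourierT_periodization f (m : Zn) : ccont f -> decaying f ->
  fourierT (periodization f) m = fourierR f (latv m).
Proof.
move=> cf df; rewrite /fourierT /fourierR.
pose G (y : V) := expi (- dot y (latv m)) * f y * (twopi ^- n)%:C.
have cG : continuous (fun y : V => - dot y (latv m)).
  rewrite (_ : (fun y => _) = fun y => - dot (latv m) y).
    by move=> y; exact: (continuousN (@continuous_dot R n (latv m) y)).
  by apply/funext => y; rewrite dotC.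
have iG : cintble setT G.
  rewrite /G (_ : (fun y => _) = fun y => (twopi ^- n)%:C * (expi (- dot y (latv m)) * f y)).
    exact: (cintbleZ _ measurableT (cintble_expi_mul cG cf df)).
  by apply/funext => y; rewrite mulrC.
have [C [C0 hC]] := decaying_sumdecay0 df.
have sf (x : V) : csummable (fun k : Zn => f (x + twopi *: latv k)).
  by apply: csummable_le (rsummableZ C (rsummable_sumdecay x twopi_gt0)) => k.
have GE (x : V) (k : Zn) : G (x + twopi *: latv k) =
    expi (- dot x (latv m)) * (twopi ^- n)%:C * f (x + twopi *: latv k).
  rewrite /G dotDl opprD expiD dotZl dot_latv -mulrN -rmorphN /= expi_twopi_int mulr1.
  by rewrite mulrAC.
have sG (x : V) : csummable (fun k : Zn => G (x + twopi *: latv k)).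
  by move: (funext (GE x)) => ->; exact: csummableZ.
rewrite [RHS](tiling_csum_in twopi_gt0 iG sG); apply: cint_eq => x _.
by move: (funext (GE x)) => ->; rewrite csumZ// mulrAC.
Qed.

(** The phase at x is absorbed into H. Summability of its coefficients follows from the decay of the
    transform of h at the points x + 2 pi k, so no derivative of H is estimated. *)
Lemma periodization_fint h (x : V) : ccont h -> decaying h -> Rapid h ->
  csum (fun k : Zn => fint (x + twopi *: latv k) h) =
  csum (fun m : Zn => expi (dot x (latv m)) * h (latv m)).
Proof.
move=> ch dh rh.
pose H (xi : V) := expi (dot x xi) * h xi.
have [C [C0 hC]] := decaying_sumdecay0 dh.
have cH : ccont H by exact: ccont_fint_integrand.
have hH xi : l1C (H xi) <= 2 * C * sumdecay xi.
  by apply: (le_trans (l1C_expiM _ _)); rewrite -mulrA ler_wpM2l.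
have E (k : Zn) : fint (x + twopi *: latv k) h = fint (twopi *: latv k) H.
  by apply: cint_eq => y _; rewrite /H mulrA -expiD -dotDl addrC.
have [D [D0 hD]] := decaying_sumdecay0 (decaying_fint ch dh rh).
have sE : csummable (fun k : Zn => fint (x + twopi *: latv k) h).
  by apply: csummable_le (rsummableZ D (rsummable_sumdecay x twopi_gt0)) => k.
move: (funext E) => EE; rewrite EE in sE *.
by apply: (poisson_summation cH _ hH sE); rewrite mulr_ge0.
Qed.

End quantization.

Theorem theorem6p4 (R : realType) (n : nat)
    (a : 'rV[R]_n -> 'rV[R]_n -> R[i])
    (a_smooth : smooth2 a)
    (a_periodic : forall (x xi : 'rV[R]_n) (i : 'I_n),
       a (x + twopi *: basis_vec i) xi = a x xi)
    (a_bound : forall alpha beta : 'I_n -> nat, exists C M : R,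
       forall x xi : 'rV[R]_n,
         `| mpartial alpha (fun y => mpartial beta (a y) xi) x |
           <= (C * japanese xi `^ M)%:C)
    (f : 'rV[R]_n -> R[i])
    (f_schwartz : schwartz f) :
  periodization (psdoR a f) = psdoT (symbol_restriction a) (periodization f).
Proof.
have cf := schwartz_ccont f_schwartz.
have df := schwartz_decaying f_schwartz.
have rf := schwartz_Rapid f_schwartz.
have [cF dF rF] := fourierR_props cf df rf.
apply/funext => x.
pose h xi := a x xi * fourierR f xi.
have ch : ccont h by apply: ccontM => //; exact: ccont_symbol0.
have dh : decaying h by apply: decayingM => //; exact: growing_symbol.
have rh : Rapid h by move=> j q; apply: rapidM => //; exact: slow_symbol.
(* By periodicity of the symbol the translation survives only in the phase, so one and the same h
   serves for every k. *)
transitivity (csum (fun k : 'rV[int]_n => fint (x + twopi *: latv k) h)).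
  congr csum; apply/funext => k; apply: cint_eq => xi _.
  by rewrite symbol_periodic// -mulrA.
rewrite periodization_fint// /psdoT; congr csum; apply/funext => m.
by rewrite fourierT_periodization// mulrA.
Qed.
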